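(* Let $n\ge3$ and suppose $\tilde\psi_j$, $j=2,\dots,n$, are constructed using the algorithm described in the context, with $\tilde\psi_0,\tilde\psi_1$ as defined there. Then the set of functions $\{\tilde\psi_j(2^k\cdot-i): i,k\in\mathbf Z,\ j=0,\dots,n\}$ forms an orthogonal, compactly supported, continuous, piecewise polynomial basis for $L^2(\mathbf R)$.
   Context: For functions on $[-1,1]$, $\langle f,g\rangle=\int_{-1}^1 fg$. $p_m^\lambda$ is the monic ultraspherical polynomial of degree $m$, orthogonal on $[-1,1]$ with respect to $(1-x^2)^{\lambda-1/2}$; for $j\ge2$, $\phi^0_j(t)=(1-t^2)\,p_{j-2}^{5/2}(t)$. For $N\ge2$, $P^N$ is the orthogonal projection of $L^2[-1,1]$ onto the polynomials of degree at most $N$ vanishing at $\pm1$; $r_0^N=(I-P^N)(1+t)$. On $[-1,1]$ let $\bar u_M(t)=1-|t|t^{M-1}$ for odd $M\ge1$, $\bar u_M(t)=t-|t|t^{M-1}$ for even $M\ge2$, and $u_{N,N-M}=(I-P^N)\bar u_M$. Let $w_n=\alpha(n)u_{n,0}+u_{n,2}$ with $$\alpha(n)=\frac{2}{n(2n-1)}\left(\frac{(n-2)(2n+1)}{n-1}-2\sqrt3\,\sqrt{\frac{(2n+1)(n+1)}{(2n-3)(n-1)}}\right),$$ and $q_{r_0^n}=r_0^n-\frac{\langle w_n,r_0^n\rangle}{\langle w_n,w_n\rangle}w_n$, $q_{l_0^n}(t)=q_{r_0^n}(-t)$. The scaling functions are: $\tilde\phi_0(t)=q_{r_0^n}(2t+1)$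 for $-1\le t<0$, $q_{l_0^n}(2t-1)$ for $0\le t<1$, $0$ elsewhere; $\tilde\phi_1(t)=w_n(2t-1)$ for $0\le t<1$, $0$ elsewhere; and, for $j=2,\dots,n$, $\tilde\phi_j(t)=\phi^0_j(2t-1)$ for $0\le t<1$, $0$ elsewhere. Put $\Phi_n=(\tilde\phi_0,\dots,\tilde\phi_n)^T$. It generates an orthogonal multiresolution analysis ($V_0$ is the closed $L^2(\mathbf R)$-span of the integer translates of the $\tilde\phi_i$, which are mutually orthogonal; $V_p=\{f(2^p\cdot):f\in V_0\}$, $V_p\subset V_{p+1}$), and $\Phi_n(t)=\sum_{j=-2}^1C_j(n)\Phi_n(2t-j)$, where $C_j(n)=\tilde C_j(n)\,\langle\Phi_n(2\cdot),\Phi_n(2\cdot)\rangle^{-1}$ are $(n+1)\times(n+1)$ matrices, $\tilde C_j(n)=\int_{-\infty}^\infty\Phi_n(t)\Phi_n(2t-j)^T\,dt$, and $\langle\Phi_n(2\cdot),\Phi_n(2\cdot)\rangle=\int_{-\infty}^{\infty}\Phi_n(2t)\Phi_n(2t)^Tdt$; that is, $(C_j(n))_{i,k}=\int\tilde\phi_i(t)\tilde\phi_k(2t-j)\,dt\big/\int\tilde\phi_k(2t)^2\,dt$ for $i,k=0,\dots,n$. Wavelets. With $P_g$ the orthogonal projection of $L^2(\mathbf R)$ onto the span of $g$, $$\tilde\psi_0=(I-P_{\tilde\phi_0})\tilde\phi_0(2\cdot),\qquad \tilde\psi_1=(\chi_{[0,1]}-\chi_{[-1,0]})(I-P_{\tilde\phi_0(2\cdot)})\tilde\phi_0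 .$$ Algorithm for $\tilde\psi_2,\dots,\tilde\psi_n$ (functions supported on $[0,1]$). Let $E(n)=(C_0(n),C_1(n))$, an $(n+1)\times(2n+2)$ matrix. Symmetric case: consider vectors of the form $$p=[0,b_1,\dots,b_n,\,b_0,(-1)^{n+1}b_1,b_2,-b_3,\dots,(-1)^nb_n]^T\in\mathbf R^{2n+2}$$ (the coordinate in the second block corresponding to $b_j$, $j\ge2$, is $(-1)^jb_j$). Find all solutions of $E(n)p=0$ of this form; they form a subspace $M$ of the null space of $E(n)$. If there is more than one free variable, set one of them equal to $1$ and the rest equal to zero; normalize the resulting vector and call it $v_1$. Put $$\tilde\psi_2(t)=v_1^T\begin{pmatrix}\Phi_n(2t)\\ \Phi_n(2t-1)\end{pmatrix}.$$ Next find the subspace of $M$ perpendicular to $v_1$ and repeat the procedure until an orthogonal basis of $M$ is found; each basis vector gives a wavelet by the same formula, symmetric with respect to $t=\frac12$. Antisymmetric case: carry out the same steps with vectors of the form $$p=[0,b_1,\dots,b_n,\,0,(-1)^{n}b_1,-b_2,b_3,\dots,-(-1)^nb_n]^T$$ (the coordinate in the second block corresponding to $b_j$, $j\ge2$, is $-(-1)^jb_j$), giving the wavelets antisymmetric with respect to $t=\frac12$. The functions obtained in the two cases are listed as $\tilde\psi_2,\dots,\tilde\psi_n$.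
   Formalization: In the algorithm (the matrices C_j(n), E(n) and the formula for the wavelets), the vector Φ_n consists of the normalized functions φ̃_k/‖φ̃_k‖; with the unnormalized φ̃_k the claim fails, e.g. for n=3 the antisymmetric wavelet is not orthogonal to ψ̃_0. *)

(* Defs.v *)
(* MathComp / MathComp-Analysis. *)
From HB Require Import structures.
From mathcomp Require Import all_boot all_order all_algebra.
From mathcomp Require Import all_classical all_reals all_analysis.

Set Implicit Arguments.
Unset Strict Implicit.
Unset Printing Implicit Defensive.
Import Order.TTheory GRing.Theory Num.Theory.
Import numFieldNormedType.Exports.
Local Open Scope classical_set_scope.
Local Open Scope ring_scope.

Section Inner.
Context {R : realType}.
Implicit Types (D : set R) (f g : R -> R).

Definition inner D f g : R := \int[lebesgue_measure]_(t in D) (f t * g t).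

(* The orthogonal projection onto S: the element p of S with f - p perpendicular
   to S, chosen by description. *)
Definition oproj D (S : set (R -> R)) f : R -> R :=
  xget (cst 0) [set p | S p /\
    forall q, S q -> inner D (fun t => f t - p t) q = 0].

Definition line g : set (R -> R) := [set h | exists c : R, h = fun t => c * g t].

Definition L2_orthogonal_basis (I : Type) (e : I -> R -> R) : Prop :=
  [/\ forall i, e i \in Lfun lebesgue_measure 2%:E,
      forall i, inner setT (e i) (e i) != 0,
      forall i j, i <> j -> inner setT (e i) (e j) = 0
    & forall f, f \in Lfun lebesgue_measure 2%:E ->
      forall eps : R, 0 < eps ->
      exists (s : seq I) (c : I -> R),
        ('N[lebesgue_measure]_(2%:E)
           [EFin \o (fun t => f t - \sum_(i <- s) c i * e i t)%R] < eps%:E)%E].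

Definition compactly_supported f : Prop := compact (closure [set x | f x != 0]).

Definition piecewise_polynomial f : Prop :=
  exists s : seq R, forall I : set R, is_interval I ->
    (forall x, x \in s -> ~ I x) ->
    exists p : {poly R}, forall x, I x -> f x = p.[x].

End Inner.

Section ScalingFunctions.
Context {R : realType}.
Implicit Types (n N M k m : nat) (t : R).

Definition ultraspherical (lam : R) m : {poly R} :=
  xget 0 [set p | [/\ p \is monic, size p = m.+1 &
    forall q : {poly R}, (size q <= m)%N ->
      \int[lebesgue_measure]_(t in `[(-1)%R, 1%R])
        (p.[t] * q.[t] * (1 - t ^+ 2) `^ (lam - 1 / 2)) = 0 :> R]].

Definition phi0 k t : R := (1 - t ^+ 2) * (ultraspherical (5 / 2) (k - 2)).[t].

Definition bubble N : set (R -> R) := [set h | exists p : {poly R},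
  [/\ (size p <= N.+1)%N, p.[-1] = 0, p.[1] = 0 & h = fun t => p.[t]]].

Definition residual N (f : R -> R) t : R := f t - oproj `[-1, 1] (bubble N) f t.

Definition r0 N : R -> R := residual N (fun t => 1 + t).

Definition ubar M t : R :=
  if odd M then 1 - `|t| * t ^+ (M - 1) else t - `|t| * t ^+ (M - 1).

(* u N k is u_{N,k}, built from ubar_M with M = N - k. *)
Definition u N k : R -> R := residual N (ubar (N - k)).

Definition alpha n : R := let x := n%:R in
  2 / (x * (2 * x - 1)) *
  ((x - 2) * (2 * x + 1) / (x - 1)
   - 2 * Num.sqrt 3 * Num.sqrt ((2 * x + 1) * (x + 1) / ((2 * x - 3) * (x - 1)))).

Definition w n t : R := alpha n * u n 0 t + u n 2 t.

Definition q_r n t : R :=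
  r0 n t - inner `[-1, 1] (w n) (r0 n) / inner `[-1, 1] (w n) (w n) * w n t.

Definition q_l n t : R := q_r n (- t).

Definition phit n k t : R :=
  if k == 0%N then
    if (-1 <= t) && (t < 0) then q_r n (2 * t + 1)
    else if (0 <= t) && (t < 1) then q_l n (2 * t - 1) else 0
  else if (0 <= t) && (t < 1) then
    if k == 1%N then w n (2 * t - 1) else phi0 k (2 * t - 1)
  else 0.

(* The mutually orthogonal functions phit are normalized here.  The algorithm
   below identifies coordinate vectors with functions: a null vector of Emx must
   give a function orthogonal to the scaling functions, and perpendicular
   vectors must give orthogonal functions.  With the functions phit themselves,
   whose norms differ, the construction fails, already for n = 3. *)
Definition Phi n (k : 'I_n.+1) t : R :=
  (Num.sqrt (inner setT (phit n k) (phit n k)))^-1 * phit n k t.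

End ScalingFunctions.

Section Algorithm.
Context {R : realType} (n : nat).
Implicit Types (Ph : 'I_n.+1 -> R -> R).

Definition Ctilde Ph (j : int) : 'M[R]_n.+1 :=
  \matrix_(i, k) inner setT (Ph i) (fun t => Ph k (2 * t - j%:~R)).

Definition Gram2 Ph : 'M[R]_n.+1 :=
  \matrix_(i, k) inner setT (fun t => Ph i (2 * t)) (fun t => Ph k (2 * t)).

Definition Cmx Ph (j : int) : 'M[R]_n.+1 := Ctilde Ph j *m invmx (Gram2 Ph).

Definition Emx Ph : 'M[R]_(n.+1, n.+1 + n.+1) := row_mx (Cmx Ph 0) (Cmx Ph 1).

Definition combination Ph (p : 'cV[R]_(n.+1 + n.+1)) (t : R) : R :=
  (p^T *m col_mx (\col_k Ph k (2 * t)) (\col_k Ph k (2 * t - 1))) 0 0.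

Definition sym_form (b : 'cV[R]_n.+1) : 'cV[R]_(n.+1 + n.+1) :=
  col_mx (\col_(j < n.+1) if j == 0%N :> nat then 0 else b j 0)
         (\col_(j < n.+1) if j == 0%N :> nat then b j 0
                          else if j == 1%N :> nat then (-1) ^+ n.+1 * b j 0
                          else (-1) ^+ j * b j 0).

(* The unknowns are b_1, ..., b_n; here b_j is the entry of index j - 1. *)
Definition antisym_form (b : 'cV[R]_n) : 'cV[R]_(n.+1 + n.+1) :=
  let b' (j : 'I_n.+1) := if unlift ord0 j is Some i then b i 0 else 0 in
  col_mx (\col_j b' j)
         (\col_(j < n.+1) if j == 0%N :> nat then 0
                          else if j == 1%N :> nat then (-1) ^+ n * b' j
                          else - ((-1) ^+ j * b' j)).

Definition normalize (p : 'cV[R]_(n.+1 + n.+1)) :=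
  (Num.sqrt ((p^T *m p) 0 0))^-1 *: p.

Section Run.
Variables (m : nat) (form : 'cV[R]_m -> 'cV[R]_(n.+1 + n.+1)).
Variable (A : 'M[R]_(n.+1, n.+1 + n.+1)).

Definition solutions (vs : seq 'cV[R]_(n.+1 + n.+1)) : set 'cV[R]_m :=
  [set b | A *m form b = 0 /\ forall v, v \in vs -> v^T *m form b = 0].

Definition free_variables (S : set 'cV[R]_m) (F : {set 'I_m}) : Prop :=
  forall c : 'cV[R]_m, exists! b, S b /\ forall i, i \in F -> b i 0 = c i 0.

Definition selects (S : set 'cV[R]_m) (v : 'cV[R]_(n.+1 + n.+1)) : Prop :=
  exists (F : {set 'I_m}) (i : 'I_m) (b : 'cV[R]_m),
    [/\ free_variables S F, i \in F, S b,
        forall j, j \in F -> b j 0 = (j == i)%:R & v = normalize (form b)].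

(* The choices of free variables are left open: any vs that some sequence of
   choices produces is a run. *)
Definition algorithm_run (vs : seq 'cV[R]_(n.+1 + n.+1)) : Prop :=
  (forall k, (k < size vs)%N -> selects (solutions (take k vs)) (nth 0 vs k))
  /\ solutions vs = [set 0].

End Run.

Definition psi0 (t : R) : R :=
  let f := phit n 0 in let g := fun s => f (2 * s) in
  g t - oproj setT (line f) g t.

Definition psi1 (t : R) : R :=
  let f := phit n 0 in let g := fun s => f (2 * s) in
  (\1_(`[0, 1] : set R) t - \1_(`[-1, 0] : set R) t)
    * (f t - oproj setT (line g) f t).

Definition psi (vs va : seq 'cV[R]_(n.+1 + n.+1)) (j : nat) : R -> R :=
  nth (cst 0) ([:: psi0; psi1] ++ [seq combination (@Phi R n) v | v <- vs ++ va]) j.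

End Algorithm.

(* Main.v *)
(* V_0 consists of the compactly supported continuous functions that, on every
   cell [i, i+1], are a polynomial of degree at most n plus a multiple of the
   rescaled w_n; as w_n is polynomial on each half of its interval, V_0 is
   contained in V_1.  The generators are orthogonal because <q_r, q_l> = 0: the
   Mellin transform of the part of w_n orthogonal to the polynomials of degree
   at most n is a rational function with known zeros and poles, so its norm is
   explicit, and alpha(n) is a root of the resulting quadratic equation.

   Only phit_0 is nonzero at integers, so <F, phit_0> is proportional to F(0) for
   F in V_0.  Hence psi_0 and psi_1 = xi - xi(-.), with xi the right half of
   phit_0 - phit_0(2.), are orthogonal to V_0.  In R^(2n+2), the vectors of
   phit_0(2.), phit_1, ..., phit_n, xi and xi(1-.), together with the output of
   the algorithm, form an orthogonal basis: symmetric and antisymmetric vectors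
   exhaust the complement.  This counts the wavelets and gives
   V_1 = V_0 + W_0 with W_0 spanned by the translates of the psi_j.

   For completeness in L^2, approximate by a continuous function of compact
   support, then by a piecewise linear function in some V_p, and split off
   wavelets until the remainder, in V_{p-q}, has norm O(2^{-q/2}). *)

(* The generators are continuous with compact support, so the argument runs among such functions,
   where every expansion is a finite sum; approximation in L^2 enters only for completeness.

   The obstacle is [<q_r, q_l> = 0], the one place where the value of [alpha n] counts. As [w] is
   even or odd, its inner products with [r_0] and with the mirror image of [r_0] agree up to sign,
   and the claim becomes the scalar identity [<w, r_0>^2 / <w, w> = 8 / (n (n+1) (n+2))].
   Subtracting from [w] a multiple of the part of [r_0] with the parity of [w] leaves a function [g]
   orthogonal to all polynomials of degree at most [n], and the identity turns into
   [(n+1) <g, g> = 2 g(1)^2]. On [[0, 1]], [g] is a polynomial whose exponents have one parity,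
   apart from terms in [t^n] and [t^(n-2)]. Both sides then depend only on the moments of [g]
   against these two monomials, and the Mellin transform gives the ratio of the moments. *)
Require Import Defs.
From mathcomp Require Import all_boot all_order all_algebra.
From mathcomp Require Import all_classical all_reals all_analysis.
From mathcomp Require Import measurable_realfun.
From mathcomp Require Import ring lra zify.
Set Implicit Arguments.
Unset Strict Implicit.
Unset Printing Implicit Defensive.
Import Order.TTheory GRing.Theory Num.Theory.
Import numFieldNormedType.Exports.
Local Open Scope classical_set_scope.
Local Open Scope ring_scope.

(** * Integrals on segments *)

Section SegmentIntegral.
Context {R : realType}.
Notation mu := (@lebesgue_measure R).
Implicit Types (f g h : R -> R) (a b c k : R) (p : {poly R}).

Definition itg a b f : R := \int[mu]_(t in `[a, b]) f t.

Lemma cont_integrable a b f : continuous f ->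
  mu.-integrable `[a, b] (EFin \o f).
Proof.
move=> cf; apply: continuous_compact_integrable; first exact: segment_compact.
exact: continuous_subspaceT.
Qed.

Lemma eq_itg a b f g : (forall t, a <= t <= b -> f t = g t) ->
  itg a b f = itg a b g.
Proof.
move=> fg; apply: eq_Rintegral => t; rewrite inE/= in_itv/=; exact: fg.
Qed.

Lemma itgD a b f g : continuous f -> continuous g ->
  itg a b (fun t => f t + g t) = itg a b f + itg a b g.
Proof. by move=> cf cg; apply: RintegralD => //; exact: cont_integrable. Qed.

Lemma itgZ a b k f : continuous f -> itg a b (fun t => k * f t) = k * itg a b f.
Proof. by move=> cf; apply: RintegralZl => //; exact: cont_integrable. Qed.

Lemma continuousZf k f : continuous f -> continuous (fun t => k * f t).
Proof. by move=> cf t; apply: continuousM; [exact: cst_continuous|exact: cf]. Qed.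

Lemma continuousDf f g : continuous f -> continuous g ->
  continuous (fun t => f t + g t).
Proof. by move=> cf cg t; apply: continuousD; [exact: cf|exact: cg]. Qed.

Lemma continuousBf f g : continuous f -> continuous g ->
  continuous (fun t => f t - g t).
Proof. by move=> cf cg t; apply: continuousB; [exact: cf|exact: cg]. Qed.

Lemma continuousMf f g : continuous f -> continuous g ->
  continuous (fun t => f t * g t).
Proof. by move=> cf cg t; apply: continuousM; [exact: cf|exact: cg]. Qed.

Lemma continuous_sumf (I : Type) (s : seq I) (F : I -> R -> R) :
  (forall i, continuous (F i)) -> continuous (fun t => \sum_(i <- s) F i t).
Proof.
move=> cF; elim: s => [|i s IH].
  by under eq_fun do rewrite big_nil; exact: cst_continuous.
by under eq_fun do rewrite big_cons; exact: continuousDf.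
Qed.

Lemma continuous_affine k c : continuous (fun t : R => k * t + c).
Proof.
by move=> t; apply: continuousD; [apply: continuousM; [exact: cst_continuous|]|exact: cst_continuous].
Qed.

Lemma continuous_compf f g : continuous f -> continuous g ->
  continuous (fun t => f (g t)).
Proof. by move=> cf cg t; apply: continuous_comp; [exact: cg|exact: cf]. Qed.

Lemma itg_split a b c f : continuous f -> a <= b -> b <= c ->
  itg a c f = itg a b f + itg b c f.
Proof.
move=> cf ab bc; apply/eqP; rewrite addrC -subr_eq; apply/eqP.
rewrite /itg (@Rintegral_itvB R f (BLeft a) (BRight c) b).
- by rewrite Rintegral_itv_obnd_cbnd//; apply: integrableS (cont_integrable b c cf) => //;
    exact: subset_itv_oc_cc.
- exact: cont_integrable.
- by rewrite bnd_simp.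
- by rewrite bnd_simp.
Qed.

Lemma itg_affine a b k c f : continuous f -> a <= b -> 0 < k ->
  itg (k * a + c) (k * b + c) f = k * itg a b (fun t => f (k * t + c)).
Proof.
move=> cf ab k0; pose F : R -> R := fun t => k * t + c.
have dF (t : R) : is_derive t 1 F k.
  by apply: is_derive_eq; rewrite addr0 /GRing.scale/= mulr1.
have F' : F^`()%classic = cst k.
  by apply/funext => t; rewrite derive1E; exact: derive_val.
rewrite -itgZ; last by apply: continuous_compf => //; exact: continuous_affine.
rewrite /itg /Rintegral; congr fine.
rewrite (@integration_by_substitution_increasing R F f a b)//.
- by apply: eq_integral => t _; rewrite F' /= mulrC.
- by move=> x y _ _ xy; rewrite /F ltrD2r ltr_pM2l.
- by rewrite F'; move=> ? ?; exact: cst_continuous.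
- by rewrite F'; exact: is_cvg_cst.
- by rewrite F'; exact: is_cvg_cst.
- split => [x _|//|].
  + exact: ex_derive.
  + by apply: cvg_at_right_filter; exact: continuous_affine.
  + by apply: cvg_at_left_filter; exact: continuous_affine.
- exact: continuous_subspaceT.
Qed.

Lemma itg_opp a b f : continuous f -> a <= b ->
  itg (- b) (- a) f = itg a b (fun t => f (- t)).
Proof.
move=> cf ab; rewrite /itg /Rintegral; congr fine.
rewrite integration_by_substitution_oppr//.
exact: continuous_subspaceT.
Qed.

Lemma itg_ge0 a b f : (forall t, a <= t <= b -> 0 <= f t) -> 0 <= itg a b f.
Proof.
by move=> f0; apply: Rintegral_ge0 => t /=; rewrite in_itv/=; exact: f0.
Qed.

Lemma le_itg a b f g : continuous f -> continuous g ->
  (forall t, a <= t <= b -> f t <= g t) -> itg a b f <= itg a b g.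
Proof.
move=> cf cg fg; apply: le_Rintegral => //; exact: cont_integrable.
Qed.

Lemma itg_cst a b c : a <= b -> itg a b (fun=> c) = c * (b - a).
Proof.
rewrite le_eqVlt => /predU1P[->|ab].
  by rewrite /itg set_itv1 Rintegral_set1 subrr mulr0.
by rewrite /itg Rintegral_cst//= lebesgue_measure_itv/= lte_fin ab.
Qed.

Lemma itg_gt0 a b f : continuous f -> a < b ->
  (forall t, a <= t <= b -> 0 < f t) -> 0 < itg a b f.
Proof.
move=> cf ab f0.
have [c cab fc] : exists2 c, c \in `[a, b]%R & forall t, t \in `[a, b]%R -> f c <= f t.
  by apply: EVT_min; [exact: ltW|exact: continuous_subspaceT].
apply: (@lt_le_trans _ _ (f c * (b - a))).
  by rewrite mulr_gt0 ?subr_gt0 ?f0.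
rewrite -itg_cst ?(ltW ab)//; apply: le_itg => //; first exact: cst_continuous.
Qed.

(** A positive value at an interior point persists on a small segment and makes the integral
    positive; the endpoints follow because they are limits of interior points. *)
Lemma itg_eq0 a b f : continuous f -> a < b ->
  (forall t, a <= t <= b -> 0 <= f t) -> itg a b f = 0 ->
  forall t, a <= t <= b -> f t = 0.
Proof.
move=> cf ab f0 I0.
have posI x : a < x < b -> f x = 0.
  move=> /andP[ax xb]; apply: contrapT => /eqP fx.
  have {}fx : 0 < f x by rewrite lt_neqAle eq_sym fx f0// !ltW.
  have : \forall y \near x, 0 < f y.
    by apply: (cvgr_gt _ (cf x)).
  case=> e /= e0 He; pose d := Num.min (e / 2) (Num.min (x - a) (b - x)).
  have d0 : 0 < d by rewrite /d !lt_min divr_gt0//= !subr_gt0 ax xb.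
  have [de [da db]] : d <= e / 2 /\ (d <= x - a /\ d <= b - x).
    by rewrite /d; split; [|split]; rewrite !ge_min lexx ?orbT.
  clearbody d.
  have P1 : 0 < itg (x - d) (x + d) f.
    apply: itg_gt0 => //; first by lra.
    move=> t /andP[t1 t2]; apply: He; rewrite /= ltr_norml; apply/andP; split; lra.
  have S1 : itg a b f = itg a (x - d) f + itg (x - d) b f by apply: itg_split => //; lra.
  have S2 : itg (x - d) b f = itg (x - d) (x + d) f + itg (x + d) b f.
    by apply: itg_split => //; lra.
  have P0 : 0 <= itg a (x - d) f.
    by apply: itg_ge0 => t /andP[t1 t2]; apply: f0; apply/andP; split; lra.
  have P2 : 0 <= itg (x + d) b f.
    by apply: itg_ge0 => t /andP[t1 t2]; apply: f0; apply/andP; split; lra.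
  lra.
have dense x e : a <= x <= b -> 0 < e -> exists2 y, `|x - y| < e & a < y < b.
  move=> /andP[ax xb] e0; pose m := (a + b) / 2.
  pose s := Num.min (1 / 2) (e / (b - a)).
  have ba0 : 0 < b - a by rewrite subr_gt0.
  have s0 : 0 < s by rewrite /s lt_min; apply/andP; split; [lra|exact: divr_gt0].
  have s1 : s <= 1 / 2 by rewrite /s ge_min lexx.
  have s2 : s * (b - a) <= e by rewrite -ler_pdivlMr// /s ge_min lexx orbT.
  exists (x + s * (m - x)); last by rewrite /m; apply/andP; split; nra.
  rewrite opprD addrA subrr sub0r normrN normrM gtr0_norm//.
  have : `|m - x| <= (b - a) / 2 by rewrite ler_norml /m; apply/andP; split; lra.
  by move=> ?; nra.
move=> x xab; apply: contrapT => /eqP fx.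
have {}fx : 0 < f x by rewrite lt_neqAle eq_sym fx f0.
have : \forall y \near x, 0 < f y by apply: (cvgr_gt _ (cf x)).
case=> e /= e0 He; have [y xy yab] := dense x e xab e0.
have := He y xy; rewrite posI// ltxx//.
Qed.

Lemma itg_deriv_poly a b p : a <= b -> itg a b (fun t => p^`().[t]) = p.[b] - p.[a].
Proof.
rewrite le_eqVlt => /predU1P[->|ab].
  by rewrite /itg set_itv1 Rintegral_set1 subrr.
rewrite /itg /Rintegral (@continuous_FTC2 R _ (fun t => p.[t]) a b)//.
- by apply: continuous_subspaceT; exact: continuous_horner.
- split => [x _||].
  + exact: derivable_horner.
  + by apply: cvg_at_right_filter; exact: continuous_horner.
  + by apply: cvg_at_left_filter; exact: continuous_horner.
- by move=> x _; rewrite -derivE.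
Qed.

End SegmentIntegral.

(** * Orthogonal polynomials *)

Section InnerSegment.
Context {R : realType}.
Implicit Types (f g h : R -> R) (a b c k : R) (p q : {poly R}).

Lemma innerE a b f g : inner `[a, b] f g = itg a b (fun t => f t * g t).
Proof. by []. Qed.

Lemma innerC (D : set R) f g : inner D f g = inner D g f.
Proof. by rewrite /inner; under eq_Rintegral do rewrite mulrC. Qed.

Lemma eq_inner a b f g f' g' : (forall t, a <= t <= b -> f t = f' t) ->
  (forall t, a <= t <= b -> g t = g' t) ->
  inner `[a, b] f g = inner `[a, b] f' g'.
Proof. by move=> ff gg; apply: eq_itg => t tab; rewrite ff ?gg. Qed.

Lemma innerDl a b f g h : continuous f -> continuous g -> continuous h ->
  inner `[a, b] (fun t => f t + g t) h = inner `[a, b] f h + inner `[a, b] g h.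
Proof.
move=> cf cg ch; rewrite !innerE -itgD; try exact: continuousMf.
by apply: eq_itg => t _; rewrite mulrDl.
Qed.

Lemma innerZl a b k f h : continuous f -> continuous h ->
  inner `[a, b] (fun t => k * f t) h = k * inner `[a, b] f h.
Proof.
move=> cf ch; rewrite !innerE -itgZ; last exact: continuousMf.
by apply: eq_itg => t _; rewrite mulrA.
Qed.

Lemma innerDr a b f g h : continuous f -> continuous g -> continuous h ->
  inner `[a, b] h (fun t => f t + g t) = inner `[a, b] h f + inner `[a, b] h g.
Proof. by move=> *; rewrite innerC innerDl// innerC [X in _ + X]innerC. Qed.

Lemma innerZr a b k f h : continuous f -> continuous h ->
  inner `[a, b] h (fun t => k * f t) = k * inner `[a, b] h f.
Proof. by move=> *; rewrite innerC innerZl// innerC. Qed.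

Lemma inner0l a b h : inner `[a, b] (fun=> 0) h = 0.
Proof.
rewrite innerE /itg; under eq_Rintegral do rewrite mul0r.
by rewrite /Rintegral integral0.
Qed.

Lemma inner_suml a b (I : Type) (s : seq I) (F : I -> R -> R) h :
  (forall i, continuous (F i)) -> continuous h ->
  inner `[a, b] (fun t => \sum_(i <- s) F i t) h = \sum_(i <- s) inner `[a, b] (F i) h.
Proof.
move=> cF ch; elim: s => [|i s IH].
  rewrite big_nil -[RHS](inner0l a b h); congr inner.
  by apply/funext => t; rewrite big_nil.
have -> : (fun t => \sum_(j <- i :: s) F j t) = fun t => F i t + \sum_(j <- s) F j t.
  by apply/funext => t; rewrite big_cons.
rewrite innerDl ?IH ?big_cons//; exact: continuous_sumf.
Qed.

Lemma inner_sumr a b (I : Type) (s : seq I) (F : I -> R -> R) h :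
  (forall i, continuous (F i)) -> continuous h ->
  inner `[a, b] h (fun t => \sum_(i <- s) F i t) = \sum_(i <- s) inner `[a, b] h (F i).
Proof.
by move=> cF ch; rewrite innerC inner_suml//; apply: eq_bigr => i _; exact: innerC.
Qed.

Lemma inner_ge0 (D : set R) f : 0 <= inner D f f.
Proof. by apply: Rintegral_ge0 => t _; rewrite -expr2 sqr_ge0. Qed.

Lemma inner_eq0 a b f : continuous f -> a < b -> inner `[a, b] f f = 0 ->
  forall t, a <= t <= b -> f t = 0.
Proof.
move=> cf ab I0 t tab; apply/eqP; rewrite -sqrf_eq0 expr2; apply/eqP.
apply: (itg_eq0 (f := fun t => f t * f t)) tab => //; first exact: continuousMf.
by move=> x _; rewrite -expr2 sqr_ge0.
Qed.

Lemma inner_flip f g : continuous f -> continuous g ->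
  inner `[(-1), 1] (fun t => f (- t)) (fun t => g (- t)) = inner `[(-1), 1] f g.
Proof.
move=> cf cg; rewrite !innerE; have := @itg_opp R (-1) 1 (fun t => f t * g t).
by rewrite opprK => -> //; exact: continuousMf.
Qed.

Lemma inner_even f g : continuous f -> continuous g ->
  (forall t, f (- t) * g (- t) = f t * g t) ->
  inner `[(-1), 1] f g = 2 * inner `[0, 1] f g.
Proof.
move=> cf cg fg; rewrite !innerE (@itg_split _ _ 0) ?lerN10 ?ler01//; last first.
  exact: continuousMf.
have -> : itg (-1) 0 (fun t => f t * g t) = itg 0 1 (fun t => f (- t) * g (- t)).
  by rewrite -(itg_opp (continuousMf cf cg)) ?ler01// oppr0.
rewrite mulr_natl mulr2n; congr (_ + _).
by apply: eq_itg => t _; rewrite fg.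
Qed.

(** A nonzero polynomial has fewer roots than its size, while the points [a + (b - a) / (k + 1)]
    supply [size p] of them. *)
Lemma poly_eq0_itv a b p : a < b -> (forall t, a <= t <= b -> p.[t] = 0) -> p = 0.
Proof.
move=> ab p0; apply/eqP; apply: contraT => pn0.
pose rs := [seq a + (b - a) / k.+1%:R | k : nat <- iota 0 (size p)].
have : (size rs < size p)%N.
  apply: max_poly_roots => //.
    apply/allP => x /mapP[k _ ->]; apply/rootP; apply: p0.
    have k0 : 0 < k.+1%:R :> R by rewrite ltr0n.
    have ba : 0 < b - a by rewrite subr_gt0.
    rewrite lerDl divr_ge0 ?(ltW ba) ?(ltW k0)//= addrC -lerBrDr ler_pdivrMr//.
    by rewrite ler_peMr ?(ltW ba)// ler1n.
  rewrite map_inj_uniq ?iota_uniq// => i j /addrI/mulfI.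
  rewrite subr_eq0 gt_eqF// => /(_ isT)/invr_inj/eqP.
  by rewrite eqr_nat => /eqP[].
by rewrite size_map size_iota ltnn.
Qed.

Lemma inner_poly_eq0 a b p : a < b -> inner `[a, b] (horner p) (horner p) = 0 -> p = 0.
Proof.
move=> ab I0; apply: (poly_eq0_itv ab) => t.
by apply: inner_eq0 => //; exact: continuous_horner.
Qed.

End InnerSegment.

(** * Expansion in a family with one monic polynomial of each degree *)

Section MonicFamilies.
Context {F : fieldType}.
Implicit Types (p q : {poly F}) (P : nat -> {poly F}).

Lemma monic_family_span P m q : (forall k, (k < m)%N -> P k \is monic) ->
  (forall k, (k < m)%N -> size (P k) = k.+1) -> (size q <= m)%N ->
  exists c : nat -> F, q = \sum_(k < m) c k *: P k.
Proof.
elim: m q => [|m IH] q mP sP sq.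
  exists (fun=> 0); rewrite big_ord0; apply/eqP; by rewrite -size_poly_leq0.
have [|c qE] := IH (q - q`_m *: P m) (fun k km => mP k (ltnW km)) (fun k km => sP k (ltnW km)).
  apply/leq_sizeP => j; rewrite leq_eqVlt => /predU1P[<-|mj].
    have := mP m (ltnSn m); rewrite monicE lead_coefE sP//= => /eqP Pm.
    by rewrite coefB coefZ Pm mulr1 subrr.
  rewrite coefB coefZ [q`_j]nth_default ?(leq_trans sq)//.
  by rewrite [(P m)`_j]nth_default ?sP// mulr0 subrr.
exists (fun k => if k == m then q`_m else c k).
rewrite big_ord_recr/= eqxx; apply/eqP; rewrite -subr_eq qE; apply/eqP.
by apply: eq_bigr => i _; rewrite (ltn_eqF (ltn_ord i)).
Qed.

End MonicFamilies.

Section Flip.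
Context {R : idomainType}.
Implicit Types (p : {poly R}) (t : R).

Definition pflip p : {poly R} := p \Po (- 'X).

Lemma horner_pflip p t : (pflip p).[t] = p.[- t].
Proof. by rewrite horner_comp !hornerE. Qed.

Lemma pflipK p : pflip (pflip p) = p.
Proof.
rewrite /pflip -comp_polyA; have -> : - 'X \Po - 'X = 'X :> {poly R}.
  by rewrite raddfN/= comp_polyX opprK.
by rewrite comp_polyXr.
Qed.

Lemma size_pflip p : size (pflip p) = size p.
Proof. by rewrite size_comp_poly2// size_polyN size_polyX. Qed.

End Flip.

(** * Gram-Schmidt for a definite symmetric form on polynomials *)

Section OrthogonalPolynomials.
Context {R : realFieldType} (B : {poly R} -> {poly R} -> R).
Hypothesis BC : forall p q, B p q = B q p.
Hypothesis BD : forall k p p' q, B (k *: p + p') q = k * B p q + B p' q.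
Hypothesis B0 : forall p, B p p = 0 -> p = 0.
Implicit Types (p q : {poly R}).

Let B0l q : B 0 q = 0.
Proof. by have := BD 1 0 0 q; rewrite scaler0 addr0 mul1r => H; lra. Qed.

Lemma form_suml (I : Type) (s : seq I) (c : I -> R) (P : I -> {poly R}) q :
  B (\sum_(i <- s) c i *: P i) q = \sum_(i <- s) c i * B (P i) q.
Proof. by elim: s => [|i s IH]; rewrite ?big_nil ?B0l// !big_cons BD IH. Qed.

Definition monic_orthogonal m p := [/\ p \is monic, size p = m.+1 &
  forall q, (size q <= m)%N -> B p q = 0].

(** Gram-Schmidt on the monomials. The induction carries a whole family [P], valid below the current
    degree, because [p] subtracts from ['X^m] its projections onto all earlier members. *)
Lemma monic_orthogonal_exists m : exists p, monic_orthogonal m p.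
Proof.
suff [P HP] : exists P : nat -> {poly R}, forall k, (k < m.+1)%N -> monic_orthogonal k (P k).
  by exists (P m); exact: HP.
elim: m.+1 => {m} [|m [P HP]]; first by exists (fun=> 0).
pose p := 'X^m - \sum_(k < m) (B 'X^m (P k) / B (P k) (P k)) *: P k.
have sS : (size (\sum_(k < m) (B 'X^m (P k) / B (P k) (P k)) *: P k)%R < size ('X^m : {poly R}))%N.
  rewrite size_polyXn ltnS; apply: (leq_trans (size_sum _ _ _)).
  apply/bigmax_leqP => k _; apply: (leq_trans (size_scale_leq _ _)).
  by have [_ -> _] := HP k (ltn_ord k).
have Pn0 (k : nat) : (k < m)%N -> B (P k) (P k) != 0.
  move=> km; apply/negP => /eqP/B0 Pk; have [_] := HP k km.
  by rewrite Pk size_poly0.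
exists (fun k => if k == m then p else P k) => k; rewrite ltnS leq_eqVlt.
move=> /predU1P[->|km]; last by rewrite (ltn_eqF km); exact: HP.
rewrite eqxx; split.
- by rewrite monicE lead_coefDl ?size_polyN// lead_coefXn.
- by rewrite size_polyDl ?size_polyN// size_polyXn.
move=> q sq; have [i im|i im|c ->] := @monic_family_span _ P m q _ _ sq.
- by have [] := HP i im.
- by have [] := HP i im.
rewrite BC form_suml big1// => j _; rewrite BC /p addrC -scaleN1r BD form_suml.
rewrite (bigD1 j)//= big1 => [|i ij].
  by rewrite divfK ?Pn0// addr0 mulN1r addNr mulr0.
have {}ij : i != j :> nat by [].
suff -> : B (P i) (P j) = 0 by rewrite mulr0.
have [_ si Hi] := HP i (ltn_ord i); have [_ sj Hj] := HP j (ltn_ord j).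
move: ij; rewrite neq_ltn => /orP[ij|ji]; last by apply: Hi; rewrite sj.
by rewrite BC; apply: Hj; rewrite si.
Qed.

Lemma monic_orthogonal_uniq m p q : monic_orthogonal m p ->
  monic_orthogonal m q -> p = q.
Proof.
move=> [p1 p2 p3] [q1 q2 q3].
have spq : (size (p - q)%R <= m)%N.
  apply/leq_sizeP => j; rewrite leq_eqVlt => /predU1P[<-|mj].
    move: p1 q1; rewrite !monicE !lead_coefE p2 q2 /= => /eqP p1 /eqP q1.
    by rewrite coefB p1 q1 subrr.
  by rewrite coefB !nth_default ?subrr ?p2 ?q2.
apply/eqP; rewrite -subr_eq0; apply/eqP/B0.
have -> : B (p - q) (p - q) = B (- 1 *: q + p) (p - q).
  by rewrite scaleN1r addrC.
by rewrite BD p3// q3// mulr0 addr0.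
Qed.

(** The flipped polynomial, with its leading coefficient corrected by [(-1)^m], is again monic and
    orthogonal, so uniqueness identifies it with [p]. *)
Lemma monic_orthogonal_flip m p :
  (forall p q, B (pflip p) (pflip q) = B p q) ->
  monic_orthogonal m p -> (-1) ^+ m *: pflip p = p.
Proof.
move=> Bflip Hp; apply: (monic_orthogonal_uniq (m := m)) => //.
have [u1 u2 u3] := Hp; split.
- rewrite monicE lead_coefZ lead_coef_comp ?size_polyN ?size_polyX//.
  move: u1; rewrite monicE => /eqP ->; rewrite lead_coefN lead_coefX u2 /=.
  by rewrite mul1r -exprMn mulrN1 opprK expr1n.
- by rewrite size_scale ?signr_eq0// size_pflip.
move=> q sq; rewrite -[q]pflipK -[_ *: _]addr0.
by rewrite BD Bflip B0l u3 ?size_pflip// mulr0 add0r.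
Qed.

End OrthogonalPolynomials.

(** * The bubble functions and their projection *)

Section Bubbles.
Context {R : realType}.
Implicit Types (f g h : R -> R) (p q : {poly R}) (t : R).
Local Notation ip := (inner `[(-1)%R, 1%R]).

Lemma horner_1mX2 t : (1 - 'X^2 : {poly R}).[t] = 1 - t ^+ 2.
Proof. by rewrite hornerD hornerN hornerXn hornerC. Qed.

(** The weight exponent is [5/2 - 1/2 = 2], so this is the ultraspherical form, and also the L^2
    inner product of the bubbles [(1 - t^2) p] and [(1 - t^2) q]. *)
Definition gegen_form p q : R := itg (-1) 1 (fun t => p.[t] * q.[t] * (1 - t ^+ 2) ^+ 2).

Lemma gegen_formE p q :
  gegen_form p q = ip (horner ((1 - 'X^2) * p)) (horner ((1 - 'X^2) * q)).
Proof. by rewrite innerE; apply: eq_itg => t _; rewrite !hornerM horner_1mX2; ring. Qed.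

Lemma gegen_formC p q : gegen_form p q = gegen_form q p.
Proof. by rewrite !gegen_formE innerC. Qed.

Lemma gegen_formD k p p' q : gegen_form (k *: p + p') q = k * gegen_form p q + gegen_form p' q.
Proof.
rewrite !gegen_formE -innerZl; try exact: continuous_horner.
rewrite -innerDl; try exact: continuous_horner; last first.
  by apply: continuousZf; exact: continuous_horner.
by apply: eq_inner => // t _; rewrite !hornerM horner_1mX2 hornerD hornerZ; ring.
Qed.

Lemma one_subX2_neq0 : (1 - 'X^2 : {poly R}) != 0.
Proof.
apply/eqP => /(congr1 (horner^~ 0)); rewrite !hornerE expr0n subr0.
exact/eqP/oner_neq0.
Qed.

Lemma ltN11R : (-1 : R) < 1. Proof. by lra. Qed.

Lemma gegen_form0 p : gegen_form p p = 0 -> p = 0.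
Proof.
rewrite gegen_formE => /(inner_poly_eq0 ltN11R)/eqP.
by rewrite mulf_eq0 (negbTE one_subX2_neq0) => /eqP.
Qed.

Local Notation usp m := (ultraspherical (5 / 2 : R) m).

Lemma ultrasphericalP m : monic_orthogonal gegen_form m (usp m).
Proof.
have E p q : gegen_form p q = \int[lebesgue_measure]_(t in `[(-1)%R, 1%R])
        (p.[t] * q.[t] * (1 - t ^+ 2) `^ (5 / 2 - 1 / 2)).
  apply: eq_itg => t /andP[t1 t2]; congr (_ * _).
  have -> : 5 / 2 - 1 / 2 = 2%:R :> R by field.
  by rewrite powR_mulrn//; nra.
have [p [p1 p2 p3]] := monic_orthogonal_exists gegen_formC gegen_formD gegen_form0 m.
rewrite /ultraspherical; case: xgetP => [q _ [q1 q2 q3]|/(_ p)[]].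
  by split=> // r sr; rewrite E; exact: q3.
by split => // q sq; rewrite -E; exact: p3.
Qed.

Lemma usp_neq0 m : usp m != 0.
Proof. by have [/monic_neq0] := ultrasphericalP m. Qed.

Lemma gegen_form_flip p q : gegen_form (pflip p) (pflip q) = gegen_form p q.
Proof.
rewrite !gegen_formE -[RHS]inner_flip; try exact: continuous_horner.
by apply: eq_inner => t _; rewrite !hornerM !horner_1mX2 horner_pflip; ring.
Qed.

Lemma usp_flip m t : (usp m).[- t] = (-1) ^+ m * (usp m).[t].
Proof.
have H := monic_orthogonal_flip gegen_formC gegen_formD gegen_form0 gegen_form_flip (ultrasphericalP m).
rewrite -[in RHS]H hornerZ horner_pflip mulrA -exprMn mulrN1 opprK.
by rewrite expr1n mul1r.
Qed.

Definition phip k : {poly R} := (1 - 'X^2) * usp (k - 2).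

Lemma phi0E k : phi0 k = horner (phip k) :> (R -> R).
Proof. by apply/funext => t; rewrite /phi0 /phip !hornerE. Qed.

Lemma continuous_phi0 k : continuous (phi0 k : R -> R).
Proof. by rewrite phi0E; exact: continuous_horner. Qed.

Lemma phi0_flip k t : (2 <= k)%N -> phi0 k (- t) = (-1) ^+ k * phi0 k t.
Proof.
move=> k2; rewrite /phi0 usp_flip sqrrN.
have -> : (-1) ^+ k = (-1) ^+ (k - 2) :> R by rewrite -{1}(subnK k2) exprD sqrrN expr1n mulr1.
by ring.
Qed.

Lemma phi0_at1 k : phi0 k 1 = 0 :> R.
Proof. by rewrite /phi0 expr1n subrr mul0r. Qed.

Lemma phi0_atN1 k : phi0 k (-1) = 0 :> R.
Proof. by rewrite /phi0 sqrrN expr1n subrr mul0r. Qed.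

Lemma phi0_orth j k : (2 <= j)%N -> (2 <= k)%N -> j != k -> ip (phi0 j) (phi0 k) = 0 :> R.
Proof.
move=> j2 k2 jk; rewrite !phi0E -gegen_formE.
have : (j - 2 != k - 2)%N by lia.
have [_ sj Hj] := ultrasphericalP (j - 2); have [_ sk Hk] := ultrasphericalP (k - 2).
by rewrite neq_ltn => /orP[?|?]; [rewrite gegen_formC Hk ?sj|rewrite Hj ?sk].
Qed.

Lemma phi0_norm_neq0 k : ip (phi0 k) (phi0 k) != 0 :> R.
Proof.
rewrite !phi0E -gegen_formE; apply/eqP => /gegen_form0/eqP.
by rewrite (negbTE (usp_neq0 _)).
Qed.

Definition isbub N p := [/\ (size p <= N.+1)%N, p.[-1] = 0 & p.[1] = 0].

Lemma isbub_phip N k : (2 <= k <= N)%N -> isbub N (phip k).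
Proof.
move=> /andP[k2 kN]; split; last 2 first.
- by rewrite -[RHS](phi0_atN1 k) phi0E.
- by rewrite -[RHS](phi0_at1 k) phi0E.
apply: (leq_trans (size_polyMleq _ _)); have [_ -> _] := ultrasphericalP (k - 2).
have : (size (1 - 'X^2 : {poly R})%R <= 3)%N.
  by apply: (leq_trans (size_polyD _ _)); rewrite size_polyN size_polyXn size_poly1.
by lia.
Qed.

Lemma isbub0 N : isbub N 0.
Proof. by split; rewrite ?horner0 ?size_poly0. Qed.

Lemma isbubD N k p q : isbub N p -> isbub N q -> isbub N (k *: p + q).
Proof.
move=> [p1 p2 p3] [q1 q2 q3]; split.
- apply: (leq_trans (size_polyD _ _)); rewrite geq_max q1 andbT.
  exact: leq_trans (size_scale_leq _ _) p1.
- by rewrite !hornerE p2 q2 mulr0 addr0.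
- by rewrite !hornerE p3 q3 mulr0 addr0.
Qed.

Lemma isbub_flip N p : isbub N p -> isbub N (pflip p).
Proof.
by move=> [p1 p2 p3]; split; rewrite ?size_pflip// horner_pflip ?opprK.
Qed.

Lemma isbub_sum N (c : nat -> R) : isbub N (\sum_(k < N.-1) c k *: phip k.+2).
Proof.
apply: (big_ind (isbub N)); [exact: isbub0| |].
  by move=> p q Hp Hq; rewrite -[p]scale1r; exact: isbubD.
move=> k _; rewrite -[_ *: _]addr0; apply: isbubD; last exact: isbub0.
by apply: isbub_phip; have := ltn_ord k; lia.
Qed.

(** A bubble is divisible by [1 - 'X^2], and the quotient expands in the ultraspherical
    polynomials. *)
Lemma isbub_span N p : isbub N p -> exists c : nat -> R, p = \sum_(k < N.-1) c k *: phip k.+2.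
Proof.
move=> [sp pN p1].
have /factor_theorem[q pE] : root p 1 by apply/rootP.
have /factor_theorem[r qE] : root q (-1).
  move: pN; rewrite pE !hornerE => /eqP; rewrite mulf_eq0 => /orP[//|].
  by rewrite -opprD oppr_eq0 => /eqP H; exfalso; move: H; lra.
have {qE} pE' : p = (1 - 'X^2) * (- r) by rewrite pE qE rmorphN/= rmorph1; ring.
have [|||c cE] := @monic_family_span R (fun k => usp k) N.-1 (- r).
- by move=> k _; have [] := ultrasphericalP k.
- by move=> k _; have [] := ultrasphericalP k.
- have [->|r0] := eqVneq r 0; first by rewrite oppr0 size_poly0.
  move: sp; rewrite pE' size_mul ?one_subX2_neq0 ?oppr_eq0//.
  rewrite size_polyN addrC size_polyDl size_polyN ?size_polyXn ?size_poly1//.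
  by rewrite addSn; lia.
exists c; rewrite pE' cE mulr_sumr; apply: eq_bigr => k _.
by rewrite /phip scalerAr !subSS subn0.
Qed.

(** [oproj] is chosen by description; the expansion of [f] in the orthogonal functions [phi0] shows
    that a projection exists, so the chosen function has the defining properties. *)
Lemma oproj_bubbleP N f : continuous f -> exists p, [/\ isbub N p,
  residual N f = (fun t => f t - p.[t]) &
  forall q, isbub N q -> ip (residual N f) (horner q) = 0].
Proof.
move=> cf.
pose c k := ip f (phi0 k.+2) / ip (phi0 k.+2) (phi0 k.+2).
pose p := \sum_(k < N.-1) c k *: phip k.+2.
have orth q : isbub N q -> ip (fun t => f t - p.[t]) (horner q) = 0.
  move=> /isbub_span[d ->].
  have cfp : continuous (fun t => f t - p.[t]).
    by move=> t; apply: continuousB; [exact: cf|exact: continuous_horner].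
  have -> : horner (\sum_(k < N.-1) d k *: phip k.+2) =
    (fun t => \sum_(k < N.-1) (d k * phi0 k.+2 t)).
    by apply/funext => t; rewrite horner_sum; apply: eq_bigr => k _; rewrite hornerZ phi0E.
  rewrite inner_sumr// ?big1// => [k _|k]; last exact/continuousZf/continuous_phi0.
  rewrite innerZr//; last exact: continuous_phi0.
  have -> : (fun t => f t - p.[t]) =
     (fun t => f t + -1 * \sum_(i < N.-1) (c i * phi0 i.+2 t)).
    apply/funext => t; rewrite horner_sum mulN1r; congr (_ - _).
    by apply: eq_bigr => i _; rewrite hornerZ phi0E.
  have cs : continuous (fun t => \sum_(i < N.-1) (c i * phi0 i.+2 t)).
    by apply: continuous_sumf => i; exact/continuousZf/continuous_phi0.
  rewrite innerDl ?innerZl//; try exact: continuous_phi0; last exact: continuousZf.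
  rewrite inner_suml; last 2 first.
  - by move=> i; exact/continuousZf/continuous_phi0.
  - exact: continuous_phi0.
  rewrite (bigD1 k)//= big1 => [|i ik]; last first.
    rewrite innerZl; try exact: continuous_phi0.
    by rewrite phi0_orth ?mulr0// eqSS eqSS.
  rewrite innerZl; try exact: continuous_phi0.
  by rewrite addr0 mulN1r divfK ?phi0_norm_neq0// subrr mulr0.
have [p' [bp' rE Hp']] : exists p', [/\ isbub N p', residual N f = (fun t => f t - p'.[t]) &
   forall q, isbub N q -> ip (fun t => f t - p'.[t]) (horner q) = 0].
  rewrite /residual /oproj; case: xgetP => [_ _ [[p' [s1 s2 s3 ->]] H]|].
    by exists p'; split => // q [q1 q2 q3]; apply: H; exists q.
  move=> /(_ (horner p))[]; have [p1 p2 p3] := isbub_sum N c; split; first by exists p.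
  by move=> _ [q [q1 q2 q3 ->]]; exact: orth.
by exists p'; split => //; rewrite rE.
Qed.

Lemma continuous_residual N f : continuous f -> continuous (residual N f).
Proof.
move=> cf; have [p [_ -> _]] := oproj_bubbleP N cf.
by move=> t; apply: continuousB; [exact: cf|exact: continuous_horner].
Qed.

Lemma isbub_orth0 N p : isbub N p -> (forall q, isbub N q -> ip (horner p) (horner q) = 0) -> p = 0.
Proof. by move=> bp H; apply: (inner_poly_eq0 ltN11R); exact: H. Qed.

(** The projection inherits the parity of [f]: the bubble [pflip p - s *: p] is orthogonal to all
    bubbles, hence zero. *)
Lemma residual_flip N f s : continuous f -> s ^+ 2 = 1 -> (forall t, f (- t) = s * f t) ->
  forall t, residual N f (- t) = s * residual N f t.
Proof.
move=> cf s2 fs; have [p [bp rE Hr]] := oproj_bubbleP N cf.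
suff pE : pflip p - s *: p = 0.
  move=> t; rewrite rE fs mulrBr; congr (_ - _); rewrite -horner_pflip.
  by move/eqP : pE; rewrite subr_eq0 => /eqP ->; rewrite hornerZ.
apply: (@isbub_orth0 N) => [|q bq].
  by rewrite addrC -scaleNr; apply: isbubD => //; exact: isbub_flip.
have cr : continuous (residual N f) := continuous_residual cf.
have -> : horner (pflip p - s *: p) =
    (fun t => -1 * (fun t => residual N f (- t)) t + s * residual N f t).
  by apply/funext => t; rewrite rE !hornerE horner_pflip fs; ring.
have crN : continuous (fun t => residual N f (- t)).
  by apply: continuous_compf => // t; exact: continuousN.
rewrite innerDl ?innerZl//; try exact: continuous_horner; try exact: continuousZf.
rewrite Hr// mulr0 addr0.
have -> : horner q = (fun t => (pflip q).[- t]).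
  by apply/funext => t; rewrite horner_pflip opprK.
rewrite inner_flip//; last exact: continuous_horner.
by rewrite Hr ?mulr0//; exact: isbub_flip.
Qed.

End Bubbles.

(** * The residual of 1 + t *)

Section Legendre.
Context {R : realType}.
Implicit Types (f g h : R -> R) (p q : {poly R}) (t : R).
Local Notation ip := (inner `[(-1)%R, 1%R]).

Definition legendre_form p q : R := ip (horner p) (horner q).

Lemma legendre_formC p q : legendre_form p q = legendre_form q p.
Proof. exact: innerC. Qed.

Lemma legendre_formD k p p' q :
  legendre_form (k *: p + p') q = k * legendre_form p q + legendre_form p' q.
Proof.
rewrite /legendre_form -innerZl; try exact: continuous_horner.
rewrite -innerDl; try exact: continuous_horner; last first.
  by apply: continuousZf; exact: continuous_horner.
by apply: eq_inner => // t _; rewrite !hornerE.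
Qed.

Lemma legendre_form0 p : legendre_form p p = 0 -> p = 0.
Proof. exact: inner_poly_eq0 ltN11R. Qed.

Lemma legendre_form_flip p q : legendre_form (pflip p) (pflip q) = legendre_form p q.
Proof.
rewrite /legendre_form -[RHS]inner_flip; try exact: continuous_horner.
by apply: eq_inner => t _; rewrite horner_pflip.
Qed.

Lemma legendre_formZr k p q : legendre_form q (k *: p) = k * legendre_form q p.
Proof.
have := legendre_formD k p 0 q; have := legendre_formD 1 0 0 q.
by rewrite scaler0 !addr0 mul1r !(legendre_formC _ q) => H1 H2; lra.
Qed.

(* Integrate [(t p(t)^2)' = 2 p(t) (t p'(t)) + p(t)^2]; up to lower order terms
   [t p'] is [m p]. *)
Lemma legendre_norm m p : monic_orthogonal legendre_form m p ->
  (2 * m%:R + 1) * legendre_form p p = 2 * p.[1] ^+ 2.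
Proof.
move=> Hp; have [mp sp Op] := Hp.
have pflipE := monic_orthogonal_flip legendre_formC legendre_formD legendre_form0 legendre_form_flip Hp.
have pN1 : p.[-1] ^+ 2 = p.[1] ^+ 2.
  by rewrite -[in RHS]pflipE hornerZ exprMn -exprM mulnC exprM sqrrN !expr1n mul1r horner_pflip.
have := @itg_deriv_poly R (-1) 1 ('X * p ^+ 2) (ltW ltN11R).
rewrite !hornerM !hornerX -!expr2 pN1 => H.
have {}H : itg (-1) 1 (fun t => ('X * p ^+ 2)^`().[t]) = 2 * p.[1] ^+ 2 by rewrite H; ring.
rewrite -H.
have sr : (size ('X * p^`() - m%:R *: p)%R <= m)%N.
  apply/leq_sizeP => j mj; rewrite coefB coefXM coefZ coef_deriv.
  case: j mj => [|j] mj /=.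
    by move: mj; rewrite leqn0 => /eqP ->; rewrite mul0r subrr.
  move: mj; rewrite leq_eqVlt => /predU1P[->|mj]; first by rewrite mulr_natl subrr.
  by rewrite [p`_j.+1]nth_default ?sp// mul0rn mulr0 subrr.
have Xp' : legendre_form p ('X * p^`()) = m%:R * legendre_form p p.
  have -> : 'X * p^`() = 1 *: ('X * p^`() - m%:R *: p) + m%:R *: p by rewrite scale1r subrK.
  by rewrite legendre_formC legendre_formD legendre_formC Op// mulr0 add0r legendre_formC legendre_formZr.
transitivity (2 * legendre_form p ('X * p^`()) + legendre_form p p); first by rewrite Xp'; ring.
rewrite /legendre_form !innerE -itgZ; last by apply: continuousMf; exact: continuous_horner.
rewrite -itgD; last 2 first.
- by apply/continuousZf/continuousMf; exact: continuous_horner.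
- by apply: continuousMf; exact: continuous_horner.
by apply: eq_itg => t _; rewrite expr2 !derivM derivX mul1r !(hornerD, hornerM) hornerX; ring.
Qed.

(** Christoffel-Darboux kernel at 1: [K] represents evaluation at 1. By [legendre_norm] the terms
    [P_k(1)^2 / <P_k, P_k>] are [(2 k + 1) / 2]; at -1 the parity of [P_k] adds the sign
    [(-1)^k]. *)
Lemma evaluation_kernel N : exists K : {poly R}, [/\ (size K <= N.+1)%N,
  forall q, (size q <= N.+1)%N -> legendre_form K q = q.[1],
  K.[1] = (N%:R + 1) ^+ 2 / 2 & K.[-1] = (-1) ^+ N * (N%:R + 1) / 2].
Proof.
have [P HP] : exists P : nat -> {poly R}, forall m, monic_orthogonal legendre_form m (P m).
  have [P HP] := choice (monic_orthogonal_exists legendre_formC legendre_formD legendre_form0).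
  by exists P.
have nP m : legendre_form (P m) (P m) != 0.
  by apply/eqP => /legendre_form0 P0; have [_] := HP m; rewrite P0 size_poly0.
have PN m : (P m).[-1] = (-1) ^+ m * (P m).[1].
  have E := monic_orthogonal_flip legendre_formC legendre_formD legendre_form0 legendre_form_flip (HP m).
  by rewrite -[in LHS]E hornerZ horner_pflip opprK.
pose K := \sum_(k < N.+1) ((P k).[1] / legendre_form (P k) (P k)) *: P k.
have diag (k : nat) : (P k).[1] / legendre_form (P k) (P k) * (P k).[1] = (2 * k%:R + 1) / 2.
  have H := legendre_norm (HP k); have := nP k.
  move: H; set b := legendre_form _ _; set a := _.[1] => H b0.
  rewrite mulrAC -expr2; apply: (mulIf b0); rewrite divfK//.
  by rewrite mulrAC H mulrAC divff ?mul1r//; lra.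
exists K; split.
- apply: (leq_trans (size_sum _ _ _)); apply/bigmax_leqP => k _.
  by apply: (leq_trans (size_scale_leq _ _)); have [_ -> _] := HP k.
- move=> q sq; have [|||c ->] := @monic_family_span R P N.+1 q.
  + by move=> k _; have [] := HP k.
  + by move=> k _; have [] := HP k.
  + by [].
  rewrite legendre_formC (form_suml legendre_formD) horner_sum; apply: eq_bigr => k _.
  rewrite hornerZ legendre_formC /K (form_suml legendre_formD) (bigD1 k)//= big1 => [|i ik].
    by rewrite divfK ?nP// addr0.
  have {}ik : i != k :> nat by [].
  suff -> : legendre_form (P i) (P k) = 0 by rewrite mulr0.
  have [_ si Oi] := HP i; have [_ sk Ok] := HP k.
  move: ik; rewrite neq_ltn => /orP[ik|ki]; last by apply: Oi; rewrite sk.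
  by rewrite legendre_formC; apply: Ok; rewrite si.
- rewrite horner_sum; under eq_bigr do rewrite hornerZ diag.
  elim: N {K} => [|N IH]; first by rewrite big_ord_recr big_ord0/=; field.
  by rewrite big_ord_recr/= IH -natr1; field.
- rewrite horner_sum; under eq_bigr do rewrite hornerZ PN mulrCA diag.
  elim: N {K} => [|N IH]; first by rewrite big_ord_recr big_ord0/=; field.
  by rewrite big_ord_recr/= IH -natr1 exprS; field.
Qed.

Lemma r0P n : (0 < n)%N -> exists p, [/\ (size p <= n.+1)%N, r0 n = horner p,
  p.[-1] = 0, p.[1] = 2 & forall q, isbub n q -> legendre_form p q = 0].
Proof.
move=> n0; have c1t : continuous (fun t : R => 1 + t).
  by apply: continuousDf; [exact: cst_continuous|move=> t; exact: cvg_id].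
have [p [[p1 p2 p3] rE Hr]] := oproj_bubbleP n c1t.
have E : r0 n = horner ('X + 1 - p).
  by rewrite /r0 rE; apply/funext => t; rewrite !hornerE [t + 1]addrC.
exists ('X + 1 - p); split => //.
- apply: (leq_trans (size_polyD _ _)); rewrite size_polyN geq_max p1 andbT.
  by rewrite -polyC1 size_XaddC.
- by rewrite !hornerE p2; lra.
- by rewrite !hornerE p3; lra.
- by move=> q bq; rewrite /legendre_form -E; exact: Hr.
Qed.

Lemma continuous_r0 n : (0 < n)%N -> continuous (r0 n : R -> R).
Proof. by move=> /r0P[p [_ -> _ _ _]]; exact: continuous_horner. Qed.

(** [K] and its mirror image represent the evaluations at 1 and -1, which vanish on bubbles. Hence
    [r0] is a combination of the two, and its inner product with a polynomial [q] of degree at most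
    [n] is [a q(1) + b q(-1)]. *)
Lemma r0_gram n : (0 < n)%N -> let N : R := n%:R in let s : R := (-1) ^+ n in
  ip (r0 n) (r0 n) = 8 / (N * (N + 2)) /\
  ip (r0 n) (fun t => r0 n (- t)) = - 8 * s / (N * (N + 1) * (N + 2)).
Proof.
move=> n0 N s; have [p [sp pE pN1 p1 Hp]] := r0P n0.
have [K [sK HK K1 KN1]] := evaluation_kernel n.
have N0 : 0 < N by rewrite ltr0n.
have s2 : s ^+ 2 = 1 by rewrite sqrr_sign.
(* The solution of [p.[1] = 2], [p.[-1] = 0] for [p = a *: K + b *: pflip K]. *)
pose a := 4 / (N * (N + 2)); pose b := - 4 * s / (N * (N + 1) * (N + 2)).
have HKf q : (size q <= n.+1)%N -> legendre_form (pflip K) q = q.[-1].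
  move=> sq; rewrite -[q]pflipK legendre_form_flip HK ?size_pflip//.
  by rewrite !horner_pflip opprK.
have pKE : p = a *: K + b *: pflip K.
  apply/eqP; rewrite -subr_eq0; apply/eqP; apply: (@isbub_orth0 _ n).
    split.
    + apply: (leq_trans (size_polyD _ _)); rewrite size_polyN geq_max sp/=.
      apply: (leq_trans (size_polyD _ _)); rewrite geq_max.
      by rewrite !(leq_trans (size_scale_leq _ _))// size_pflip.
    + rewrite !hornerE horner_pflip opprK pN1 K1 KN1 -/s /a /b.
      by rewrite -/N; field; clear pE; lra.
    + rewrite !hornerE horner_pflip p1 K1 KN1 -/s /a /b.
      transitivity (2 - (2 * (N + 1) ^+ 2 / (N * (N + 2)) - 2 * s ^+ 2 / (N * (N + 2)))).
        by rewrite /N; field; rewrite -/N; clear pE; lra.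
      by rewrite s2; field; clear pE; lra.
  move=> q bq; rewrite -/(legendre_form _ _) -[p - _]addr0.
  have -> : p - (a *: K + b *: pflip K) + 0 = 1 *: p + (- a *: K + - b *: pflip K).
    by rewrite addr0 scale1r opprD !scaleNr.
  rewrite legendre_formD Hp// mulr0 add0r.
  rewrite legendre_formD -[_ *: pflip K]addr0 legendre_formD.
  have [q1 q2 q3] := bq.
  rewrite HK// HKf// q2 q3.
  have := legendre_formD 1 0 0 q; rewrite scaler0 addr0 mul1r => H.
  by rewrite !mulr0; lra.
have L q : (size q <= n.+1)%N -> legendre_form p q = a * q.[1] + b * q.[-1].
  move=> sq; rewrite pKE legendre_formD HK// -[_ *: pflip K]addr0 legendre_formD HKf//.
  by have := legendre_formD 1 0 0 q; rewrite scaler0 addr0 mul1r => H; lra.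
split.
  rewrite pE -/(legendre_form _ _) L// p1 pN1 /a; field; clear pE; lra.
have -> : ip (r0 n) (fun t => r0 n (- t)) = legendre_form p (pflip p).
  by rewrite pE; apply: eq_inner => // t _; rewrite horner_pflip.
rewrite L ?size_pflip// !horner_pflip opprK p1 pN1 /b; field; clear pE; lra.
Qed.

End Legendre.

(** * The Mellin transform *)

Section Mellin.
Context {R : realFieldType} (n : nat) (al : R) (c : nat -> R).
Hypothesis n3 : (3 <= n)%N.
Implicit Types (p q : {poly R}).
Notation m := (uphalf n).
Notation N := (n%:R : R).
Local Notation l i := (N - 1 - 2 * i%:R).

(* Mellin transform at [k] of
   [- al t^n - t^(n-2) + \sum_(i < m) c_i t^(n-1-2i)] over [[0, 1]]. *)
Definition mellin (k : R) : R := - al / (k + N + 1) - 1 / (k + N - 1)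
  + \sum_(i < m) c i / (k + l i + 1).

Let N3 : 3 <= N. Proof. by rewrite ler_nat. Qed.

Let lbound i : (i < m)%N -> 0 <= l i :> R.
Proof.
move=> im; have : (2 * i + 1 <= n)%N by lia.
by rewrite -(ler_nat R) natrD natrM => H; lra.
Qed.

(* The zeros of [mellin] at the exponents determine it up to a linear factor
   [q]; its residues at the poles [-N-1] and [1-N] are [-al] and [-1]. *)
Lemma mellin_ratio : (forall i, (i < m)%N -> mellin (l i) = 0) ->
  exists Q : R,
    mellin N = Q * (2 * al + (2 * N + 1) * (2 / (N - 1) - al))
               / ((2 * N + 1) * (2 * N - 1)) /\
    mellin (N - 2) = Q * (- 2 / (N - 1)) *
               (4 / (N - 1) + (2 * N - 3) * (2 / (N - 1) - al))
               / ((2 * N - 1) * (2 * N - 3)).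
Proof.
move=> Hz; have N3' := N3.
pose D : {poly R} := \prod_(i < m) ('X - (- (l i + 1))%:P).
pose S : {poly R} := \sum_(i < m) c i *: \prod_(k < m | k != i) ('X - (- (l k + 1))%:P).
(* The numerator of [mellin] over the common denominator [(x + N + 1) (x + N - 1) D(x)]. Its degree
   is at most [m + 1], so the [m] known zeros leave a factor [q] of degree at most 1. *)
pose P : {poly R} := - al *: (('X - (1 - N)%:P) * D) - ('X - (- N - 1)%:P) * D
   + ('X - (- N - 1)%:P) * ('X - (1 - N)%:P) * S.
have Dn0 (x : R) : 0 <= x -> D.[x] != 0.
  move=> x0; rewrite horner_prod; apply/prodf_neq0 => i _.
  by rewrite !hornerE opprK gt_eqF//; have := lbound (ltn_ord i); lra.
have PE (x : R) : 0 <= x -> P.[x] = (x + N + 1) * (x + N - 1) * D.[x] * mellin x.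
  move=> x0.
  have SE : S.[x] = D.[x] * \sum_(i < m) c i / (x + l i + 1).
    rewrite horner_sum mulr_sumr; apply: eq_bigr => i _.
    rewrite hornerZ /D [in RHS](bigD1 i)//= hornerM hornerXsubC.
    have : x + l i + 1 != 0 by rewrite gt_eqF//; have := lbound (ltn_ord i); lra.
    have -> : x - - (l i + 1) = x + l i + 1 by rewrite opprK addrA.
    by set y := x + l i + 1; set Pi := (\prod_(_ | _) _).[x] => y0; field.
  rewrite /P /mellin !(hornerD, hornerN, hornerZ, hornerM, hornerX, hornerC) SE.
  by field; apply/andP; split; have := N3; lra.
have Pz i : (i < m)%N -> P.[l i] = 0 by move=> im; rewrite PE ?Hz ?mulr0// lbound.
pose rs : seq R := [seq l i | i : nat <- iota 0 m].
have [q PqE] : exists q, P = q * \prod_(z <- rs) ('X - z%:P).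
  apply: uniq_roots_prod_XsubC.
    apply/allP => z /mapP[i]; rewrite mem_iota add0n => /andP[_ im] ->.
    by apply/rootP; exact: Pz.
  rewrite uniq_rootsE map_inj_uniq ?iota_uniq// => i j H.
  by apply/eqP; rewrite -(eqr_nat R); apply/eqP; lra.
have sXC (a : R) : size ('X - a%:P) = 2 by rewrite size_XsubC.
have sS : (size S <= m)%N.
  apply: (leq_trans (size_sum _ _ _)); apply/bigmax_leqP => i _.
  apply: (leq_trans (size_scale_leq _ _)).
  apply: (leq_trans (size_poly_prod_leq _ _)).
  under eq_bigr do rewrite size_XsubC.
  rewrite sum_nat_const cardC1 card_ord; have := ltn_ord i; lia.
have sD : size D = m.+1 
  by rewrite /D -(big_mkord xpredT (fun i => 'X - (- (l i + 1))%:P)) size_prod_XsubC size_iota subn0.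
have sP : (size P <= m.+2)%N.
  apply: (leq_trans (size_polyD _ _)); rewrite geq_max; apply/andP; split.
    apply: (leq_trans (size_polyD _ _)); rewrite size_polyN geq_max; apply/andP; split.
      apply: (leq_trans (size_scale_leq _ _)).
      by apply: (leq_trans (size_polyMleq _ _)); rewrite sXC sD.
    by apply: (leq_trans (size_polyMleq _ _)); rewrite sXC sD.
  apply: (leq_trans (size_polyMleq _ _)).
  have : (size (('X - (- N - 1)%:P) * ('X - (1 - N)%:P))%R <= 3)%N.
    by apply: (leq_trans (size_polyMleq _ _)); rewrite !sXC.
  by move=> s3; apply: (@leq_trans (3 + m).-1) => //; rewrite -!subn1 leq_sub2r// leq_add.
have sq : (size q <= 2)%N.
  have [->|q0] := eqVneq q 0; first by rewrite size_poly0.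
  move: sP; rewrite PqE size_Mmonic ?monic_prod_XsubC// size_prod_XsubC.
  by rewrite size_map size_iota; lia.
have qE x : q.[x] = q`_0 + q`_1 * x.
  by rewrite (horner_coef_wide _ sq) big_ord_recl big_ord1/= expr0 mulr1 expr1.
have PlE x : P.[x] = q.[x] * \prod_(i < m) (x - l i).
  rewrite PqE hornerM horner_prod big_map -[X in iota _ X]subn0 big_mkord.
  by under eq_bigr do rewrite hornerXsubC.
have DE x : D.[x] = \prod_(i < m) (x + l i + 1).
  by rewrite horner_prod; apply: eq_bigr => i _; rewrite hornerXsubC opprK addrA.
pose A0 := \prod_(i < m) (1 + 2 * i%:R : R); pose B0 := \prod_(i < m) (2 * N - 2 * i%:R).
pose A1 := \prod_(i < m) (2 * i%:R - 1 : R); pose B1 := \prod_(i < m) (2 * N - 2 * i%:R - 2).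
have sgn0 : (-1) ^+ m != 0 :> R by rewrite signr_eq0.
have prodN (F G : 'I_m -> R) : (forall i, F i = - G i) ->
    \prod_(i < m) F i = (-1) ^+ m * \prod_(i < m) G i.
  by move=> FG; rewrite -[m in (-1) ^+ m]card_ord -prodrN; apply: eq_bigr => i _.
(* At each of the points [- N - 1] and [1 - N] a single term of [P] survives; the two values
   determine [q]. *)
have q1 : 2 * al * A0 = q.[- N - 1] * B0.
  apply: (mulfI sgn0); rewrite mulrCA [RHS]mulrCA.
  rewrite -(prodN (fun i : 'I_m => - N - 1 - l i) (fun i : 'I_m => 2 * N - 2 * i%:R)) => [|i]; last by ring.
  rewrite -(prodN (fun i : 'I_m => - N - 1 + l i + 1) (fun i : 'I_m => 1 + 2 * i%:R)) => [|i]; last by ring.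
  rewrite -PlE -DE /P !(hornerD, hornerN, hornerZ, hornerM, hornerX, hornerC); ring.
have q2 : - 2 * A1 = q.[1 - N] * B1.
  apply: (mulfI sgn0); rewrite mulrCA [RHS]mulrCA.
  rewrite -(prodN (fun i : 'I_m => 1 - N - l i) (fun i : 'I_m => 2 * N - 2 * i%:R - 2)) => [|i]; last by ring.
  rewrite -(prodN (fun i : 'I_m => 1 - N + l i + 1) (fun i : 'I_m => 2 * i%:R - 1)) => [|i]; last by ring.
  rewrite -PlE -DE /P !(hornerD, hornerN, hornerZ, hornerM, hornerX, hornerC); ring.
have e1 : (2 * N + 1) * (2 * N - 1) * B0 * mellin N = q.[N] * A0.
  have -> : A0 = \prod_(i < m) (N - l i) by apply: eq_bigr => i _; ring.
  rewrite -PlE PE; last by lra.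
  have -> : B0 = D.[N] by rewrite DE; apply: eq_bigr => i _; ring.
  by ring.
have e2 : (2 * N - 1) * (2 * N - 3) * B1 * mellin (N - 2) = q.[N - 2] * A1.
  have -> : A1 = \prod_(i < m) (N - 2 - l i) by apply: eq_bigr => i _; ring.
  rewrite -PlE PE; last by lra.
  have -> : B1 = D.[N - 2] by rewrite DE; apply: eq_bigr => i _; ring.
  by ring.
(* [A1] and [B1] are [A0] and [B0] with the index shifted by one, so their ratios telescope. *)
have t1 (k : nat) : (2 * k%:R - 1) * \prod_(i < k) (2 * i%:R - 1 : R)
      = - \prod_(i < k) (1 + 2 * i%:R : R).
  elim: k => [|k IH]; first by rewrite !big_ord0; ring.
  rewrite !big_ord_recr/= -natr1; move: IH; set x := \prod_(i < k) _ => IH.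
  by transitivity ((2 * k%:R + 1) * ((2 * k%:R - 1) * x)); [ring|rewrite IH; ring].
have t2 (k : nat) : 2 * N * \prod_(i < k) (2 * N - 2 * i%:R - 2)
      = (2 * N - 2 * k%:R) * \prod_(i < k) (2 * N - 2 * i%:R).
  elim: k => [|k IH]; first by rewrite !big_ord0; ring.
  rewrite !big_ord_recr/= -natr1; move: IH; set x := \prod_(i < k) _ => IH.
  by transitivity ((2 * N - 2 * k%:R - 2) * (2 * N * x)); [ring|rewrite IH; ring].
(* [2 m] is [n] or [n + 1], and the product is the same in both cases: here the parity of [n]
   disappears. *)
have mE : (2 * m%:R - 1) * (2 * N - 2 * m%:R) = N * (N - 1).
  have [n1|n1] : (2 * m = n)%N \/ (2 * m = n.+1)%N by lia.
    by have -> : 2 * m%:R = N :> R by [rewrite -natrM n1]; ring.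
  by have -> : 2 * m%:R = N + 1 :> R by [rewrite natr1 -natrM n1]; ring.
have B0n0 : B0 != 0.
  apply/prodf_neq0 => i _; rewrite gt_eqF//; have := lbound (ltn_ord i); lra.
have B1n0 : B1 != 0.
  apply/prodf_neq0 => i _; rewrite gt_eqF//; have := lbound (ltn_ord i); lra.
have {}t1 := t1 m; have {}t2 := t2 m; rewrite -/A0 -/A1 in t1; rewrite -/B0 -/B1 in t2.
have rr : A1 * B0 * (N - 1) = - 2 * A0 * B1.
  have : N * (A1 * B0 * (N - 1) + 2 * A0 * B1) = 0.
    transitivity (A1 * B0 * (N * (N - 1)) + A0 * (2 * N * B1)); first by ring.
    rewrite -mE t2.
    transitivity ((2 * N - 2 * m%:R) * B0 * ((2 * m%:R - 1) * A1 + A0)); first by ring.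
    by rewrite t1 addNr mulr0.
  by move/eqP; rewrite mulf_eq0 gt_eqF ?orFb; [move=> /eqP H; lra|lra].
pose r := A0 / B0.
have r'E : A1 / B1 = - 2 * r / (N - 1).
  apply/eqP; rewrite eqr_div ?B1n0//; last by lra.
  apply/eqP/(mulIf B0n0); transitivity (A1 * B0 * (N - 1)); first by ring.
  by rewrite rr /r; field.
(* One factor [r] comes from [q], the other from the products. Both values share the square, which
   cancels in any homogeneous linear relation between them. *)
exists (r ^+ 2).
have {}q1 : q.[- N - 1] = 2 * al * r by rewrite /r mulrA q1 mulfK.
have {}q2 : q.[1 - N] = 4 * r / (N - 1).
  have : q.[1 - N] = - 2 * (A1 / B1) by rewrite mulrA q2 mulfK.
  by rewrite r'E => ->; field; lra.
have qs : q`_1 = r * (2 / (N - 1) - al).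
  by have : q.[1 - N] - q.[- N - 1] = 2 * q`_1 by [rewrite !qE; ring];
    rewrite q1 q2 => H; apply: (@mulfI _ 2); rewrite ?pnatr_eq0// -H; field; lra.
have qN : q.[N] = r * (2 * al + (2 * N + 1) * (2 / (N - 1) - al)).
  have -> : q.[N] = q.[- N - 1] + (2 * N + 1) * q`_1 by rewrite !qE; ring.
  by rewrite q1 qs; ring.
have qN2 : q.[N - 2] = r * (4 / (N - 1) + (2 * N - 3) * (2 / (N - 1) - al)).
  have -> : q.[N - 2] = q.[1 - N] + (2 * N - 3) * q`_1 by rewrite !qE; ring.
  by rewrite q2 qs; ring.
have a1 : 2 * N + 1 != 0 by lra.
have a2 : 2 * N - 1 != 0 by lra.
have a3 : 2 * N - 3 != 0 by lra.
have a4 : N - 1 != 0 by lra.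
split.
  have -> : mellin N = q.[N] * A0 / ((2 * N + 1) * (2 * N - 1) * B0).
    by rewrite -e1 mulrC mulKf// !mulf_neq0.
  by rewrite qN /r; field; rewrite ?a1 ?a2 ?a4 ?B0n0.
have -> : mellin (N - 2) = q.[N - 2] * (A1 / B1) / ((2 * N - 1) * (2 * N - 3)).
  by rewrite mulrA -e2; field; rewrite ?a2 ?a3 ?B1n0.
by rewrite r'E qN2; field; rewrite ?a2 ?a3 ?a4.
Qed.

End Mellin.

(** * The function w *)

Section AlphaIdentity.
Context {R : realType} (n : nat).
Hypothesis n3 : (3 <= n)%N.
Notation N := (n%:R : R).
Notation al := (alpha n : R).

(* This is the quadratic equation of which [alpha n] is a root. *)
Lemma alpha_quadratic :
  N * al * ((2 * al + (2 * N + 1) * (2 / (N - 1) - al))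
               / ((2 * N + 1) * (2 * N - 1))) =
  (4 - N) * ((- 2 / (N - 1)) * (4 / (N - 1) + (2 * N - 3) * (2 / (N - 1) - al))
               / ((2 * N - 1) * (2 * N - 3))).
Proof.
have N3 : 3 <= N by rewrite ler_nat.
have a0 : N != 0 by lra.
have a1 : 2 * N + 1 != 0 by lra.
have a2 : 2 * N - 1 != 0 by lra.
have a3 : 2 * N - 3 != 0 by lra.
have a4 : N - 1 != 0 by lra.
pose Y := (2 * N + 1) * (N + 1) / ((2 * N - 3) * (N - 1)).
have Y0 : 0 <= Y by rewrite divr_ge0// mulr_ge0//; lra.
pose y := Num.sqrt 3 * Num.sqrt Y.
have y2 : y ^+ 2 = 3 * Y by rewrite exprMn !sqr_sqrtr//; lra.
have -> : al = 2 / (N * (2 * N - 1)) * ((N - 2) * (2 * N + 1) / (N - 1) - 2 * y).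
  by rewrite /alpha /y /Y; field; rewrite a0 a2 a4.
apply/eqP; rewrite -subr_eq0; apply/eqP.
(* Completing the square in [alpha]: [- N / (2 N + 1)] is the leading coefficient and
   [4 y / (N (2 N - 1))] the distance of [alpha] from the vertex. *)
transitivity (- N / (2 * N + 1) * (4 / (N * (2 * N - 1))) ^+ 2 * (y ^+ 2 - 3 * Y)).
  rewrite /Y; clear y2; field; by rewrite a0 a1 a2 a3 a4.
by rewrite y2 subrr mulr0.
Qed.

End AlphaIdentity.

(** * Integrals of polynomials over the unit interval *)

Section UnitIntegral.
Context {R : realType}.
Implicit Types (p q : {poly R}).

Definition upint p : R := itg 0 1 (horner p).

Lemma upintD p q : upint (p + q) = upint p + upint q.
Proof.
rewrite /upint -itgD; try exact: continuous_horner.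
by apply: eq_itg => t _; rewrite hornerD.
Qed.

Lemma upintZ k p : upint (k *: p) = k * upint p.
Proof.
rewrite /upint -itgZ; try exact: continuous_horner.
by apply: eq_itg => t _; rewrite hornerZ.
Qed.

Lemma upintN p : upint (- p) = - upint p.
Proof. by rewrite -scaleN1r upintZ mulN1r. Qed.

Lemma upint_sum (I : Type) (s : seq I) (P : I -> {poly R}) :
  upint (\sum_(i <- s) P i) = \sum_(i <- s) upint (P i).
Proof.
elim: s => [|i s IH]; last by rewrite !big_cons upintD IH.
by rewrite !big_nil -(scale0r 0) upintZ mul0r.
Qed.

Lemma upint_deriv p : upint p^`() = p.[1] - p.[0].
Proof. exact: itg_deriv_poly ler01. Qed.

Lemma upintXn k : upint 'X^k = 1 / (k%:R + 1).
Proof.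
have k0 : k%:R + 1 != 0 :> R by rewrite natr1 pnatr_eq0.
have -> : 'X^k = (k%:R + 1)^-1 *: ('X^(k.+1))^`() :> {poly R}.
  by rewrite derivXn/= -['X^_ *+ _]scaler_nat scalerA -natr1 mulVf// scale1r.
by rewrite upintZ upint_deriv !hornerXn expr1n expr0n/= subr0 mulrC.
Qed.

End UnitIntegral.

Section Wfun.
Context {R : realType}.
Implicit Types (f g h : R -> R) (p q : {poly R}) (t : R).
Local Notation ip := (inner `[(-1)%R, 1%R]).

Definition absX (k : nat) t : R := `|t| * t ^+ k.

Lemma continuous_absX k : continuous (absX k).
Proof.
apply: continuousMf; first exact: norm_continuous.
by move=> t; exact: exprn_continuous.
Qed.

Lemma absXN k t : absX k (- t) = (-1) ^+ k * absX k t.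
Proof. by rewrite /absX normrN [(- t) ^+ k]exprNn mulrCA. Qed.

Lemma ubarE M : exists2 p : {poly R}, (size p <= 2)%N &
  ubar M = (fun t => p.[t] - absX (M - 1) t).
Proof.
case oM : (odd M).
- by exists 1; [rewrite size_poly1|apply/funext => t; rewrite /ubar oM hornerC].
- by exists 'X; [rewrite size_polyX|apply/funext => t; rewrite /ubar oM hornerX].
Qed.

Lemma continuous_ubar M : continuous (ubar M : R -> R).
Proof.
have [p _ ->] := ubarE M; apply: continuousBf; first exact: continuous_horner.
exact: continuous_absX.
Qed.

Lemma ubar_flip M t : (0 < M)%N -> ubar M (- t) = - (-1) ^+ M * ubar M t :> R.
Proof.
case: M => // M _; rewrite /ubar subn1/= normrN [(- t) ^+ M]exprNn exprS -signr_odd.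
by case: (odd M) => /=; rewrite ?expr0 ?expr1; ring.
Qed.

Lemma ubar1 M : (0 < M)%N -> ubar M 1 = 0 :> R.
Proof. by move=> M0; rewrite /ubar normr1 expr1n mulr1 subrr if_same. Qed.

Variable n : nat.
Hypothesis n3 : (3 <= n)%N.
Let s : R := (-1) ^+ n.

(** Projecting changes only the polynomial part: the terms [|t| t^(n-1)] of [ubar n] and
    [|t| t^(n-3)] of [ubar (n - 2)] stay as they are. *)
Lemma wP : exists p, [/\ (size p <= n.+1)%N,
  w n = (fun t => p.[t] - alpha n * absX (n - 1) t - absX (n - 3) t) &
  forall q, isbub n q -> ip (w n) (horner q) = 0].
Proof.
have [p1 [[s1 _ _] E1 H1]] := oproj_bubbleP n (@continuous_ubar n).
have [p2 [[s2 _ _] E2 H2]] := oproj_bubbleP n (@continuous_ubar (n - 2)).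
have [v1 sv1 V1] := ubarE n; have [v2 sv2 V2] := ubarE (n - 2).
have c1 := continuous_residual (N := n) (@continuous_ubar n).
have c2 := continuous_residual (N := n) (@continuous_ubar (n - 2)).
exists (alpha n *: (v1 - p1) + (v2 - p2)); split.
- have sB p q : (size p <= 2)%N -> (size q <= n.+1)%N -> (size (p - q)%R <= n.+1)%N.
    move=> sp sq; apply: (leq_trans (size_polyD _ _)).
    by rewrite size_polyN geq_max sq andbT; lia.
  apply: (leq_trans (size_polyD _ _)); rewrite geq_max.
  by rewrite (leq_trans (size_scale_leq _ _))// ?sB.
- apply/funext => t; rewrite /w /u subn0 E1 E2 V1 V2 /= hornerD hornerZ !hornerD !hornerN.
  have -> : (n - 2 - 1 = n - 3)%N by lia.
  by ring.
- move=> q bq; have cq : continuous (horner q) by exact: continuous_horner.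
  have -> : w n = fun t => alpha n * residual n (ubar n) t + residual n (ubar (n - 2)) t.
    by apply/funext => t; rewrite /w /u subn0.
  by rewrite (innerDl _ _ (continuousZf (k := alpha n) c1) c2 cq) (innerZl _ _ (alpha n) c1 cq) H1// H2// mulr0 addr0.
Qed.

Lemma continuous_w : continuous (w n : R -> R).
Proof.
have [p [_ -> _]] := wP; apply: continuousBf; last exact: continuous_absX.
apply: continuousBf; first exact: continuous_horner.
by apply: continuousZf; exact: continuous_absX.
Qed.

Lemma w_orth_phi0 k : (2 <= k <= n)%N -> ip (w n) (phi0 k) = 0 :> R.
Proof. by move=> kn; have [p [_ _ H]] := wP; rewrite phi0E H//; exact: isbub_phip. Qed.

Lemma w_flip t : w n (- t) = - s * w n t.
Proof.
have s2 : (- s) ^+ 2 = 1 by rewrite sqrrN sqrr_sign.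
have e2 : - s = - (-1) ^+ (n - 2) :> R.
  by rewrite /s -{1}(subnK (ltnW n3)) exprD sqrrN expr1n mulr1.
rewrite /w /u subn0 (@residual_flip _ _ _ (- s))//; last 2 first.
- exact: continuous_ubar.
- by move=> x; rewrite ubar_flip//; lia.
rewrite (@residual_flip _ _ (ubar (n - 2)) (- s))//; last 2 first.
- exact: continuous_ubar.
- by move=> x; rewrite ubar_flip ?e2//; lia.
by ring.
Qed.

Lemma w1 : w n 1 = 0 :> R.
Proof.
have [p1 [[_ _ s1] E1 _]] := oproj_bubbleP n (@continuous_ubar n).
have [p2 [[_ _ s2] E2 _]] := oproj_bubbleP n (@continuous_ubar (n - 2)).
by rewrite /w /u subn0 E1 E2 s1 s2 !ubar1 ?subr0 ?mulr0 ?addr0//; lia.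
Qed.

Lemma wN1 : w n (-1) = 0 :> R.
Proof. by rewrite w_flip w1 mulr0. Qed.

(** [w n] is [q - A] on [[0, 1]] and [q + A] on [[-1, 0]], with [A = alpha t^n + t^(n-2)]. A single
    polynomial on both halves would force [A + A = 0], but the coefficient of [t^(n-2)] in [A] is 1,
    whatever [alpha] is. *)
Lemma w_not_poly p : ~ (forall t, -1 <= t <= 1 -> w n t = p.[t]).
Proof.
have [q [_ -> _]] := wP => H.
pose A : {poly R} := alpha n *: 'X^n + 'X^(n - 2).
have absP t k : 0 <= t -> absX k t = t ^+ k.+1 by move=> t0; rewrite /absX ger0_norm// exprS.
have absN t k : t <= 0 -> absX k t = - t ^+ k.+1 by move=> t0; rewrite /absX ler0_norm// exprS mulNr.
have n1 : (n - 1).+1 = n by lia.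
have n2 : (n - 3).+1 = (n - 2)%N by lia.
have P1 : q - A - p = 0.
  apply: (poly_eq0_itv (@ltr01 R)) => t /andP[t0 t1].
  have := H t; rewrite !absP// n1 n2 => Ht; rewrite /A !(hornerD, hornerN, hornerZ, hornerXn) -Ht; last by lra.
  by ring.
have P2 : q + A - p = 0.
  apply: (@poly_eq0_itv _ (-1) 0) => [|t /andP[t0 t1]]; first by lra.
  have := H t; rewrite !absN// n1 n2 => Ht; rewrite /A !(hornerD, hornerN, hornerZ, hornerXn) -Ht; last by lra.
  by ring.
have /(congr1 (fun p : {poly R} => p`_(n - 2))) : A + A = 0.
  by rewrite -[RHS](subrr 0) -{1}P2 -P1; ring.
rewrite !coefD coefZ !coefXn eqxx coef0; have -> : (n - 2 == n)%N = false by lia.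
by rewrite mulr0 add0r -mulr2n => /eqP; rewrite pnatr_eq0.
Qed.

Lemma w_norm_gt0 : 0 < ip (w n) (w n) :> R.
Proof.
rewrite lt_neqAle inner_ge0 andbT eq_sym; apply/eqP => W0.
apply: (@w_not_poly 0) => t t1; rewrite horner0.
by apply: (inner_eq0 (a := -1) (b := 1)) t1 => //; exact: continuous_w.
Qed.

End Wfun.

(** * Orthogonality of q_r and q_l *)

Section KeyIdentity.
Context {R : realType} (n : nat).
Hypothesis n3 : (3 <= n)%N.
Implicit Types (f g h : R -> R) (p q : {poly R}) (t : R).
Local Notation ip := (inner `[(-1)%R, 1%R]).
Notation N := (n%:R : R).
Notation al := (alpha n : R).
Notation m := (uphalf n).
Let s : R := (-1) ^+ n.

(** Parity kills the coefficients whose index has the parity of [n]. For [i < uphalf n] the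
    subtraction [n - 1 - 2 i] does not truncate, so each remaining exponent occurs once. *)
Lemma sumXn_parity q : (size q <= n.+1)%N -> (forall t, q.[- t] = - s * q.[t]) ->
  q = \sum_(i < m) q`_(n - 1 - 2 * i) *: 'X^(n - 1 - 2 * i).
Proof.
move=> sq qN.
have q0 k : ~~ odd (k + n) -> q`_k = 0.
  move=> okn; have [kn|kn] := ltnP k n.+1; last by rewrite nth_default// (leq_trans sq).
  have : \poly_(k < n.+1) ((-1) ^+ k * q`_k) + s *: q = 0.
    apply: (poly_eq0_itv (@ltr01 R)) => t _.
    have : q.[- t] = (\poly_(k < n.+1) ((-1) ^+ k * q`_k)).[t].
      rewrite (horner_coef_wide _ sq) horner_poly; apply: eq_bigr => i _.
      by rewrite [(- t) ^+ i]exprNn; ring.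
    by rewrite qN hornerD hornerZ => <-; ring.
  move/(congr1 (fun p : {poly R} => p`_k)).
  rewrite coefD coefZ coef_poly kn coef0 -mulrDl => /eqP.
  rewrite mulf_eq0 => /orP[|/eqP//].
  have -> : s = (-1) ^+ k.
    by rewrite /s -signr_odd -[RHS]signr_odd; move: okn; rewrite oddD; case: odd; case: odd.
  by rewrite -mulr2n mulrn_eq0 signr_eq0.
apply/polyP => k; rewrite coef_sum; under eq_bigr do rewrite coefZ coefXn.
have [kn|kn] := ltnP k n.+1; last first.
  rewrite nth_default ?(leq_trans sq)// big1// => i _.
  by have -> : (k == n - 1 - 2 * i)%N = false by [lia]; rewrite mulr0.
have [okn|okn] := boolP (odd (k + n)); last first.
  rewrite q0// big1// => i _.
  have -> : (k == n - 1 - 2 * i)%N = false; last by rewrite mulr0.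
  apply/eqP => kE; move: okn; rewrite kE; have := ltn_ord i; lia.
have im : ((n - 1 - k)./2 < m)%N by lia.
rewrite (bigD1 (Ordinal im))//= big1 => [|i].
  have -> : (n - 1 - 2 * (n - 1 - k)./2 = k)%N by lia.
  by rewrite eqxx mulr1 addr0.
rewrite -val_eqE/= => ne.
have -> : (k == n - 1 - 2 * i)%N = false; last by rewrite mulr0.
by apply/eqP => kE; move: ne; apply/negP/negPn/eqP; have := ltn_ord i; lia.
Qed.

Lemma exponentE i : (2 * i + 1 <= n)%N -> (n - 1 - 2 * i)%:R = N - 1 - 2 * i%:R.
Proof. by move=> i2; rewrite -subnDA natrB 1?addnC// natrD natrM; ring. Qed.

(* [g] is orthogonal to the polynomials of degree at most [n], so its Mellin
   transform on [[0, 1]] is given by [mellin_ratio]; the second relation between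
   the moments comes from integrating [(t g(t)^2)']. *)
Lemma muntz_norm g (gp : {poly R}) : (size gp <= n.+1)%N ->
  g = (fun t => gp.[t] - al * absX (n - 1) t - absX (n - 3) t) ->
  (forall t, g (- t) = - s * g t) ->
  (forall q, (size q <= n.+1)%N -> ip g (horner q) = 0) ->
  (N + 1) * ip g g = 2 * g 1 ^+ 2.
Proof.
move=> sg gE gN gO.
have N3 : 3 <= N by rewrite ler_nat.
have cg : continuous g.
  rewrite gE; apply: continuousBf; last exact: continuous_absX.
  by apply: continuousBf; [exact: continuous_horner|exact/continuousZf/continuous_absX].
have s2 : s * s = 1 by rewrite -expr2 sqrr_sign.
have gpN t : gp.[- t] = - s * gp.[t].
  have := gN t; rewrite gE /= !absXN.
  have -> : (-1) ^+ (n - 1) = - s :> R.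
    by rewrite /s -{2}(subnK (leq_trans (isT : 0 < 3)%N n3)) exprD expr1; ring.
  have -> : (-1) ^+ (n - 3) = - s :> R.
    by rewrite /s -{2}(subnK n3) exprD !exprS expr0; ring.
  by move=> H; lra.
pose c i := gp`_(n - 1 - 2 * i).
have gpE : gp = \sum_(i < m) c i *: 'X^(n - 1 - 2 * i) by exact: sumXn_parity.
(* The polynomial that [g] equals on [[0, 1]], where [|t| t^(n-1)] is [t^n]. *)
pose gh : {poly R} := gp - al *: 'X^n - 'X^(n - 2).
have gh01 t : 0 <= t <= 1 -> g t = gh.[t].
  move=> /andP[t0 _]; rewrite gE /gh /absX !(hornerD, hornerN, hornerZ, hornerXn) ger0_norm//.
  by rewrite -!exprS; have -> : (n - 1).+1 = n by [lia]; have -> : (n - 3).+1 = (n - 2)%N by lia.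
have mE k : upint (gh * 'X^k) = mellin n al c k%:R.
  rewrite /gh mulrBl mulrBl gpE mulr_suml -scalerAl -!exprD.
  rewrite !upintD !upintN !upintZ upint_sum !upintXn /mellin.
  rewrite (eq_bigr (fun i : 'I_m => c i / (k%:R + (N - 1 - 2 * i%:R) + 1))) => [|i _].
    have e2 : (n - 2 + k)%:R = N - 2 + k%:R :> R by rewrite natrD natrB//; lia.
    rewrite e2 natrD; set S := \sum_(i < m) _; set K := k%:R.
    have K0 : 0 <= K by rewrite ler0n.
    have -> : N - 2 + K + 1 = K + N - 1 by ring.
    have -> : N + K + 1 = K + N + 1 by ring.
    by ring.
  rewrite -scalerAl -exprD upintZ upintXn mul1r; congr (_ / _).
  have : (2 * i + 1 <= n)%N by have := ltn_ord i; lia.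
  move=> i2; rewrite natrD -subnDA natrB 1?addnC// natrD natrM; ring.
(* [g] and this monomial have the same parity, so their orthogonality on [[-1, 1]] passes to
   [[0, 1]]. *)
have m0 i : (i < m)%N -> mellin n al c (N - 1 - 2 * i%:R) = 0.
  move=> im; have i2 : (2 * i + 1 <= n)%N by lia.
  have -> : N - 1 - 2 * i%:R = (n - 1 - 2 * i)%:R.
    by rewrite -subnDA natrB 1?addnC// natrD natrM; ring.
  rewrite -mE; have := gO 'X^(n - 1 - 2 * i); rewrite size_polyXn => H.
  have {}H := H (ltac:(lia)); move: H; rewrite inner_even//; last 2 first.
  - exact: continuous_horner.
  - move=> t; rewrite gN !hornerXn [(- t) ^+ _]exprNn.
    have -> : (-1) ^+ (n - 1 - 2 * i) = - s :> R.
      have nE : n = (n - 1 - 2 * i + 2 * i + 1)%N by lia.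
      by rewrite /s [in RHS]nE exprD exprD exprM sqrrN expr1n expr1n expr1; ring.
    by transitivity (s * s * (g t * t ^+ (n - 1 - 2 * i))); [ring|rewrite s2 mul1r].
  move=> H; have {H} : inner `[0, 1] g (horner 'X^(n - 1 - 2 * i)) = 0 by lra.
  by move=> <-; apply: eq_itg => t t01; rewrite gh01// hornerM.
have Ig : ip g g = 2 * upint (gh * gh).
  rewrite inner_even// => [|t]; last by rewrite !gN; transitivity (s * s * (g t * g t)); [ring|rewrite s2 mul1r].
  by congr (_ * _); apply: eq_itg => t t01; rewrite !gh01// hornerM.
have gpO : upint (gh * gp) = 0.
  rewrite gpE mulr_sumr upint_sum big1// => i _.
  rewrite -scalerAr upintZ mE; have i2 : (2 * i + 1 <= n)%N by have := ltn_ord i; lia.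
  by rewrite exponentE// m0 ?mulr0//; lia.
have gpO' : upint (gh * ('X * gp^`())) = 0.
  rewrite gpE raddf_sum /= mulr_sumr mulr_sumr upint_sum big1// => i _.
  have i2 : (2 * i + 1 <= n)%N by have := ltn_ord i; lia.
  have -> : 'X * (c i *: 'X^(n - 1 - 2 * i))^`() = ((n - 1 - 2 * i)%:R * c i) *: 'X^(n - 1 - 2 * i).
    rewrite derivZ derivXn; case: (n - 1 - 2 * i)%N => [|k]; first by rewrite mulr0n !scaler0 mulr0 mul0r scale0r.
    by rewrite /= -[_ *+ _]scaler_nat scalerA -scalerAr -exprS mulrC.
  rewrite -scalerAr upintZ mE.
  by rewrite exponentE// m0 ?mulr0//; lia.
(* The exponents of [gp] are zeros of the transform, so every moment below reduces to these two. *)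
pose F0 := mellin n al c N; pose F2 := mellin n al c (N - 2).
have G1 : upint (gh * gh) = - al * F0 - F2.
  rewrite {2}/gh !mulrBr !upintD !upintN gpO -scalerAr upintZ !mE /F0 /F2.
  by rewrite natrB ?(ltnW n3)//; ring.
have G2 : upint (gh * ('X * gh^`())) = - N * al * F0 - (N - 2) * F2.
  have -> : 'X * gh^`() = 'X * gp^`() - (al * N) *: 'X^n - (N - 2) *: 'X^(n - 2).
    rewrite /gh !derivB derivZ !derivXn !mulrBr; congr (_ - _ - _).
      by rewrite -[_ *+ _]scaler_nat !scalerA -scalerAr -exprS prednK//; lia.
    rewrite -[_ *+ _]scaler_nat -scalerAr -exprS prednK; last by lia.
    by rewrite natrB ?(ltnW n3).
  rewrite !mulrBr !upintD !upintN gpO' -[gh * ((al * N) *: _)]scalerAr.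
  rewrite -[gh * ((N - 2) *: _)]scalerAr !upintZ !mE /F0 /F2.
  by rewrite natrB ?(ltnW n3)//; ring.
have G3 : g 1 ^+ 2 = upint (gh * gh) + 2 * upint (gh * ('X * gh^`())).
  have <- : upint ('X * (gh * gh))^`() = g 1 ^+ 2.
    by rewrite upint_deriv !hornerM !hornerX -gh01 ?ler01 ?lexx//; ring.
  rewrite -upintZ -upintD; congr upint.
  by rewrite !derivM derivX -mul_polyC polyCMn; ring.
have [Q [FQ0 FQ2]] := mellin_ratio n3 m0.
(* Given [G1], [G2] and [G3], the claim is equivalent to this relation, which is the quadratic
   equation of [alpha n] multiplied by [Q]. *)
have key : N * al * F0 = (4 - N) * F2.
  rewrite /F0 /F2 FQ0 FQ2.
  have := @alpha_quadratic R n n3.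
  set A1 := (_ / ((2 * N + 1) * (2 * N - 1))); set A2 := (_ / ((2 * N - 1) * (2 * N - 3))) => H.
  rewrite -[Q * _ / _]mulrA.
  have -> : N * al * (Q * A1) = Q * (N * al * A1) by ring.
  by rewrite H /A2; ring.
rewrite Ig G3 G1 G2.
have -> : (N + 1) * (2 * (- al * F0 - F2)) = 2 * (- (N * al * F0) - al * F0 - (N + 1) * F2) by ring.
have -> : 2 * (- al * F0 - F2 + 2 * (- N * al * F0 - (N - 2) * F2)) =
   2 * (- 2 * (N * al * F0) - al * F0 - (2 * N - 3) * F2) by ring.
by rewrite key; ring.
Qed.

Let n0 : (0 < n)%N. Proof. by lia. Qed.

(** At 1 and -1, [r0] takes the values 2 and 0, its mirror image 0 and 2; subtracting them with half
    the endpoint values of [q] leaves a bubble. *)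
Lemma r0_decomp q : (size q <= n.+1)%N -> exists2 b : {poly R}, isbub n b &
  horner q = (fun t => b.[t] + (q.[1] / 2 * r0 n t + q.[-1] / 2 * r0 n (- t))).
Proof.
move=> sq; have [p [sp pE pN1 p1 Hp]] := @r0P R n n0.
exists (q - ((q.[1] / 2) *: p + (q.[-1] / 2) *: pflip p)).
  split.
  - apply: (leq_trans (size_polyD _ _)); rewrite size_polyN geq_max sq/=.
    apply: (leq_trans (size_polyD _ _)); rewrite geq_max.
    by rewrite !(leq_trans (size_scale_leq _ _))// size_pflip.
  - rewrite !(hornerD, hornerN, hornerZ) horner_pflip opprK pN1 p1; clear pE; lra.
  - rewrite !(hornerD, hornerN, hornerZ) horner_pflip pN1 p1; clear pE; lra.
by apply/funext => t; rewrite pE !(hornerD, hornerN, hornerZ) horner_pflip; ring.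
Qed.

Lemma continuous_flip f : continuous f -> continuous (fun t => f (- t)).
Proof. by move=> cf; apply: continuous_compf => // t; exact: continuousN. Qed.

Lemma w_r0_flip : ip (w n) (fun t => r0 n (- t)) = - s * ip (w n) (r0 n) :> R.
Proof.
have cw := @continuous_w R _ n3; have cr := @continuous_r0 R _ n0.
rewrite -[LHS]inner_flip//; last exact: continuous_flip.
rewrite -innerZl//; apply: eq_inner => t _; rewrite ?opprK//.
exact: w_flip.
Qed.

(** [ra] is the part of [r0] with the parity of [w], and [x] makes [g = w - x ra] orthogonal to
    [r0]. By parity [g] is orthogonal to the mirror image of [r0] too, and it is orthogonal to
    bubbles, hence to all polynomials of degree at most [n]. Then [muntz_norm] applies with
    [g 1 = - x], since [w] is 0 and [ra] is 1 at 1. *)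
Lemma w_r0_norm : ip (w n) (w n) * 8 / (N * (N + 1) * (N + 2)) = ip (w n) (r0 n) ^+ 2 :> R.
Proof.
have cw := @continuous_w R _ n3; have cr := @continuous_r0 R _ n0.
have crf := continuous_flip cr.
have s2 : s * s = 1 by rewrite -expr2 sqrr_sign.
have [G0 G1'] := @r0_gram R _ n0.
have G1 : ip (r0 n) (fun t => r0 n (- t)) = - 8 * s / (N * (N + 1) * (N + 2)) by [].
have N3 : 3 <= N by rewrite ler_nat.
pose ra t := 1 / 2 * (r0 n t + - s * r0 n (- t)).
have cra : continuous ra.
  by apply/continuousZf/continuousDf => //; exact: continuousZf.
have raN t : ra (- t) = - s * ra t.
  rewrite /ra opprK; transitivity (1 / 2 * ((s * s) * r0 n (- t) + - s * r0 n t)); last by ring.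
  by rewrite s2 !mul1r.
have ip_r0f h : continuous h -> ip (fun t => r0 n (- t)) (fun t => h (- t)) = ip (r0 n) h.
  by move=> ch; rewrite inner_flip.
have ipra h : continuous h -> ip ra h = 1 / 2 * (ip (r0 n) h + - s * ip (fun t => r0 n (- t)) h).
  move=> ch; rewrite innerZl//; last by apply: continuousDf => //; exact: continuousZf.
  by rewrite innerDl ?innerZl//; exact: continuousZf.
have rf0 : ip (fun t => r0 n (- t)) (r0 n) = - 8 * s / (N * (N + 1) * (N + 2)).
  by rewrite innerC.
have rfrf : ip (fun t => r0 n (- t)) (fun t => r0 n (- t)) = 8 / (N * (N + 2)).
  by rewrite ip_r0f.
have a0 : N != 0 by lra.
have a1 : N + 1 != 0 by lra.
have a2 : N + 2 != 0 by lra.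
have rar0 : ip ra (r0 n) = 4 / (N * (N + 1)).
  rewrite ipra// G0 rf0.
  transitivity (1 / 2 * (8 / (N * (N + 2)) + 8 * (s * s) / (N * (N + 1) * (N + 2)))); first by ring.
  by rewrite s2; field; rewrite a0 a1 a2.
have rarf : ip ra (fun t => r0 n (- t)) = - s * (4 / (N * (N + 1))).
  rewrite ipra// G1 rfrf.
  transitivity (- s * (1 / 2 * (8 / (N * (N + 2)) + 8 / (N * (N + 1) * (N + 2))))); first by ring.
  by congr (_ * _); field; rewrite a0 a1 a2.
have rara : ip ra ra = 4 / (N * (N + 1)).
  rewrite ipra// innerC rar0 [ip (fun t => _) ra]innerC rarf.
  transitivity (1 / 2 * (1 + s * s) * (4 / (N * (N + 1)))); first by ring.
  by rewrite s2; field; rewrite a0 a1.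
have wra : ip (w n) ra = ip (w n) (r0 n).
  rewrite innerC ipra// innerC [ip (fun t => _) (w n)]innerC w_r0_flip.
  transitivity (1 / 2 * (1 + s * s) * ip (w n) (r0 n)); first by ring.
  by rewrite s2; field.
pose x := ip (w n) (r0 n) / (4 / (N * (N + 1))).
have c0 : 4 / (N * (N + 1)) != 0 by rewrite !mulf_neq0 ?invr_neq0 ?mulf_neq0.
pose g t := w n t + - x * ra t.
have cg : continuous g by apply: continuousDf => //; exact: continuousZf.
have ipg h : continuous h -> ip g h = ip (w n) h - x * ip ra h.
  by move=> ch; rewrite innerDl//; [rewrite innerZl// mulNr|exact: continuousZf].
have gN t : g (- t) = - s * g t by rewrite /g raN (w_flip n3 t : _ = - s * w n t); ring.
have gr0 : ip g (r0 n) = 0 by rewrite ipg// rar0 /x divfK// subrr.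
have grf : ip g (fun t => r0 n (- t)) = 0.
  rewrite -[LHS]inner_flip//; have -> : (fun t => g (- t)) = (fun t => - s * g t) by apply/funext.
  by rewrite innerZl// (_ : (fun t => r0 n (- - t)) = r0 n) ?gr0 ?mulr0//; apply/funext => t; rewrite opprK.
have [p0 [sp0 p0E p0N1 p01 Hp0]] := @r0P R n n0.
have [pw [spw pwE Hpw]] := @wP R n n3.
have bubO b : isbub n b -> ip g (horner b) = 0.
  move=> bb; rewrite ipg; last exact: continuous_horner.
  rewrite Hpw// ipra; last exact: continuous_horner.
  have -> : ip (r0 n) (horner b) = 0 by rewrite p0E; exact: Hp0.
  have -> : ip (fun t => r0 n (- t)) (horner b) = 0.
    rewrite (_ : horner b = fun t => (pflip b).[- t]); last by apply/funext => t; rewrite horner_pflip opprK.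
    rewrite ip_r0f; last exact: continuous_horner.
    by rewrite p0E; apply: Hp0; exact: isbub_flip.
  by ring.
have gO q : (size q <= n.+1)%N -> ip g (horner q) = 0.
  move=> /r0_decomp[b bb ->].
  rewrite innerDr//; last 2 first.
  - exact: continuous_horner.
  - by apply: continuousDf; exact: continuousZf.
  rewrite bubO// add0r innerDr//; try exact: continuousZf.
  by rewrite !innerZr// gr0 grf !mulr0 addr0.
have rap : exists2 pr : {poly R}, (size pr <= n.+1)%N & ra = horner pr.
  exists ((1 / 2) *: (p0 + - s *: pflip p0)).
    apply: (leq_trans (size_scale_leq _ _)); apply: (leq_trans (size_polyD _ _)).
    by rewrite geq_max sp0 (leq_trans (size_scale_leq _ _))// size_pflip.
  by apply/funext => t; rewrite /ra p0E hornerZ hornerD hornerZ horner_pflip.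
have [pr spr prE] := rap.
have gE : g = (fun t => (pw + - x *: pr).[t] - al * absX (n - 1) t - absX (n - 3) t).
  by apply/funext => t; rewrite /g pwE prE hornerD hornerZ; ring.
have sgp : (size (pw + - x *: pr)%R <= n.+1)%N.
  by apply: (leq_trans (size_polyD _ _)); rewrite geq_max spw (leq_trans (size_scale_leq _ _)).
have := muntz_norm sgp gE gN gO.
have -> : g 1 = - x.
  by rewrite /g w1// /ra p0E p01 p0N1; field.
have -> : ip g g = ip (w n) (w n) - x * ip (w n) (r0 n).
  rewrite [in LHS]ipg// [ip (w n) g]innerC [ip ra g]innerC !ipg// rara [ip ra (w n)]innerC wra.
  rewrite {3}/x divfK//; ring.
set W := ip (w n) (w n).
have -> : ip (w n) (r0 n) = x * (4 / (N * (N + 1))) by rewrite /x divfK.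
move=> H; have {}H : W = 2 * x ^+ 2 / (N + 1) + x * (x * (4 / (N * (N + 1)))).
  apply: (mulfI a1); rewrite mulrDr [(N + 1) * (_ / (N + 1))]mulrC divfK//.
  have {H} : (N + 1) * W = 2 * (- x) ^+ 2 + (N + 1) * (x * (x * (4 / (N * (N + 1))))) by rewrite -H; ring.
  by rewrite sqrrN.
by rewrite H; field; rewrite a0 a1 a2.
Qed.

Lemma w_r0_neq0 : ip (w n) (r0 n) != 0 :> R.
Proof.
have N3 : 3 <= N by rewrite ler_nat.
rewrite -sqrf_eq0 -w_r0_norm gt_eqF// divr_gt0// ?mulr_gt0//; try by lra.
exact: w_norm_gt0.
Qed.

Lemma continuous_q_r : continuous (q_r n : R -> R).
Proof.
apply: continuousBf; first exact: continuous_r0.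
by apply/continuousZf/continuous_w.
Qed.

Lemma w_q_r : ip (w n) (q_r n) = 0 :> R.
Proof.
have cw := @continuous_w R _ n3; have cr := @continuous_r0 R _ n0.
have -> : q_r n = (fun t => r0 n t + - (ip (w n) (r0 n) / ip (w n) (w n)) * w n t).
  by apply/funext => t; rewrite /q_r mulNr.
rewrite innerDr ?innerZr//; last exact: continuousZf.
by rewrite mulNr divfK ?subrr// gt_eqF// w_norm_gt0.
Qed.

(** As [q_r] is orthogonal to [w], only the product of [r0] with its mirror image and a multiple of
    [<w, r0>^2 / <w, w>] remain; [r0_gram] and [w_r0_norm] make them cancel. *)
Lemma q_r_q_l : ip (q_r n) (q_l n) = 0 :> R.
Proof.
have cw := @continuous_w R _ n3; have cr := @continuous_r0 R _ n0.
have N3 : 3 <= N by rewrite ler_nat.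
have W0 := @w_norm_gt0 R _ n3; set W := ip (w n) (w n) in W0.
set b := ip (w n) (r0 n) / W.
have -> : q_l n = (fun t => r0 n (- t) + b * s * w n t).
  by apply/funext => t; rewrite /q_l /q_r w_flip// /b -/W /s; ring.
rewrite innerDr; try exact: continuous_q_r; last exact: continuousZf; last exact: continuous_flip.
rewrite innerZr//; last exact: continuous_q_r.
rewrite [ip (q_r n) (w n)]innerC w_q_r mulr0 addr0.
have -> : q_r n = (fun t => r0 n t + - b * w n t).
  by apply/funext => t; rewrite /q_r mulNr.
rewrite innerDl ?innerZl//; try exact: continuous_flip; last exact: continuousZf.
have [_ ->] := @r0_gram R _ n0; rewrite w_r0_flip.
transitivity (s * (b * ip (w n) (r0 n) - 8 / (N * (N + 1) * (N + 2)))); first by rewrite /s; ring.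
suff -> : b * ip (w n) (r0 n) = 8 / (N * (N + 1) * (N + 2)) by rewrite subrr mulr0.
rewrite /b mulrAC -expr2 -w_r0_norm -/W; field.
by rewrite (gt_eqF W0) !gt_eqF//; lra.
Qed.

End KeyIdentity.

(** * Inner products of compactly supported functions *)

Section RealLine.
Context {R : realType}.
Notation mu := (@lebesgue_measure R).
Implicit Types (f g h : R -> R) (a b c k : R).

Definition dot f g : R := inner setT f g.

(** The endpoints are included, so functions on adjacent intervals have product zero everywhere. *)
Definition supp a b f := forall t, t <= a \/ b <= t -> f t = 0.

Definition cc f := continuous f /\ exists a b, supp a b f.

Lemma suppW a b a' b' f : a' <= a -> b <= b' -> supp a b f -> supp a' b' f.
Proof. by move=> aa bb sf t [ta|tb]; apply: sf; [left|right]; lra. Qed.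

Lemma suppD a b f g : supp a b f -> supp a b g -> supp a b (fun t => f t + g t).
Proof. by move=> sf sg t ab; rewrite sf ?sg ?addr0. Qed.

Lemma suppZ a b k f : supp a b f -> supp a b (fun t => k * f t).
Proof. by move=> sf t ab; rewrite sf ?mulr0. Qed.

Lemma supp_affine a b k c f : 0 < k -> supp a b f ->
  supp ((a - c) / k) ((b - c) / k) (fun t => f (k * t + c)).
Proof.
move=> k0 sf t; rewrite ler_pdivlMr// ler_pdivrMr// => H.
by apply: sf; case: H => H; [left|right]; lra.
Qed.

Lemma supp_opp a b f : supp a b f -> supp (- b) (- a) (fun t => f (- t)).
Proof. by move=> sf t H; apply: sf; case: H => H; [right|left]; lra. Qed.

Lemma supp_disj a b c d f g : supp a b f -> supp c d g -> b <= c ->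
  forall t, f t * g t = 0.
Proof.
move=> sf sg bc t; have [bt|tb] := leP b t; first by rewrite sf ?mul0r//; right.
by rewrite sg ?mulr0//; left; lra.
Qed.

Lemma cc_cont f : cc f -> continuous f. Proof. by case. Qed.

Lemma cc0 : cc (fun=> 0).
Proof. by split; [exact: cst_continuous|exists 0, 0]. Qed.

Lemma ccD f g : cc f -> cc g -> cc (fun t => f t + g t).
Proof.
move=> [cf [a [b sf]]] [cg [a' [b' sg]]]; split; first exact: continuousDf.
exists (Num.min a a'), (Num.max b b'); apply: suppD.
  by apply: suppW sf; rewrite ?ge_min ?le_max lexx.
by apply: suppW sg; rewrite ?ge_min ?le_max lexx orbT.
Qed.

Lemma ccZ k f : cc f -> cc (fun t => k * f t).
Proof.
move=> [cf [a [b sf]]]; split; first exact: continuousZf.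
by exists a, b; exact: suppZ.
Qed.

Lemma ccN f : cc f -> cc (fun t => - f t).
Proof.
by move=> /(ccZ (-1)); under eq_fun do rewrite mulN1r.
Qed.

Lemma ccB f g : cc f -> cc g -> cc (fun t => f t - g t).
Proof. by move=> cf /ccN; exact: ccD. Qed.

Lemma cc_sum (I : Type) (s : seq I) (F : I -> R -> R) :
  (forall i, cc (F i)) -> cc (fun t => \sum_(i <- s) F i t).
Proof.
move=> cF; elim: s => [|i s IH].
  by under eq_fun do rewrite big_nil; exact: cc0.
by under eq_fun do rewrite big_cons; exact: ccD.
Qed.

Lemma cc_affine k c f : 0 < k -> cc f -> cc (fun t => f (k * t + c)).
Proof.
move=> k0 [cf [a [b sf]]]; split.
  by apply: (continuous_compf cf); exact: continuous_affine.
by exists ((a - c) / k), ((b - c) / k); exact: supp_affine.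
Qed.

Lemma cc_opp f : cc f -> cc (fun t => f (- t)).
Proof.
move=> [cf [a [b sf]]]; split.
  by apply: (continuous_compf cf) => t; exact: continuousN.
by exists (- b), (- a); exact: supp_opp.
Qed.

Lemma ccM f g : cc f -> continuous g -> cc (fun t => f t * g t).
Proof.
move=> [cf [a [b sf]]] cg; split; first exact: continuousMf.
by exists a, b => t tab; rewrite sf ?mul0r.
Qed.

Lemma integral_supp a b f : supp a b f -> \int[mu]_(t in setT) f t = itg a b f.
Proof.
move=> sf; rewrite /itg [RHS]Rintegral_mkcond; congr Rintegral.
apply/funext => t; rewrite patchE; case: ifPn => //.
rewrite notin_setE/= in_itv/= => /negP; rewrite negb_and -!ltNge => H.
by apply: sf; case/orP: H => /ltW; [left|right].
Qed.

Lemma dot_supp a b f g : supp a b f -> dot f g = inner `[a, b] f g.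
Proof.
by move=> sf; apply: integral_supp => t tab; rewrite sf ?mul0r.
Qed.

Lemma cc_integrable f : cc f -> mu.-integrable setT (EFin \o f).
Proof.
move=> [cf [a [b sf]]].
have -> : EFin \o f = (EFin \o f) \_ `[a, b].
  apply/funext => t; rewrite patchE; case: ifPn => //.
  rewrite notin_setE/= in_itv/= => /negP; rewrite negb_and -!ltNge => H.
  by rewrite sf//; case/orP: H => /ltW; [left|right].
by rewrite -integrable_mkcond//; exact: cont_integrable.
Qed.

Lemma dotC f g : dot f g = dot g f. Proof. exact: innerC. Qed.

Lemma dotDl f g h : cc f -> cc g -> cc h ->
  dot (fun t => f t + g t) h = dot f h + dot g h.
Proof.
move=> cf cg ch; rewrite /dot /inner -RintegralD//.
- by apply: eq_Rintegral => t _; rewrite mulrDl.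
- by apply: cc_integrable; apply: ccM => //; exact: cc_cont.
- by apply: cc_integrable; apply: ccM => //; exact: cc_cont.
Qed.

Lemma dotZl k f h : cc f -> cc h -> dot (fun t => k * f t) h = k * dot f h.
Proof.
move=> cf ch; rewrite /dot /inner -RintegralZl//.
- by apply: eq_Rintegral => t _; rewrite mulrA.
- by apply: cc_integrable; apply: ccM => //; exact: cc_cont.
Qed.

Lemma dotNl f h : cc f -> cc h -> dot (fun t => - f t) h = - dot f h.
Proof.
by move=> cf ch; rewrite -mulN1r -dotZl//; congr dot; apply/funext => t; rewrite mulN1r.
Qed.

Lemma dotBl f g h : cc f -> cc g -> cc h ->
  dot (fun t => f t - g t) h = dot f h - dot g h.
Proof. by move=> cf cg ch; rewrite dotDl ?dotNl//; exact: ccN. Qed.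

Lemma dotBr f g h : cc f -> cc g -> cc h ->
  dot h (fun t => f t - g t) = dot h f - dot h g.
Proof. by move=> *; rewrite dotC dotBl// dotC [X in _ - X]dotC. Qed.

Lemma dotZr k f h : cc f -> cc h -> dot h (fun t => k * f t) = k * dot h f.
Proof. by move=> *; rewrite dotC dotZl// dotC. Qed.

Lemma dot0l h : dot (fun=> 0) h = 0.
Proof.
rewrite /dot /inner; under eq_Rintegral do rewrite mul0r.
by rewrite /Rintegral integral0.
Qed.

Lemma dot_suml (I : Type) (s : seq I) (F : I -> R -> R) h :
  (forall i, cc (F i)) -> cc h ->
  dot (fun t => \sum_(i <- s) F i t) h = \sum_(i <- s) dot (F i) h.
Proof.
move=> cF ch; elim: s => [|i s IH].
  by rewrite big_nil -[RHS](dot0l h); congr dot; apply/funext => t; rewrite big_nil.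
have -> : (fun t => \sum_(j <- i :: s) F j t) = fun t => F i t + \sum_(j <- s) F j t.
  by apply/funext => t; rewrite big_cons.
by rewrite dotDl ?IH ?big_cons//; exact: cc_sum.
Qed.

Lemma dot_sumr (I : Type) (s : seq I) (F : I -> R -> R) h :
  (forall i, cc (F i)) -> cc h ->
  dot h (fun t => \sum_(i <- s) F i t) = \sum_(i <- s) dot h (F i).
Proof.
by move=> cF ch; rewrite dotC dot_suml//; apply: eq_bigr => i _; exact: dotC.
Qed.

Lemma dot_disj f g : (forall t, f t * g t = 0) -> dot f g = 0.
Proof.
move=> fg; rewrite /dot /inner; under eq_Rintegral do rewrite fg.
by rewrite /Rintegral integral0.
Qed.

Lemma dot_ge0 f : 0 <= dot f f. Proof. exact: inner_ge0. Qed.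

Lemma cc_supp_lt f : cc f -> exists a b, a < b /\ supp a b f.
Proof.
move=> [_ [a [b sf]]]; exists (Num.min a b - 1), (Num.max a b + 1); split.
  have : Num.min a b <= Num.max a b by rewrite ge_min le_max lexx.
  by lra.
apply: suppW sf.
  by have : Num.min a b <= a by [rewrite ge_min lexx]; lra.
by have : b <= Num.max a b by [rewrite le_max lexx orbT]; lra.
Qed.

Lemma dot_eq0 f : cc f -> dot f f = 0 -> forall t, f t = 0.
Proof.
move=> ccf; have [cf _] := ccf; have [a [b [ab sf]]] := cc_supp_lt ccf.
rewrite (dot_supp f sf) => H t; have [at_|] := leP t a; first by apply: sf; left.
have [bt|tb ta] := leP b t; first by move=> _; apply: sf; right.
by apply: (inner_eq0 cf ab H); rewrite !ltW.
Qed.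

Lemma dot_gt0 f t : cc f -> f t != 0 -> 0 < dot f f.
Proof.
move=> cf ft; rewrite lt_neqAle dot_ge0 andbT eq_sym.
by apply/eqP => /(dot_eq0 cf)/(_ t)/eqP; rewrite (negbTE ft).
Qed.

Lemma dot_affine k c f g : 0 < k -> cc f -> cc g ->
  dot (fun t => f (k * t + c)) (fun t => g (k * t + c)) = k^-1 * dot f g.
Proof.
move=> k0 cf cg; have [a [b [ab sf]]] := cc_supp_lt cf.
rewrite (dot_supp _ (supp_affine (c := c) k0 sf)) (dot_supp g sf) !innerE.
have kn0 : k != 0 by rewrite gt_eqF.
have := @itg_affine _ ((a - c) / k) ((b - c) / k) k c (fun t => f t * g t)
  (continuousMf (cc_cont cf) (cc_cont cg)).
rewrite ![k * (_ / k)]mulrC !divfK// !subrK => -> //; first by rewrite mulKf.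
by rewrite ler_pdivrMr// divfK//; lra.
Qed.

Lemma dot_opp f g : cc f -> cc g ->
  dot (fun t => f (- t)) (fun t => g (- t)) = dot f g.
Proof.
move=> cf cg; have [a [b [ab sf]]] := cc_supp_lt cf.
rewrite (dot_supp _ (supp_opp sf)) (dot_supp g sf) !innerE.
have H := @itg_opp R (- b) (- a) (fun t => f t * g t) (continuousMf (cc_cont cf) (cc_cont cg)).
by rewrite -H ?opprK//; lra.
Qed.

Lemma dot_shift c f g : cc f -> cc g ->
  dot (fun t => f (t + c)) (fun t => g (t + c)) = dot f g.
Proof.
move=> cf cg; have := dot_affine c (@ltr01 R) cf cg; rewrite invr1 mul1r => <-.
by congr dot; apply/funext => t; rewrite mul1r.
Qed.

Lemma dot_reflect c f g : cc f -> cc g ->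
  dot (fun t => f (c - t)) (fun t => g (c - t)) = dot f g.
Proof.
move=> cf cg; have cF h : cc h -> cc (fun t => h (t + c)).
  by move=> /(@cc_affine 1 c h ltr01); under eq_fun do rewrite mul1r.
rewrite -(dot_shift c cf cg) -(dot_opp (cF _ cf) (cF _ cg)).
by congr dot; apply/funext => t; rewrite addrC.
Qed.

Lemma cc_shift c f : cc f -> cc (fun t => f (t + c)).
Proof. by move=> /(@cc_affine 1 c f ltr01); under eq_fun do rewrite mul1r. Qed.

End RealLine.

(** * Scaling functions *)

Section ScalingFunctions.
Context {R : realType} (n : nat).
Hypothesis n3 : (3 <= n)%N.
Implicit Types (f g h F G H : R -> R) (p q : {poly R}) (t x a b : R).
Local Notation ip := (inner `[(-1)%R, 1%R]).
Local Notation W := (@w R n).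
Local Notation qr := (@q_r R n).
Local Notation ql := (@q_l R n).
Local Notation phit k := (@phit R n k).

Let n0 : (0 < n)%N. Proof. by lia. Qed.
Let cW : continuous W := @continuous_w R n n3.
Let cqr : continuous qr := @continuous_q_r R n n3.

Definition bas k : R -> R := if k == 1%N then W else phi0 k.

Lemma continuous_bas k : continuous (bas k).
Proof. by rewrite /bas; case: eqP => _; [exact: cW|exact: continuous_phi0]. Qed.

Lemma continuous_q_l : continuous ql.
Proof. exact: continuous_flip. Qed.

Lemma q_r1 : qr 1 = 2.
Proof. by have [p [_ pE _ p1 _]] := @r0P R n n0; rewrite /q_r pE p1 w1// mulr0 subr0. Qed.

Lemma q_rN1 : qr (-1) = 0.
Proof. by have [p [_ pE p1 _ _]] := @r0P R n n0; rewrite /q_r pE p1 wN1// mulr0 subr0. Qed.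

Lemma q_l1 : ql 1 = 0. Proof. by rewrite /q_l q_rN1. Qed.

Lemma q_lN1 : ql (-1) = 2. Proof. by rewrite /q_l opprK q_r1. Qed.

Lemma bas1 k : bas k 1 = 0.
Proof. by rewrite /bas; case: eqP => _; [rewrite w1|rewrite phi0_at1]. Qed.

Lemma basN1 k : bas k (-1) = 0.
Proof. by rewrite /bas; case: eqP => _; [rewrite wN1|rewrite phi0_atN1]. Qed.

(** The parity of [bas k]; the same signs occur in the vectors searched by the algorithm. *)
Definition bas_sign k : R := if k == 1%N then - (-1) ^+ n else (-1) ^+ k.

Lemma bas_flip k x : (0 < k)%N -> bas k (- x) = bas_sign k * bas k x.
Proof.
rewrite /bas /bas_sign; case: eqP => [_ _|/eqP k1 k0]; first exact: w_flip.
by rewrite phi0_flip//; lia.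
Qed.

Lemma q_r_bas k : (0 < k <= n)%N -> ip qr (bas k) = 0.
Proof.
move=> /andP[k0 kn]; rewrite /bas; case: eqP => [_|/eqP k1]; first by rewrite innerC w_q_r.
have kr : (2 <= k <= n)%N by lia.
have -> : qr = (fun t => r0 n t + - (ip W (r0 n) / ip W W) * W t).
  by apply/funext => t; rewrite /q_r mulNr.
rewrite innerDl ?innerZl//; try exact: continuous_phi0; try exact: continuous_r0; last exact: continuousZf.
rewrite w_orth_phi0// mulr0 addr0.
have [p [_ pE _ _ Hp]] := @r0P R n n0.
by rewrite pE phi0E; apply: Hp; exact: isbub_phip.
Qed.

Lemma q_l_bas k : (0 < k <= n)%N -> ip ql (bas k) = 0.
Proof.
move=> kn; have cb : continuous (bas k) by exact: continuous_bas.
rewrite -inner_flip//; last exact: continuous_q_l.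
have -> : (fun t => bas k (- t)) = (fun t => bas_sign k * bas k t).
  by apply/funext => t; rewrite bas_flip//; lia.
have -> : (fun t => ql (- t)) = qr by apply/funext => t; rewrite /q_l opprK.
by rewrite innerZr// q_r_bas// mulr0.
Qed.

Lemma bas_orth k l : (0 < k <= n)%N -> (0 < l <= n)%N -> k != l -> ip (bas k) (bas l) = 0.
Proof.
move=> kn ln kl; rewrite /bas; case: (eqVneq k 1%N) => k1; case: (eqVneq l 1%N) => l1.
- by move: kl; rewrite k1 l1.
- by rewrite w_orth_phi0//; lia.
- by rewrite innerC w_orth_phi0//; lia.
- by rewrite phi0_orth//; lia.
Qed.

Lemma bas_norm_neq0 k : ip (bas k) (bas k) != 0.
Proof.
rewrite /bas; case: (k =P 1%N) => _; last exact: phi0_norm_neq0.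
by rewrite gt_eqF// w_norm_gt0.
Qed.

Lemma continuous_maxf f g : continuous f -> continuous g ->
  continuous (fun x => Num.max (f x) (g x)).
Proof.
move=> cf cg; under eq_fun do rewrite maxr_absE.
apply: continuousMf; last exact: cst_continuous.
apply: continuousDf; first exact: continuousDf.
by apply: (continuous_compf (f := fun x : R => `|x|)); [exact: norm_continuous|exact: continuousBf].
Qed.

Lemma continuous_minf f g : continuous f -> continuous g ->
  continuous (fun x => Num.min (f x) (g x)).
Proof.
move=> cf cg; under eq_fun do rewrite minr_absE.
apply: continuousMf; last exact: cst_continuous.
apply: continuousBf; first exact: continuousDf.
by apply: (continuous_compf (f := fun x : R => `|x|)); [exact: norm_continuous|exact: continuousBf].
Qed.

(* [clamp] replaces the case distinction in [phit] by a formula whose continuity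
   is visible. *)
Definition clamp x : R := Num.max (-1) (Num.min 1 x).

Lemma continuous_clamp : continuous clamp.
Proof.
apply: continuous_maxf; first exact: cst_continuous.
by apply: continuous_minf; [exact: cst_continuous|move=> x; exact: cvg_id].
Qed.

Lemma clamp_id x : -1 <= x <= 1 -> clamp x = x.
Proof. by move=> /andP[x1 x2]; rewrite /clamp min_r// max_r. Qed.

Lemma clamp_le x : x <= -1 -> clamp x = -1.
Proof. by move=> x1; rewrite /clamp max_l// ge_min x1 orbT. Qed.

Lemma clamp_ge x : 1 <= x -> clamp x = 1.
Proof. by move=> x1; rewrite /clamp min_l// max_r//; lra. Qed.

Lemma phitE k t : (0 < k)%N -> phit k t = bas k (clamp (2 * t - 1)).
Proof.
move=> k0; rewrite /Defs.phit gtn_eqF//.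
case: ifPn => [/andP[t0 t1]|].
  by rewrite clamp_id; [rewrite /bas; case: eqP|lra].
rewrite negb_and -ltNge -leNgt => /orP[t0|t1].
  by rewrite clamp_le ?basN1//; lra.
by rewrite clamp_ge ?bas1//; lra.
Qed.

(** Off its own cell each clamped term is constant. At the common endpoint 0 both have the value 2,
    which is subtracted once. *)
Lemma phit0E t : phit 0 t = qr (clamp (2 * t + 1)) + ql (clamp (2 * t - 1)) - 2.
Proof.
rewrite /Defs.phit eqxx; case: ifPn => [/andP[t0 t1]|N1].
  by rewrite clamp_id ?clamp_le ?q_lN1; lra.
case: ifPn => [/andP[t0 t1]|N2].
  by rewrite clamp_ge ?clamp_id ?q_r1; lra.
have [t1|t1] := leP t (-1); first by rewrite !clamp_le ?q_rN1 ?q_lN1; lra.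
by rewrite !clamp_ge ?q_r1 ?q_l1; lra.
Qed.

Lemma supp_phit k : (0 < k)%N -> supp 0 1 (phit k).
Proof.
move=> k0 t tt; rewrite phitE//; case: tt => tt.
  by rewrite clamp_le ?basN1//; lra.
by rewrite clamp_ge ?bas1//; lra.
Qed.

Lemma supp_phit0 : supp (-1) 1 (phit 0).
Proof.
move=> t tt; rewrite phit0E; case: tt => tt.
  by rewrite !clamp_le ?q_rN1 ?q_lN1; lra.
by rewrite !clamp_ge ?q_r1 ?q_l1; lra.
Qed.

Lemma supp_phitW k : supp (-1) 1 (phit k).
Proof.
case: k => [|k]; first exact: supp_phit0.
by apply: suppW (supp_phit _) => //; lra.
Qed.

Lemma cc_phit k : cc (phit k).
Proof.
split; last by exists (-1), 1; exact: supp_phitW.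
have cc2 c : continuous (fun t : R => clamp (2 * t + c)).
  by apply: (continuous_compf continuous_clamp); exact: continuous_affine.
case: k => [|k].
  have -> : phit 0 = (fun t => qr (clamp (2 * t + 1)) + ql (clamp (2 * t + -1)) - 2).
    by apply/funext => t; exact: phit0E.
  apply: continuousBf; last exact: cst_continuous.
  by apply: continuousDf; [exact: (continuous_compf cqr)|exact: (continuous_compf continuous_q_l)].
have -> : phit k.+1 = (fun t => bas k.+1 (clamp (2 * t + -1))).
  by apply/funext => t; exact: phitE.
by apply: (continuous_compf (f := bas k.+1)) => //; exact: continuous_bas.
Qed.

Lemma phit_cell k t : (0 < k)%N -> 0 <= t <= 1 -> phit k t = bas k (2 * t - 1).
Proof. by move=> k0 t01; rewrite phitE// clamp_id//; lra. Qed.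

Lemma phit0_cellN t : -1 <= t <= 0 -> phit 0 t = qr (2 * t + 1).
Proof. by move=> t01; rewrite phit0E clamp_id ?clamp_le ?q_lN1; lra. Qed.

Lemma phit0_cellP t : 0 <= t <= 1 -> phit 0 t = ql (2 * t - 1).
Proof. by move=> t01; rewrite phit0E clamp_ge ?clamp_id ?q_r1; lra. Qed.

Lemma phit0_0 : phit 0 0 = 2.
Proof. by rewrite phit0_cellP ?mulr0 ?sub0r ?q_lN1//; lra. Qed.

Lemma phit_0 k : (0 < k)%N -> phit k 0 = 0.
Proof. by move=> k0; apply: supp_phit => //; left. Qed.

Lemma phit0_opp t : phit 0 (- t) = phit 0 t.
Proof.
have [t0|t0] := leP t 0; last first.
  have [t1|t1] := leP 1 t; first by rewrite !supp_phit0//; [right|left]; lra.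
  rewrite phit0_cellN ?phit0_cellP /q_l; last 2 first; [lra|lra|].
  by congr q_r; ring.
have [t1|t1] := leP t (-1); first by rewrite !supp_phit0//; [left|right]; lra.
rewrite phit0_cellP ?phit0_cellN /q_l; last 2 first; [lra|lra|].
by congr q_r; ring.
Qed.

Lemma phit_reflect k t : (0 < k)%N -> phit k (1 - t) = bas_sign k * phit k t.
Proof.
move=> k0; have [t0|t0] := leP t 0.
  by rewrite !supp_phit ?mulr0//; [left|right]; lra.
have [t1|t1] := leP 1 t; first by rewrite !supp_phit ?mulr0//; [right|left]; lra.
rewrite !phit_cell//; [|lra|lra].
by rewrite -bas_flip//; congr bas; ring.
Qed.

Lemma dot_cell a F G f g : continuous f -> continuous g ->
  (forall t, t <= a \/ a + 1 <= t -> F t * G t = 0) ->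
  (forall t, a <= t <= a + 1 -> F t = f (2 * (t - a) - 1)) ->
  (forall t, a <= t <= a + 1 -> G t = g (2 * (t - a) - 1)) ->
  dot F G = 1 / 2 * ip f g.
Proof.
move=> cf cg sFG Ff Gg; rewrite /dot /inner (integral_supp sFG) -/(itg _ _ _).
rewrite (eq_itg (g := fun t => f (2 * t + (- 2 * a - 1)) * g (2 * t + (- 2 * a - 1)))); last first.
  move=> t ta; rewrite Ff// Gg//.
  by have -> : 2 * (t - a) - 1 = 2 * t + (- 2 * a - 1) by ring.
have := @itg_affine R a (a + 1) 2 (- 2 * a - 1) _ (continuousMf cf cg).
have -> : 2 * a + (- 2 * a - 1) = -1 by ring.
have -> : 2 * (a + 1) + (- 2 * a - 1) = 1 by ring.
move=> H; rewrite /itg in H *; rewrite H; [by field|lra|lra].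
Qed.

Lemma supp_shift a b c f : supp a b f -> supp (a + c) (b + c) (fun t => f (t - c)).
Proof. by move=> sf t tt; apply: sf; case: tt => tt; [left|right]; lra. Qed.

Lemma cc_shiftB c f : cc f -> cc (fun t => f (t - c)).
Proof. exact: cc_shift. Qed.

(** Only products on a common cell count. Distinct translates of [phit 0] share a cell only when
    they are neighbours, and there [q_r] meets [q_l]; otherwise [q_r], [q_l] or another [bas] meets
    a [bas]. *)
Lemma phit_orth k l (i : int) : (k <= n)%N -> (l <= n)%N -> (k != l) || (i != 0) ->
  dot (phit k) (fun t => phit l (t - i%:~R)) = 0.
Proof.
have P0 l' (j : int) : (0 < l' <= n)%N -> dot (phit 0) (fun t => phit l' (t - j%:~R)) = 0.
  move=> ln'; have /andP[l0 ln] := ln'.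
  have sl := supp_shift (c := j%:~R) (supp_phit l0).
  have cb : continuous (bas l') by exact: continuous_bas.
  have [jE|j0] := eqVneq j 0.
    rewrite jE in sl *.
    rewrite (@dot_cell 0 _ _ ql (bas l'))//.
    - by rewrite q_l_bas ?mulr0.
    - exact: continuous_q_l.
    - by move=> t tt; rewrite (sl t) ?mulr0//; case: tt => tt; [left|right]; lra.
    - by move=> t tt; rewrite phit0_cellP ?subr0//; lra.
    - by move=> t tt; rewrite phit_cell ?subr0//; lra.
  have [jE|j1] := eqVneq j (-1).
    rewrite jE in sl *.
    rewrite (@dot_cell (-1) _ _ qr (bas l'))//.
    - by rewrite q_r_bas ?mulr0.
    - by move=> t tt; rewrite mulrC; rewrite (sl t) ?mul0r//; case: tt => tt; [left|right]; lra.
    - by move=> t tt; rewrite phit0_cellN; [congr qr; ring|lra].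
    - by move=> t tt; rewrite phit_cell//; lra.
  have [jp|jn] : 1 <= j \/ j <= - 2 by lia.
    apply: dot_disj; apply: (supp_disj supp_phit0 sl).
    by move: jp; rewrite -(ler_int R); lra.
  apply: dot_disj => t; rewrite mulrC; apply: (supp_disj sl supp_phit0).
  by move: jn; rewrite -(ler_int R); lra.
move=> kn ln; case: k kn => [|k] kn; case: l ln => [|l] ln.
- rewrite eqxx /= => i0; have sl := supp_shift (c := i%:~R) supp_phit0.
  have [->|i1] := eqVneq i 1.
    rewrite (@dot_cell 0 _ _ ql qr)//.
    + by rewrite innerC q_r_q_l ?mulr0.
    + exact: continuous_q_l.
    + move=> t [tt|tt]; last by rewrite supp_phit0 ?mul0r//; right; lra.
      by rewrite mulrC [X in X * _]supp_phit0 ?mul0r//; left; lra.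
    + by move=> t tt; rewrite phit0_cellP ?subr0//; lra.
    + by move=> t tt; rewrite phit0_cellN; [congr qr; ring|lra].
  have [->|i2] := eqVneq i (-1).
    rewrite (@dot_cell (-1) _ _ qr ql)//.
    + by rewrite q_r_q_l ?mulr0.
    + exact: continuous_q_l.
    + move=> t [tt|tt]; first by rewrite supp_phit0 ?mul0r//; left; lra.
      by rewrite mulrC [X in X * _]supp_phit0 ?mul0r//; right; lra.
    + by move=> t tt; rewrite phit0_cellN; [congr qr; ring|lra].
    + by move=> t tt; rewrite phit0_cellP; [congr ql; ring|lra].
  have [jp|jn] : 2 <= i \/ i <= - 2 by lia.
    apply: dot_disj; apply: (supp_disj supp_phit0 sl).
    by move: jp; rewrite -(ler_int R); lra.
  apply: dot_disj => t; rewrite mulrC; apply: (supp_disj sl supp_phit0).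
  by move: jn; rewrite -(ler_int R); lra.
- by move=> _; exact: P0.
- move=> _; rewrite -(dot_shift i%:~R); [|exact: cc_phit|exact/cc_shiftB/cc_phit].
  have -> : (fun t => phit 0 (t + i%:~R - i%:~R)) = phit 0 by apply/funext => t; rewrite addrK.
  rewrite dotC; have := P0 k.+1 (- i) kn.
  by under [X in dot _ X = _]eq_fun do rewrite rmorphN opprK.
have sl := supp_shift (c := i%:~R) (supp_phit (ltn0Sn l)).
have sk := supp_phit (ltn0Sn k).
have [->|i0 _] := eqVneq i 0.
  rewrite orbF => kl; rewrite (@dot_cell 0 _ _ (bas k.+1) (bas l.+1)).
  - by rewrite bas_orth ?mulr0.
  - exact: continuous_bas.
  - exact: continuous_bas.
  - by move=> t tt; rewrite sk ?mul0r//; case: tt => tt; [left|right]; lra.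
  - by move=> t tt; rewrite phit_cell ?subr0//; lra.
  - by move=> t tt; rewrite phit_cell ?subr0//; lra.
have [jp|jn] : 1 <= i \/ i <= - 1 by lia.
  apply: dot_disj; apply: (supp_disj sk sl).
  by move: jp; rewrite -(ler_int R); lra.
apply: dot_disj => t; rewrite mulrC; apply: (supp_disj sl sk).
by move: jn; rewrite -(ler_int R); lra.
Qed.

Lemma phit_norm_gt0 k : 0 < dot (phit k) (phit k).
Proof.
case: k => [|k]; first by apply: (dot_gt0 (t := 0) (cc_phit _)); rewrite phit0_0 pnatr_eq0.
rewrite lt_neqAle dot_ge0 andbT eq_sym.
rewrite (@dot_cell 0 _ _ (bas k.+1) (bas k.+1)).
- by rewrite mulf_neq0 ?bas_norm_neq0//; lra.
- exact: continuous_bas.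
- exact: continuous_bas.
- move=> t tt; rewrite supp_phit ?mul0r//; case: tt => tt; [left|right]; lra.
- by move=> t tt; rewrite phit_cell ?subr0//; lra.
- by move=> t tt; rewrite phit_cell ?subr0//; lra.
Qed.

End ScalingFunctions.

(** * The space V_0 *)

Section MultiresolutionSpace.
Context {R : realType} (n : nat).
Hypothesis n3 : (3 <= n)%N.
Implicit Types (f g h F G H : R -> R) (p q : {poly R}) (t x a b c : R) (i j : int).
Local Notation ip := (inner `[(-1)%R, 1%R]).
Local Notation W := (@w R n).
Local Notation qr := (@q_r R n).
Local Notation ql := (@q_l R n).
Local Notation phit k := (@phit R n k).
Local Notation bas := (@bas R n).

Let n0 : (0 < n)%N. Proof. by lia. Qed.

(** The form of a function of [V_0] on a cell rescaled to [[-1, 1]]. *)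
Definition inW H := exists p c, (size p <= n.+1)%N /\ forall x, H x = p.[x] + c * W x.

Definition cell F i := exists p c, (size p <= n.+1)%N /\
  forall t, i%:~R <= t <= i%:~R + 1 -> F t = p.[t] + c * W (2 * (t - i%:~R) - 1).

(* [V_0]: in terms of its cells, it visibly satisfies [V_0 \subset V_1]. *)
Definition VV F := cc F /\ forall i, cell F i.

Lemma poly_affine p k c : (size p <= n.+1)%N -> exists2 q : {poly R},
  (size q <= n.+1)%N & forall t, q.[t] = p.[k * t + c].
Proof.
move=> sp; exists (p \Po (k *: 'X + c%:P)); last by move=> t; rewrite horner_comp !hornerE.
apply: (leq_trans (size_comp_poly_leq _ _)).
have : (size (k *: 'X + c%:P : {poly R})%R <= 2)%N.
  apply: (leq_trans (size_polyD _ _)); rewrite geq_max.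
  rewrite (leq_trans (size_scale_leq _ _)) ?size_polyX//=.
  by rewrite (leq_trans (size_polyC_leq1 _)).
move=> s2; rewrite ltnS; apply: (@leq_trans ((size p).-1 * 1)).
  by apply: leq_mul => //; move: s2; case: size.
by rewrite muln1; lia.
Qed.

Lemma inW_poly p : (size p <= n.+1)%N -> inW (horner p).
Proof. by move=> sp; exists p, 0; split=> // x; rewrite mul0r addr0. Qed.

Lemma inW_w : inW W.
Proof. by exists 0, 1; rewrite size_poly0; split=> // x; rewrite horner0 add0r mul1r. Qed.

Lemma inW_q_r : inW qr.
Proof.
have [p [sp pE _ _ _]] := @r0P R n n0.
exists p, (- (ip W (r0 n) / ip W W)); split=> // x.
by rewrite /q_r pE mulNr.
Qed.

Lemma inW_q_l : inW ql.
Proof.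
have [p [c [sp pE]]] := inW_q_r.
exists (pflip p), (c * - (-1) ^+ n); rewrite size_pflip; split=> // x.
by rewrite /q_l pE w_flip// horner_pflip mulrA.
Qed.

Lemma inW_bas k : (0 < k <= n)%N -> inW (bas k).
Proof.
rewrite /bas; case: (k =P 1%N) => [_ _|k1 kn]; first exact: inW_w.
by rewrite phi0E; apply: inW_poly; have [] := @isbub_phip R n k; lia.
Qed.

Lemma cell_inW F i H : inW H ->
  (forall t, i%:~R <= t <= i%:~R + 1 -> F t = H (2 * (t - i%:~R) - 1)) -> cell F i.
Proof.
move=> [p [c [sp HE]]] FH; have [q sq qE] := poly_affine 2 (- 2 * i%:~R - 1) sp.
exists q, c; split=> // t tt; rewrite FH// HE qE; congr (_.[_] + _); ring.
Qed.

Lemma cell_inW_exists F i : cell F i -> exists H, inW H /\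
  forall t, i%:~R <= t <= i%:~R + 1 -> F t = H (2 * (t - i%:~R) - 1).
Proof.
move=> [p [c [sp FE]]]; have [q sq qE] := poly_affine (1 / 2) (1 / 2 + i%:~R) sp.
exists (fun x => q.[x] + c * W x); split; first by exists q, c.
by move=> t tt; rewrite FE// qE; congr (_.[_] + _); field.
Qed.

Lemma cell_ext F G i : (forall t, i%:~R <= t <= i%:~R + 1 -> F t = G t) ->
  cell G i -> cell F i.
Proof.
by move=> FG [p [c [sp E]]]; exists p, c; split=> // t tt; rewrite FG ?E.
Qed.

Lemma cell_poly F i p : (size p <= n.+1)%N ->
  (forall t, i%:~R <= t <= i%:~R + 1 -> F t = p.[t]) -> cell F i.
Proof. by move=> sp E; exists p, 0; split=> // t tt; rewrite mul0r addr0 E. Qed.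

Lemma cell0 F i : (forall t, i%:~R <= t <= i%:~R + 1 -> F t = 0) -> cell F i.
Proof.
by move=> F0; apply: (@cell_poly _ _ 0); [rewrite size_poly0|move=> t tt; rewrite horner0 F0].
Qed.

Lemma cellD F G i : cell F i -> cell G i -> cell (fun t => F t + G t) i.
Proof.
move=> [p [c [sp E]]] [q [d [sq E']]]; exists (p + q), (c + d); split.
  by apply: (leq_trans (size_polyD _ _)); rewrite geq_max sp sq.
by move=> t tt; rewrite E// E'// hornerD; ring.
Qed.

Lemma cellZ k F i : cell F i -> cell (fun t => k * F t) i.
Proof.
move=> [p [c [sp E]]]; exists (k *: p), (k * c); split.
  exact: (leq_trans (size_scale_leq _ _)).
by move=> t tt; rewrite E// hornerZ; ring.
Qed.

Lemma cell_shift F i j : cell F (i - j) -> cell (fun t => F (t - j%:~R)) i.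
Proof.
move=> [p [c [sp E]]]; have [q sq qE] := poly_affine 1 (- j%:~R) sp.
exists q, c; split=> // t tt; rewrite qE mul1r E; last by rewrite rmorphB/=; lra.
by congr (_ + _ * W _); rewrite rmorphB/=; ring.
Qed.

Lemma w_poly_pos : exists2 p : {poly R}, (size p <= n.+1)%N & forall x, 0 <= x -> W x = p.[x].
Proof.
have [p [sp pE _]] := @wP R n n3.
exists (p - alpha n *: 'X^n - 'X^(n - 2)).
  apply: (leq_trans (size_polyD _ _)); rewrite geq_max size_polyN size_polyXn.
  apply/andP; split; last by lia.
  apply: (leq_trans (size_polyD _ _)); rewrite geq_max sp size_polyN.
  by rewrite (leq_trans (size_scale_leq _ _))// size_polyXn.
move=> x x0; rewrite pE /absX ger0_norm// -!exprS !(hornerD, hornerN, hornerZ, hornerXn).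
by have -> : (n - 1).+1 = n by [lia]; have -> : (n - 3).+1 = (n - 2)%N by lia.
Qed.

Lemma w_poly_neg : exists2 p : {poly R}, (size p <= n.+1)%N & forall x, x <= 0 -> W x = p.[x].
Proof.
have [p sp pE] := w_poly_pos; exists (- (-1) ^+ n *: pflip p).
  by rewrite (leq_trans (size_scale_leq _ _))// size_pflip.
move=> x x0; rewrite hornerZ horner_pflip -pE; last by rewrite oppr_ge0.
by rewrite -w_flip// opprK.
Qed.

Lemma cell_half F i : (forall j, cell F j) -> cell (fun t => F (t / 2)) i.
Proof.
move=> cF; pose j := (i %/ 2)%Z; have [p [c [sp E]]] := cF j.
have [q sq qE] := poly_affine (1 / 2) 0 sp.
have [P [sP PE]] : exists P : {poly R}, (size P <= n.+1)%N /\
    forall t, i%:~R <= t <= i%:~R + 1 -> W (t - 2 * j%:~R - 1) = P.[t].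
  have [i2|i2] : i = 2 * j \/ i = 2 * j + 1 by rewrite /j; lia.
    have [P0 sP0 P0E] := w_poly_neg; have [P sP PE] := poly_affine 1 (- 2 * j%:~R - 1) sP0.
    exists P; split=> // t; rewrite i2 rmorphM/= => tt.
    by rewrite PE P0E; [congr (_.[_]); ring|lra].
  have [P0 sP0 P0E] := w_poly_pos; have [P sP PE] := poly_affine 1 (- 2 * j%:~R - 1) sP0.
  exists P; split=> // t; rewrite i2 rmorphD rmorphM/= => tt.
  by rewrite PE P0E; [congr (_.[_]); ring|lra].
apply: (@cell_poly _ _ (q + c *: P)).
  apply: (leq_trans (size_polyD _ _)); rewrite geq_max sq.
  by rewrite (leq_trans (size_scale_leq _ _)).
move=> t tt; rewrite hornerD hornerZ -PE// qE E.
  by congr (_.[_] + _ * W _); field.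
have [i2|i2] : i = 2 * j \/ i = 2 * j + 1 by rewrite /j; lia.
  by move: tt; rewrite i2 rmorphM/=; lra.
by move: tt; rewrite i2 rmorphD rmorphM/=; lra.
Qed.

Lemma VV_cc F : VV F -> cc F. Proof. by case. Qed.

Lemma VV0 : VV (fun=> 0).
Proof. by split; [exact: cc0|move=> i; exact: cell0]. Qed.

Lemma VVD F G : VV F -> VV G -> VV (fun t => F t + G t).
Proof. by move=> [cF eF] [cG eG]; split; [exact: ccD|move=> i; exact: cellD]. Qed.

Lemma VVZ k F : VV F -> VV (fun t => k * F t).
Proof. by move=> [cF eF]; split; [exact: ccZ|move=> i; exact: cellZ]. Qed.

Lemma VVN F : VV F -> VV (fun t => - F t).
Proof. by move=> /(VVZ (-1)); under eq_fun do rewrite mulN1r. Qed.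

Lemma VVB F G : VV F -> VV G -> VV (fun t => F t - G t).
Proof. by move=> vF /VVN; exact: VVD. Qed.

Lemma VV_sum (I : Type) (s : seq I) (F : I -> R -> R) :
  (forall k : I, VV (F k)) -> VV (fun t => \sum_(k <- s) F k t).
Proof.
move=> cF; elim: s => [|k s IH].
  by under eq_fun do rewrite big_nil; exact: VV0.
by under eq_fun do rewrite big_cons; exact: VVD.
Qed.

Lemma VV_shift F j : VV F -> VV (fun t => F (t - j%:~R)).
Proof.
by move=> [cF eF]; split; [exact: cc_shiftB|move=> i; exact: cell_shift].
Qed.

Lemma cc_half F : cc F -> cc (fun t => F (t / 2)).
Proof.
move=> /(@cc_affine _ 2^-1 0 F (ltac:(lra) : 0 < 2^-1 :> R)).
by under eq_fun do rewrite addr0 mulrC.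
Qed.

Lemma VV_half F : VV F -> VV (fun t => F (t / 2)).
Proof. by move=> [cF eF]; split; [exact: cc_half|move=> i; exact: cell_half]. Qed.

Lemma VV_phit k : (k <= n)%N -> VV (phit k).
Proof.
move=> kn; split; first exact: cc_phit.
case: k kn => [|k] kn i.
  have [->|i0] := eqVneq i 0.
    apply: (cell_inW inW_q_l) => t tt; rewrite phit0_cellP ?subr0//; lra.
  have [->|i1] := eqVneq i (-1).
    apply: (cell_inW inW_q_r) => t; rewrite mulrN1z => tt.
    by rewrite phit0_cellN//; [congr qr; ring|lra].
  apply: cell0 => t tt; apply: supp_phit0 => //.
  have [ip|im] : 1 <= i \/ i <= - 2 by lia.
    by right; move: ip; rewrite -(ler_int R); lra.
  by left; move: im; rewrite -(ler_int R); lra.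
have [->|i0] := eqVneq i 0.
  apply: (cell_inW (inW_bas (k := k.+1) kn)) => t tt; rewrite phit_cell ?subr0//; lra.
apply: cell0 => t tt; apply: supp_phit => //.
have [ip|im] : 1 <= i \/ i <= - 1 by lia.
  by right; move: ip; rewrite -(ler_int R); lra.
by left; move: im; rewrite -(ler_int R); lra.
Qed.

(** [r0_decomp] expands the polynomial part; replacing [r0] and its mirror image by [qr] and [ql]
    creates multiples of [w], which are collected in the coefficient of [bas 1]. *)
Lemma inW_expansion H : inW H -> exists d : nat -> R, forall x,
  H x = H 1 / 2 * qr x + H (-1) / 2 * ql x + \sum_(k < n) d k * bas k.+1 x.
Proof.
move=> [p [c [sp HE]]]; have [b bb pE] := @r0_decomp R n n3 p sp.
have [e eE] := isbub_span bb.
pose be := ip W (r0 n) / ip W W.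
have H1 : H 1 = p.[1] by rewrite HE w1// mulr0 addr0.
have HN1 : H (-1) = p.[-1] by rewrite HE wN1// mulr0 addr0.
exists (fun k => if k is k'.+1 then e k' else c + p.[1] / 2 * be - p.[-1] / 2 * be * (-1) ^+ n) => x.
rewrite HE (congr1 (fun f => f x) pE) H1 HN1.
rewrite -(big_mkord xpredT (fun k => (if k is k'.+1 then e k' else _) * bas k.+1 x)).
rewrite big_ltn// big_add1 big_mkord {1}/bas eqxx.
have -> : \sum_(i < n.-1) e i * bas i.+2 x = b.[x].
  rewrite eE horner_sum; apply: eq_bigr => k _.
  by rewrite hornerZ /bas /= phi0E.
have -> : r0 n x = qr x + be * W x by rewrite /q_r /be subrK.
have -> : r0 n (- x) = ql x - be * (-1) ^+ n * W x.
  by rewrite /q_l /q_r /be w_flip//; ring.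
by ring.
Qed.

(** The coefficients of [phit 0] are half the values at integers because its peak value is 2. There
    are [M + 1] nodes but [M] cells: the last index carries only a node, whence [c M k.+1 = 0]. *)
Lemma VV_expand F (a : int) (M : nat) : VV F -> supp a%:~R (a%:~R + M%:R) F ->
  exists c : nat -> nat -> R, [/\ forall i : nat, c i 0%N = F (a%:~R + i%:R) / 2,
    forall k, c M k.+1 = 0 &
    forall t, F t = \sum_(i < M.+1) \sum_(k < n.+1) c i k * phit k (t - (a + i%:Z)%:~R)].
Proof.
move=> [ccF cF] sF.
have ex_d (j : nat) : exists d : nat -> R, forall t,
   (a + j)%:~R <= t <= (a + j)%:~R + 1 ->
   F t = F (a%:~R + j.+1%:R) / 2 * qr (2 * (t - (a + j)%:~R) - 1)
       + F (a%:~R + j%:R) / 2 * ql (2 * (t - (a + j)%:~R) - 1)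
       + \sum_(k < n) d k * bas k.+1 (2 * (t - (a + j)%:~R) - 1).
  have [H [iH FH]] := cell_inW_exists (cF (a + j)); have [d dE] := inW_expansion iH.
  exists d => t tt; rewrite FH// dE; congr (_ / 2 * _ + _ / 2 * _ + _).
    by rewrite FH; [congr H; rewrite rmorphD/= -natr1; ring|rewrite rmorphD/= -natr1; lra].
  by rewrite FH; [congr H; rewrite rmorphD/=; ring|rewrite rmorphD/=; lra].
have [d dE] := choice ex_d.
pose c (i k : nat) := if k is k'.+1 then (if (i < M)%N then d i k' else 0) else F (a%:~R + i%:R) / 2.
exists c; split=> // [k|t]; first by rewrite /c ltnn.
have aiE (i : nat) : (a + i)%:~R = a%:~R + i%:R :> R by rewrite rmorphD.
have [ta|ta] := leP t a%:~R.
  rewrite sF; last by left.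
  rewrite big1// => i _; rewrite big1// => k _; rewrite aiE.
  case: (k : nat) => [|k'].
    case: (nat_of_ord i) => [|i']; first by rewrite /c addr0 sF ?mul0r//; left.
    have i'0 : 0 <= i'%:R :> R by [].
    by rewrite [X in _ * X]supp_phit0 ?mulr0//; left; rewrite -natr1; lra.
  have i'0 : 0 <= i%:R :> R by [].
  by rewrite [X in _ * X]supp_phit ?mulr0//; left; lra.
have [tM|tM] := leP (a%:~R + M%:R) t.
  rewrite sF; last by right.
  rewrite big1// => i _; rewrite big1// => k _; rewrite aiE.
  have := ltn_ord i; rewrite ltnS leq_eqVlt => /predU1P[iM|iM].
    case: (k : nat) => [|k']; first by rewrite /c iM sF ?mul0r//; right.
    by rewrite /c iM ltnn mul0r.
  move: iM; rewrite -(ler_nat R) -natr1 => iM.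
  by rewrite [X in _ * X]supp_phitW ?mulr0//; right; lra.
pose j := Num.trunc (t - a%:~R).
have /andP[j1 j2] : j%:R <= t - a%:~R < j.+1%:R by apply: truncn_itv; lra.
have jM : (j < M)%N by rewrite -(ltr_nat R); lra.
have jM1 : (j < M.+1)%N by lia.
have jM2 : (j.+1 < M.+1)%N by lia.
rewrite (bigD1 (Ordinal jM1))//= (bigD1 (Ordinal jM2))/=; last by rewrite -val_eqE/=; lia.
rewrite [X in _ + (_ + X)]big1 ?addr0 => [|i /andP[ij ij1]]; last first.
  rewrite big1// => k _; rewrite [X in _ * X]supp_phitW ?mulr0// aiE.
  move: ij ij1; rewrite -!val_eqE/= => ij ij1.
  have [ij2|ij2] : (i.+1 <= j)%N \/ (j.+2 <= i)%N by lia.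
    by move: ij2; rewrite -(ler_nat R) -natr1 => ij2; right; lra.
  move: ij2; rewrite -(ler_nat R) -[j.+2]addn2 natrD => ij2; left.
  by move: j2; rewrite -natr1; lra.
have jS : j.+1%:R = j%:R + 1 :> R by rewrite natr1.
rewrite jS in j2.
rewrite !big_ord_recl [X in _ + (_ + X)]big1 ?addr0 => [|k _]; last first.
  by rewrite [X in _ * X]supp_phit ?mulr0// aiE jS; left; lra.
rewrite (dE j) ?aiE; last by lra.
rewrite phit0_cellP//; last by lra.
rewrite phit0_cellN//= ?aiE ?jS; last by lra.
rewrite -[LHS]addrA [LHS]addrC; congr (_ + _ + _ * qr _).
- apply: eq_bigr => k _; rewrite jM (_ : bump 0 k = k.+1)// phit_cell//; lra.
- by ring.
Qed.

Lemma supp_int F : cc F -> exists M : nat, supp (- M%:R) M%:R F.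
Proof.
move=> [_ [a [b sF]]]; pose M := (Num.trunc (`|a| + `|b|)).+1; exists M.
have MM : `|a| + `|b| < M%:R.
  by have /andP[] := truncn_itv (addr_ge0 (normr_ge0 a) (normr_ge0 b)).
have := ler_norm (- a); have := ler_norm b; have := normr_ge0 a; have := normr_ge0 b.
rewrite normrN => *.
by apply: suppW sF; lra.
Qed.

Lemma VV_expand_sym F : VV F -> exists (M : nat) (c : nat -> nat -> R),
  c M 0%N = F 0 / 2 /\
  F = fun t => \sum_(i < (2 * M).+1) \sum_(k < n.+1) c i k * phit k (t - (- M%:Z + i%:Z)%:~R).
Proof.
move=> vF; have [M sF] := supp_int (VV_cc vF); exists M.
have [|c [c0 _ E]] := @VV_expand F (- M%:Z) (2 * M) vF.
  by apply: suppW sF; rewrite rmorphN/= ?natrM; lra.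
exists c; split; last exact/funext.
by rewrite c0; congr (F _ / _); rewrite rmorphN/=; ring.
Qed.

(* [phit 0] is the only generator of [V_0] that does not vanish at [0]. *)
Lemma dot_VV_phit0 F : VV F -> dot F (phit 0) = F 0 / 2 * dot (phit 0) (phit 0).
Proof.
move=> vF; have [M [c [c0 FE]]] := VV_expand_sym vF; rewrite {1}FE.
have cct (i : nat) (k : nat) : cc (fun t => c i k * phit k (t - (- M%:Z + i%:Z)%:~R)).
  by apply/ccZ/cc_shiftB/cc_phit.
rewrite dot_suml; last exact: cc_phit; last by move=> i; apply: cc_sum => k; exact: cct.
have MM : (M < (2 * M).+1)%N by lia.
have D (i k : nat) : (k <= n)%N -> (k != 0%N) || (i != M) ->
    dot (fun t => c i k * phit k (t - (- M%:Z + i%:Z)%:~R)) (phit 0) = 0.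
  move=> kn ik; rewrite dotZl; [|exact/cc_shiftB/cc_phit|exact: cc_phit].
  rewrite dotC phit_orth ?mulr0//; apply/orP.
  by case/orP: ik => ik; [left; rewrite eq_sym|right; lia].
rewrite (bigD1 (Ordinal MM))//= [X in _ + X]big1 ?addr0 => [|i iM]; last first.
  rewrite dot_suml; [|by move=> k; exact: cct|exact: cc_phit].
  rewrite big1// => k _; rewrite (D i k (ltn_ord k))//; apply/orP; right.
  by move: iM; rewrite -val_eqE.
rewrite dot_suml; [|by move=> k; exact: cct|exact: cc_phit].
rewrite big_ord_recl big1 ?addr0 => [|k _]; last by rewrite (D M k.+1 (ltn_ord k)).
rewrite dotZl; [|exact/cc_shiftB/cc_phit|exact: cc_phit].
have -> : (fun t => phit 0 (t - (- M%:Z + M%:Z)%:~R)) = phit 0.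
  by apply/funext => t; rewrite addNr subr0.
by rewrite c0.
Qed.

End MultiresolutionSpace.

(** * The first two wavelets *)

Section Psi01.
Context {R : realType} (n : nat).
Hypothesis n3 : (3 <= n)%N.
Implicit Types (f g h F G H : R -> R) (p q : {poly R}) (t x a b c : R) (i j : int).
Local Notation phit k := (@phit R n k).
Local Notation VV := (@VV R n).

Let n0 : (0 < n)%N. Proof. by lia. Qed.

Definition phid t : R := phit 0 (2 * t).

Lemma cc_double F : cc F -> cc (fun t => F (2 * t)).
Proof.
move=> /(@cc_affine _ 2 0 F (ltr0Sn _ 1)).
by under eq_fun do rewrite addr0.
Qed.

Lemma dot_double F G : cc F -> cc G ->
  dot (fun t => F (2 * t)) (fun t => G (2 * t)) = 1 / 2 * dot F G.
Proof.
move=> cF cG; have := @dot_affine _ 2 0 F G (ltr0Sn _ 1) cF cG.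
by rewrite div1r => <-; congr dot; apply/funext => t; rewrite addr0.
Qed.

Lemma double_halfK F : (fun t => F (2 * t / 2)) = F.
Proof. by apply/funext => t; congr F; field. Qed.

Lemma cc_phid : cc phid. Proof. exact/cc_double/cc_phit. Qed.

(** [F (t / 2)] lies in [V_0] as well and has the same value at 0, so the formula for [phit 0]
    rescales. *)
Lemma dot_VV_phid F : VV F -> dot F phid = F 0 / 2 * dot phid phid.
Proof.
move=> vF; have cf : cc (phit 0) by exact: cc_phit.
have vH := VV_half n3 vF; have cH := VV_cc vH.
have -> : dot F phid = 1 / 2 * dot (fun t => F (t / 2)) (phit 0).
  by rewrite -dot_double// double_halfK.
by rewrite dot_VV_phit0// /phid dot_double// mul0r; ring.
Qed.

Lemma dot_phid_phid : dot phid phid = 1 / 2 * dot (phit 0) (phit 0).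
Proof. by rewrite dot_double//; exact: cc_phit. Qed.

Lemma dot_phit0_phid : dot (phit 0) phid = dot phid phid.
Proof. by rewrite dot_VV_phid; [rewrite phit0_0//; field|exact: VV_phit]. Qed.

Lemma oproj_line f g : cc f -> cc g -> dot f f != 0 ->
  oproj setT (line f) g = fun t => dot g f / dot f f * f t.
Proof.
move=> cf cg f0; rewrite /oproj; case: xgetP => [_ _ [[c ->] H]|].
  have := H f; rewrite -/(dot _ _) dotBl//; last exact: ccZ.
  rewrite dotZl// => /(_ (ex_intro _ 1 _))E.
  apply/funext => t; congr (_ * _).
  have {}E := E (ltac:(by apply/funext => x; rewrite mul1r)).
  by apply: (mulIf f0); rewrite divfK//; move/eqP: E; rewrite subr_eq0 => /eqP.
move=> /(_ (fun t => dot g f / dot f f * f t))[]; split; first by eexists.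
move=> _ [c ->]; rewrite -/(dot _ _) dotZr//; last exact/ccB/ccZ.
by rewrite dotBl//; [rewrite dotZl// divfK// subrr mulr0|exact: ccZ].
Qed.

(** As [<phit 0, phid> = <phid, phid>], this is [phit 0] minus its projection onto [phid], the
    function from which [psi1] is cut. *)
Definition hfun t : R := phit 0 t - phid t.

(** [Num.max 0] removes the left half; the cut is continuous because [hfun 0 = 0]. *)
Definition xi t : R := hfun (Num.max 0 t).

Lemma cc_hfun : cc hfun.
Proof. by apply: ccB; [exact: cc_phit|exact: cc_phid]. Qed.

Lemma hfun0 : hfun 0 = 0.
Proof. by rewrite /hfun /phid mulr0 subrr. Qed.

Lemma hfun_opp t : hfun (- t) = hfun t.
Proof. by rewrite /hfun /phid mulrN !phit0_opp. Qed.

Lemma supp_phid : supp (- (1 / 2)) (1 / 2) phid.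
Proof. by move=> t tt; apply: supp_phit0 => //; case: tt => tt; [left|right]; lra. Qed.

Lemma supp_hfun : supp (-1) 1 hfun.
Proof.
move=> t tt; rewrite /hfun supp_phit0// supp_phid ?subrr//.
by case: tt => tt; [left|right]; lra.
Qed.

Lemma supp_xi : supp 0 1 xi.
Proof.
move=> t [tt|tt]; first by rewrite /xi max_l ?hfun0.
by rewrite /xi max_r; [apply: supp_hfun; right|lra].
Qed.

Lemma xi_pos t : 0 <= t -> xi t = hfun t.
Proof. by move=> t0; rewrite /xi max_r. Qed.

Lemma cc_xi : cc xi.
Proof.
split; last by exists 0, 1; exact: supp_xi.
apply: (continuous_compf (cc_cont cc_hfun)).
by apply: continuous_maxf; [exact: cst_continuous|move=> t; exact: cvg_id].
Qed.

Lemma hfun_split t : hfun t = xi t + xi (- t).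
Proof.
have [t0|t0] := leP 0 t.
  by rewrite xi_pos// [X in _ + X]supp_xi ?addr0//; left; lra.
by rewrite supp_xi ?add0r; [rewrite xi_pos ?hfun_opp//; lra|left; lra].
Qed.

Lemma psi0E : psi0 n = fun t => phid t - 1 / 2 * phit 0 t.
Proof.
apply/funext => t; rewrite /psi0 -/phid oproj_line; last 3 first.
- exact: cc_phit.
- exact: cc_phid.
- by rewrite gt_eqF// phit_norm_gt0.
rewrite dotC dot_phit0_phid dot_phid_phid -/(phid t).
have := @phit_norm_gt0 R n n3 0; set D := dot _ _ => D0.
by have -> : 1 / 2 * D / D = 1 / 2 by rewrite mulfK// gt_eqF.
Qed.

Lemma psi1E : psi1 n = fun t => xi t - xi (- t).
Proof.
apply/funext => t; rewrite /psi1 -/phid oproj_line; last 3 first.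
- exact: cc_phid.
- exact: cc_phit.
- by rewrite dot_phid_phid gt_eqF// mulr_gt0 ?phit_norm_gt0//; lra.
rewrite dot_phit0_phid divff ?mul1r; last first.
  by rewrite dot_phid_phid gt_eqF// mulr_gt0 ?phit_norm_gt0//; lra.
rewrite -/(hfun t) !indicE !mem_setE !in_itv/=.
have [t0|t0|->] := ltgtP t 0; last by rewrite oppr0 subrr hfun0 mulr0.
- rewrite [xi t]supp_xi; last by left; lra.
  rewrite sub0r xi_pos ?hfun_opp; last by lra.
  have [t1|t1] := leP (-1) t; first by rewrite /= sub0r mulN1r.
  have -> : hfun t = 0 by apply: supp_hfun; left; lra.
  by rewrite mulr0 subrr.
- rewrite [xi (- t)]supp_xi; last by left; lra.
  rewrite subr0 xi_pos; last by lra.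
  have [t1|t1] := leP t 1; first by rewrite /= andbF subr0 mul1r.
  have -> : hfun t = 0 by apply: supp_hfun; right; lra.
  by rewrite mulr0.
Qed.

(** If [xi] vanished, [phit 0 t = phit 0 (2 t)] for [t >= 0], that is [q_l ((x - 1) / 2) = q_l x] on
    [[-1, 1]]. As [(x - 1) / 2 <= 0], the left side is polynomial in [x]; since [w] has a nonzero
    coefficient in [q_l], it would be polynomial too. *)
Lemma xi_neq0 : exists t, xi t != 0.
Proof.
apply: contrapT => /forallNP H.
have {}H t : xi t = 0 by apply/eqP; apply: contrapT => /negP; exact: H.
have [p sp pE] := @w_poly_neg R n n3.
have [r [_ rE _ _ _]] := @r0P R n n0.
pose be := inner `[(-1), 1] (w n) (r0 n) / inner `[(-1), 1] (w n) (w n) : R.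
have be0 : be != 0.
  by rewrite mulf_neq0 ?w_r0_neq0// invr_neq0// gt_eqF// w_norm_gt0.
have qlE x : q_l n x = (pflip r).[x] + be * (-1) ^+ n * w n x.
  by rewrite /q_l /q_r -/be w_flip// rE horner_pflip; ring.
pose aff : {poly R} := (1 / 2) *: 'X - (1 / 2)%:P.
have affE x : aff.[x] = (x - 1) / 2 by rewrite /aff !hornerE; field.
pose P : {poly R} := (be * (-1) ^+ n)^-1 *:
   ((pflip r + (be * (-1) ^+ n) *: p) \Po aff - pflip r).
have c0 : be * (-1) ^+ n != 0 by rewrite mulf_neq0 ?signr_eq0.
apply: (@w_not_poly R n n3 P) => x x1.
have := H ((x + 1) / 4); rewrite xi_pos; last by lra.
rewrite /hfun /phid !phit0_cellP//; try lra.
have -> : 2 * ((x + 1) / 4) - 1 = (x - 1) / 2 by field.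
have -> : 2 * (2 * ((x + 1) / 4)) - 1 = x by field.
rewrite !qlE [w n ((x - 1) / 2)]pE; last by lra.
rewrite /P hornerZ hornerD hornerN [(_ \Po aff).[x]]horner_comp affE hornerD hornerZ => E.
apply: (mulfI c0); rewrite mulrA divff// mul1r; lra.
Qed.

Definition xi' t : R := xi (1 - t).

Lemma cc_reflect c F : cc F -> cc (fun t => F (c - t)).
Proof.
move=> /(@cc_shift _ c)/cc_opp.
by under eq_fun do rewrite addrC.
Qed.

Lemma cc_xi' : cc xi'. Proof. exact/cc_reflect/cc_xi. Qed.

Lemma supp_xi' : supp 0 1 xi'.
Proof. by move=> t tt; apply: supp_xi; case: tt => tt; [right|left]; lra. Qed.

Lemma VV_phid_half : VV (fun t => phid (t / 2)).
Proof.
have -> : (fun t => phid (t / 2)) = phit 0 by apply/funext => t; rewrite /phid; congr (phit 0 _); field.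
exact: VV_phit.
Qed.

Lemma VV_hfun_half : VV (fun t => hfun (t / 2)).
Proof. by apply: VVB; [exact/VV_half/VV_phit|exact: VV_phid_half]. Qed.

Lemma int_cases i : 0 <= i \/ i <= - 1. Proof. by lia. Qed.

(** The cut is at an integer, so each cell of [hfun (t / 2)] is kept whole or replaced by 0. *)
Lemma VV_xi_half : VV (fun t => xi (t / 2)).
Proof.
split; first exact/cc_half/cc_xi.
move=> i; have [_ ch] := VV_hfun_half; have [i0|i0] := int_cases i.
  apply: (cell_ext _ (ch i)) => t tt; rewrite xi_pos//.
  by move: i0; rewrite -(ler_int R); lra.
apply: cell0 => t tt; rewrite supp_xi//; left.
by move: i0; rewrite -(ler_int R); lra.
Qed.

Lemma VV_xiN_half : VV (fun t => xi (- (t / 2))).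
Proof.
have -> : (fun t => xi (- (t / 2))) = (fun t => hfun (t / 2) - xi (t / 2)).
  by apply/funext => t; rewrite hfun_split; ring.
by apply: VVB; [exact: VV_hfun_half|exact: VV_xi_half].
Qed.

Lemma VV_xi'_half : VV (fun t => xi' (t / 2)).
Proof.
have := VV_shift n3 2 VV_xiN_half.
congr (VV _); apply/funext => t; rewrite /xi'; congr xi.
by field.
Qed.

Lemma VV_psi0_half : VV (fun t => psi0 n (t / 2)).
Proof.
rewrite psi0E; apply: VVB; first exact: VV_phid_half.
exact/VVZ/VV_half/VV_phit.
Qed.

Lemma VV_psi1_half : VV (fun t => psi1 n (t / 2)).
Proof. by rewrite psi1E; apply: VVB; [exact: VV_xi_half|exact: VV_xiN_half]. Qed.

Lemma hfun_VV F : VV F -> F 0 = 0 -> dot (phit 0) F = 0 -> dot hfun F = 0.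
Proof.
move=> vF F0 fF; rewrite dotBl; [|exact: cc_phit|exact: cc_phid|exact: (VV_cc vF)].
by rewrite fF dotC dot_VV_phid// F0 mul0r mul0r subrr.
Qed.

Lemma supp_xiN : supp (-1) 0 (fun t => xi (- t)).
Proof. by have := supp_opp supp_xi; rewrite oppr0. Qed.

(** The other half of [hfun] lives to the left of 0. This is how orthogonality of [hfun] to
    functions of [V_0] passes to [xi]. *)
Lemma dot_xi F : cc F -> supp 0 2 F -> dot xi F = dot hfun F.
Proof.
move=> cF sF; have -> : hfun = fun t => xi t + xi (- t) by apply/funext => t; exact: hfun_split.
rewrite dotDl//; [|exact: cc_xi|exact/cc_opp/cc_xi].
by rewrite [X in _ + X]dot_disj ?addr0//; exact: (supp_disj supp_xiN sF).
Qed.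

Lemma dot_xi_phit k : (0 < k <= n)%N -> dot xi (phit k) = 0.
Proof.
move=> /andP[k0 kn]; rewrite dot_xi; [|exact: cc_phit|].
  apply: hfun_VV; [exact: VV_phit|exact: phit_0|].
  have := @phit_orth R n n3 0 k 0 isT kn; rewrite eq_sym -lt0n k0 => /(_ isT) <-.
  by congr dot; apply/funext => t; rewrite subr0.
by apply: suppW (supp_phit n3 k0) => //; lra.
Qed.

Lemma dot_phit0_shift1 : dot (phit 0) (fun t => phit 0 (t - 1)) = 0.
Proof. exact: (@phit_orth R n n3 0 0 1). Qed.

Lemma VV_phit0_shift1 : VV (fun t => phit 0 (t - 1)).
Proof. exact: (VV_shift n3 1 (VV_phit n3 (leq0n n))). Qed.

Lemma dot_phid_shift F : VV F -> F 1 = 0 -> dot F (fun t => phid (t - 1)) = 0.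
Proof.
move=> vF F1; rewrite -(dot_shift 1); [|exact: (VV_cc vF)|exact/cc_shiftB/cc_phid].
have -> : (fun t => phid (t + 1 - 1)) = phid by apply/funext => t; rewrite addrK.
rewrite dot_VV_phid; first by rewrite add0r F1 mul0r mul0r.
by have := VV_shift n3 (-1) vF; under eq_fun do rewrite mulrN1z opprK.
Qed.

Lemma dot_hfun_shift1 : dot hfun (fun t => hfun (t - 1)) = 0.
Proof.
have cf : cc (phit 0) by [exact: cc_phit]; have cg := cc_phid.
have cf1 := cc_shiftB 1 cf; have cg1 := cc_shiftB 1 cg.
rewrite dotBl//; last exact: ccB.
rewrite !dotBr// dot_phit0_shift1.
rewrite dot_phid_shift; [|exact: VV_phit|by apply: supp_phit0 => //; right].
rewrite dotC dot_VV_phid; last exact: VV_phit0_shift1.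
rewrite [phit 0 (0 - 1)]supp_phit0//; last by left; lra.
have sg1 := supp_shift (c := 1) supp_phid.
have -> : dot phid (fun t => phid (t - 1)) = 0.
  by apply: dot_disj; apply: (supp_disj supp_phid sg1); lra.
by rewrite !(mul0r, subr0).
Qed.

(** On [[0, 1]], [xi'] is the left half of [hfun (t - 1)], so the inner product is that of [hfun]
    with its own translate. *)
Lemma dot_xi_xi' : dot xi xi' = 0.
Proof.
rewrite dot_xi; [|exact: cc_xi'|by apply: suppW supp_xi' => //; lra].
rewrite -[RHS]dot_hfun_shift1 dotC [RHS]dotC.
have -> : (fun t => hfun (t - 1)) = (fun t => xi' t + xi (t - 1)).
  by apply/funext => t; rewrite hfun_split /xi' opprB addrC.
rewrite [RHS]dotDl; [|exact: cc_xi'|exact/cc_shiftB/cc_xi|exact: cc_hfun].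
rewrite [X in _ = _ + X]dot_disj ?addr0// => t; rewrite mulrC.
have s1 := supp_shift (c := 1) supp_xi.
by apply: (supp_disj supp_hfun s1); lra.
Qed.

End Psi01.

(** * Finite orthogonal systems and the algorithm *)

Section OrthogonalSystems.
Context {R : realFieldType} (d : nat).
Implicit Types (u v p q : 'cV[R]_d) (L : seq 'cV[R]_d).

Definition cdot u v : R := (u^T *m v) 0 0.

Lemma cdotE u v : cdot u v = \sum_s u s 0 * v s 0.
Proof. by rewrite /cdot mxE; apply: eq_bigr => s _; rewrite mxE. Qed.

Lemma cdotC u v : cdot u v = cdot v u.
Proof. by rewrite !cdotE; apply: eq_bigr => s _; rewrite mulrC. Qed.

Lemma cdot_eq0 u v : (u^T *m v = 0) <-> cdot u v = 0.
Proof.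
split=> [E|E]; first by rewrite /cdot E mxE.
by apply/matrixP => i j; rewrite !ord1 [RHS]mxE.
Qed.

Lemma cdotDr u v p : cdot u (v + p) = cdot u v + cdot u p.
Proof. by rewrite /cdot mulmxDr mxE. Qed.

Lemma cdotZr c u v : cdot u (c *: v) = c * cdot u v.
Proof. by rewrite /cdot -scalemxAr mxE. Qed.

Lemma cdotZl c u v : cdot (c *: u) v = c * cdot u v.
Proof. by rewrite cdotC cdotZr cdotC. Qed.

Lemma cdot_ge0 u : 0 <= cdot u u.
Proof. by rewrite cdotE sumr_ge0// => s _; rewrite -expr2 sqr_ge0. Qed.

Lemma cdot0 u : cdot u u = 0 -> u = 0.
Proof.
rewrite cdotE => /psumr_eq0P => H; apply/colP => s; rewrite mxE.
by apply/eqP; rewrite -sqrf_eq0 expr2 H// => i _; rewrite -expr2 sqr_ge0.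
Qed.

Definition stack L : 'M[R]_(size L, d) := \matrix_(i, s) nth 0 L i s 0.

Lemma stack_mul L p i : (stack L *m p) i 0 = cdot (nth 0 L i) p.
Proof. by rewrite cdotE mxE; apply: eq_bigr => s _; rewrite mxE. Qed.

Definition orthseq L := pairwise (fun u v => cdot u v == 0) L.

(** Stated by orthogonality, the form in which the stopping condition of the algorithm is used;
    [complete_span] turns it into spanning. *)
Definition complete L := forall p, (forall v, v \in L -> cdot v p = 0) -> p = 0.

Lemma complete_full L : complete L -> row_full (stack L).
Proof.
move=> cL; rewrite /row_full -mxrank_tr -/(row_free _) -kermx_eq0.
apply/eqP/row_matrixP => i; rewrite row0; apply: trmx_inj; rewrite trmx0.
apply: cL => v /(nthP 0)[j jL <-].
rewrite -(@stack_mul L _ (Ordinal jL)).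
have : row i (kermx (stack L)^T) *m (stack L)^T = 0.
  by rewrite -row_mul mulmx_ker row0.
move=> /(congr1 trmx); rewrite trmx_mul trmxK trmx0 => ->.
by rewrite mxE.
Qed.

Lemma complete_span L p : complete L ->
  exists c : nat -> R, p = \sum_(i < size L) c i *: nth 0 L i.
Proof.
move=> /complete_full/(submx_full p^T)/submxP[u uE].
exists (fun i => if insub i is Some j then u 0 j else 0).
apply: trmx_inj; rewrite uE raddf_sum/=; apply/rowP => s.
rewrite mxE summxE; apply: eq_bigr => i _.
by rewrite insubT// => lt; rewrite !mxE; congr (u _ _ * _); exact: val_inj.
Qed.

(** Completeness makes the rows of [stack L] span, orthogonality makes them independent: the rank is
    both [d] and [size L]. *)
Lemma orth_complete_size L : orthseq L -> complete L ->
  (forall v, v \in L -> v != 0) -> size L = d.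
Proof.
move=> oL cL nL; have := complete_full cL; rewrite /row_full => /eqP rk.
rewrite -[RHS]rk.
apply/esym/eqP; rewrite -/(row_free _) -kermx_eq0.
apply/eqP/row_matrixP => i; rewrite row0.
set u := row i _; have uL : u *m stack L = 0 by rewrite -row_mul mulmx_ker row0.
apply/rowP => j; rewrite [RHS]mxE.
have : (stack L *m (u *m stack L)^T) j 0 = 0 by rewrite uL trmx0 mulmx0 mxE.
rewrite trmx_mul mulmxA mxE (bigD1 j)//= big1 ?addr0 => [|k kj].
  rewrite [u^T _ _]mxE => /eqP; rewrite mulf_eq0 => /orP[|/eqP//].
  have -> : (stack L *m (stack L)^T) j j = cdot (nth 0 L j) (nth 0 L j).
    by rewrite cdotE mxE; apply: eq_bigr => s _; rewrite !mxE.
  by move=> /eqP/cdot0/eqP; rewrite (negbTE (nL _ (mem_nth _ (ltn_ord j)))).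
have -> : (stack L *m (stack L)^T) j k = cdot (nth 0 L j) (nth 0 L k).
  by rewrite cdotE mxE; apply: eq_bigr => s _; rewrite !mxE.
suff -> : cdot (nth 0 L j) (nth 0 L k) = 0 by rewrite mul0r.
move/(pairwiseP 0) : oL => oL; have {}kj : k != j :> nat by [].
move: kj; rewrite neq_ltn => /orP[kj|jk]; apply/eqP.
  by rewrite cdotC; apply: oL => //; exact: ltn_ord.
by apply: oL => //; exact: ltn_ord.
Qed.

End OrthogonalSystems.

(** * What a run of the algorithm delivers *)

Section Runs.
Context {R : realType} (n m : nat).
Variables (form : 'cV[R]_m -> 'cV[R]_(n.+1 + n.+1)).
Variable (A : 'M[R]_(n.+1, n.+1 + n.+1)).
Hypothesis form0 : forall b, form b = 0 -> b = 0.

(** These facts hold for every choice of free variables: a selected solution has a coordinate equal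
    to 1, so it is nonzero; the earlier vectors are among its constraints; and stopping means that
    nothing perpendicular is left. *)
Lemma runP vs : algorithm_run form A vs -> [/\
  forall v, v \in vs -> exists c b, v = c *: form b /\ A *m form b = 0,
  forall v, v \in vs -> cdot v v = 1,
  orthseq vs &
  forall b, A *m form b = 0 -> (forall v, v \in vs -> cdot v (form b) = 0) -> b = 0].
Proof.
move=> [sel sol].
have selP k : (k < size vs)%N -> exists b, [/\ b != 0, A *m form b = 0,
    nth 0 vs k = normalize (form b) &
    forall j, (j < k)%N -> cdot (nth 0 vs j) (form b) = 0].
  move=> kv; have [F [i [b [_ iF [Ab ob] bF vE]]]] := sel k kv.
  exists b; split => //.
    apply/eqP => b0; have := bF i iF; rewrite b0 mxE eqxx.
    by move/eqP; rewrite eq_sym oner_eq0.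
  move=> j jk; apply/cdot_eq0; apply: ob.
  by rewrite -(nth_take 0 jk); apply: mem_nth; rewrite size_take kv.
split.
- move=> v /(nthP 0)[k kv <-]; have [b [_ Ab -> _]] := selP k kv.
  by exists (Num.sqrt (((form b)^T *m form b) 0 0))^-1, b.
- move=> v /(nthP 0)[k kv <-]; have [b [b0 Ab -> _]] := selP k kv.
  rewrite /normalize -/(cdot _ _) cdotZl cdotZr.
  have c0 : 0 < cdot (form b) (form b).
    rewrite lt_neqAle cdot_ge0 andbT eq_sym; apply/eqP => /cdot0/form0/eqP.
    by rewrite (negbTE b0).
  have s0 : Num.sqrt (cdot (form b) (form b)) != 0 by rewrite gt_eqF// sqrtr_gt0.
  rewrite -[X in _ * (_ * X)](sqr_sqrtr (ltW c0)) expr2.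
  by rewrite mulKf// mulVf.
- apply/(pairwiseP 0) => i j; rewrite !inE => iv jv ij.
  have [b [b0 Ab -> ob]] := selP j jv.
  by rewrite /normalize cdotZr ob ?mulr0.
- move=> b Ab vb; have : [set 0] b; last by [].
  by rewrite -sol; split=> // v vv; apply/cdot_eq0; exact: vb.
Qed.

End Runs.

(** * Coordinates in V_1 *)

Section Coordinates.
Context {R : realType} (n : nat).
Hypothesis n3 : (3 <= n)%N.
Implicit Types (f g h F G H : R -> R) (t x a b c : R) (i j : int).
Local Notation phit k := (@phit R n k).
Local Notation Phi := (@Phi R n).
Local Notation VV := (@VV R n).
Local Notation vec := 'cV[R]_(n.+1 + n.+1).
Implicit Types (p q v : vec).

Definition nu k : R := Num.sqrt (dot (phit k) (phit k)).

Lemma nu_gt0 k : 0 < nu k. Proof. by rewrite sqrtr_gt0 phit_norm_gt0. Qed.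

Lemma PhiE (k : 'I_n.+1) : Phi k = fun t => (nu k)^-1 * phit k t.
Proof. by []. Qed.

Lemma cc_Phi k : cc (Phi k). Proof. by apply: ccZ; exact: cc_phit. Qed.

Lemma VV_Phi k : VV (Phi k). Proof. by apply: VVZ; exact: (VV_phit n3 (ltn_ord k)). Qed.

Lemma dot_Phi (k l : 'I_n.+1) i :
  dot (Phi k) (fun t => Phi l (t - i%:~R)) = ((k == l) && (i == 0))%:R.
Proof.
rewrite PhiE PhiE dotZl; [|exact: cc_phit|exact/ccZ/cc_shiftB/cc_phit].
rewrite dotZr; [|exact/cc_shiftB/cc_phit|exact: cc_phit].
have [/andP[/eqP <- /eqP ->]|kl] := boolP (_ && _).
  have -> : (fun t => phit k (t - 0%:~R)) = phit k by apply/funext => t; rewrite subr0.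
  have nk := gt_eqF (nu_gt0 k).
  by rewrite -[dot _ _]sqr_sqrtr ?dot_ge0// -/(nu k) expr2 mulKf ?nk// mulVf ?nk.
have kl' : (k != l :> nat) || (i != 0) by rewrite val_eqE -negb_and.
by rewrite (@phit_orth R n n3 k l i (ltn_ord k) (ltn_ord l) kl') !mulr0.
Qed.

(** The functions whose coefficients the vectors hold: [Phi (2 t)] for the first block,
    [Phi (2 t - 1)] for the second. *)
Definition lvl (s : 'I_(n.+1 + n.+1)) t : R :=
  match fintype.split s with inl k => Phi k (2 * t) | inr k => Phi k (2 * t - 1) end.

Lemma lvl_l k : lvl (lshift n.+1 k) = fun t => Phi k (2 * t).
Proof. by apply/funext => t; rewrite /lvl (unsplitK (inl k)). Qed.

Lemma lvl_r k : lvl (rshift n.+1 k) = fun t => Phi k (2 * t - 1).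
Proof. by apply/funext => t; rewrite /lvl (unsplitK (inr k)). Qed.

Lemma cc_lvl s : cc (lvl s).
Proof.
rewrite -[s]fintype.splitK; case: (fintype.split _) => k; rewrite ?lvl_l ?lvl_r.
  exact/cc_double/cc_Phi.
exact: (@cc_affine _ 2 (-1) _ (ltr0Sn _ 1) (cc_Phi k)).
Qed.

Lemma dot_lvl_lr k l : dot (fun t => Phi k (2 * t)) (fun t => Phi l (2 * t - 1)) = 0.
Proof.
rewrite (@dot_double _ (Phi k) (fun t => Phi l (t - 1)))//; [|exact: cc_Phi|exact/cc_shiftB/cc_Phi].
by have -> := dot_Phi k l 1; rewrite andbF mulr0.
Qed.

Lemma dot_lvl s s' : dot (lvl s) (lvl s') = 1 / 2 * (s == s')%:R.
Proof.
have P0 k l : dot (Phi k) (Phi l) = (k == l)%:R.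
  have := dot_Phi k l 0; rewrite eqxx andbT => <-.
  by congr dot; apply/funext => t; rewrite subr0.
rewrite -[s]fintype.splitK -[s']fintype.splitK; case: (fintype.split s) => k; case: (fintype.split s') => l /=.
- by rewrite eq_lshift !lvl_l dot_double ?P0//; exact: cc_Phi.
- by rewrite eq_lrshift lvl_l lvl_r dot_lvl_lr mulr0.
- by rewrite eq_rlshift lvl_l lvl_r dotC dot_lvl_lr mulr0.
- rewrite eq_rshift !lvl_r -P0.
  by rewrite (@dot_affine _ 2 (-1)) ?div1r//; exact: cc_Phi.
Qed.

Lemma combE p : combination Phi p = fun t => \sum_s p s 0 * lvl s t.
Proof.
apply/funext => t; rewrite /combination mxE; apply: eq_bigr => s _.
by rewrite [p^T _ _]mxE mxE /lvl; case: (fintype.split _) => k; rewrite mxE.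
Qed.

Local Notation comb := (combination Phi).

Lemma comb_split p t : comb p t = \sum_k p (lshift n.+1 k) 0 * Phi k (2 * t)
   + \sum_k p (rshift n.+1 k) 0 * Phi k (2 * t - 1).
Proof.
rewrite combE big_split_ord; congr (_ + _); apply: eq_bigr => k _.
  by rewrite lvl_l.
by rewrite lvl_r.
Qed.

Lemma combD p q : comb (p + q) = fun t => comb p t + comb q t.
Proof.
apply/funext => t; rewrite !combE -big_split; apply: eq_bigr => s _.
by rewrite mxE mulrDl.
Qed.

Lemma combZ c p : comb (c *: p) = fun t => c * comb p t.
Proof.
apply/funext => t; rewrite !combE mulr_sumr; apply: eq_bigr => s _.
by rewrite mxE mulrA.
Qed.

Lemma comb0 : comb 0 = fun=> 0.
Proof. by apply/funext => t; rewrite combE big1// => s _; rewrite mxE mul0r. Qed.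

Lemma comb_sum (r : nat) (c : nat -> R) (v : nat -> vec) :
  comb (\sum_(k < r) c k *: v k) = fun t => \sum_(k < r) c k * comb (v k) t.
Proof.
apply/funext => t; elim: r => [|r IH]; first by rewrite !big_ord0 comb0.
by rewrite !big_ord_recr/= combD IH combZ.
Qed.

Lemma cc_comb p : cc (comb p).
Proof. by rewrite combE; apply: cc_sum => s; exact/ccZ/cc_lvl. Qed.

(** Rests on the normalization of [Phi]: the functions [lvl] have Gram matrix [1/2], so
    perpendicular vectors give orthogonal functions. *)
Lemma dot_comb p q : dot (comb p) (comb q) = 1 / 2 * cdot p q.
Proof.
have cs (c : R) s : cc (fun t => c * lvl s t) by exact/ccZ/cc_lvl.
rewrite [comb p]combE dot_suml//; last exact: cc_comb.
rewrite cdotE mulr_sumr; apply: eq_bigr => s _.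
rewrite dotZl; [|exact: cc_lvl|exact: cc_comb].
rewrite combE dot_sumr//; last exact: cc_lvl.
rewrite (bigD1 s)//= big1 => [|s' ss]; rewrite dotZr; try exact: cc_lvl.
  by rewrite dot_lvl eqxx addr0 /= mulr1; ring.
by rewrite dot_lvl eq_sym (negbTE ss) !mulr0.
Qed.

(** The factor 2 inverts the Gram matrix [1/2] in [Cmx]. Null vectors of [Emx] are thus the
    combinations orthogonal to the untranslated scaling functions. *)
Lemma Emx_comb p (k : 'I_n.+1) : (Emx Phi *m p) k 0 = 2 * dot (Phi k) (comb p).
Proof.
have G2 : Gram2 Phi = (1 / 2)%:M.
  apply/matrixP => k' l; rewrite !mxE -/(dot _ _) -lvl_l -lvl_l dot_lvl eq_lshift.
  by rewrite mulr_natr.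
have CE j' (k' l : 'I_n.+1) : Cmx Phi j' k' l = 2 * Ctilde Phi j' k' l.
  by rewrite /Cmx G2 invmx_scalar mul_mx_scalar mxE invf_div divr1.
rewrite mxE combE dot_sumr; [|by move=> s; exact/ccZ/cc_lvl|exact: cc_Phi].
rewrite mulr_sumr; apply: eq_bigr => s _.
rewrite dotZr; [|exact: cc_lvl|exact: cc_Phi].
rewrite mulrCA -[RHS]mulrC; congr (_ * _).
rewrite -[s]fintype.splitK; case: (fintype.split _) => l /=.
  rewrite row_mxEl CE mxE -/(dot _ _) lvl_l; congr (_ * dot _ _).
  by apply/funext => t; rewrite subr0.
by rewrite row_mxEr CE mxE -/(dot _ _) lvl_r.
Qed.

Lemma Emx_comb0 p : Emx Phi *m p = 0 <-> forall k, dot (Phi k) (comb p) = 0.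
Proof.
split=> [E k|H].
  have := Emx_comb p k; rewrite E mxE => /esym/eqP.
  by rewrite mulf_eq0 pnatr_eq0 => /eqP.
by apply/colP => k; rewrite Emx_comb H mulr0 mxE.
Qed.

(** The positions of [phit 0 (2 t)] and [phit 0 (2 t - 1)]; the former is the only function of the
    two blocks that leaves [[0, 1]]. *)
Let l0 : 'I_(n.+1 + n.+1) := lshift n.+1 ord0.
Let r0 : 'I_(n.+1 + n.+1) := rshift n.+1 ord0.

Lemma supp_comb p : p l0 0 = 0 -> supp 0 1 (comb p).
Proof.
move=> p0 t tt; rewrite comb_split big1 ?big1 ?addr0// => k _.
  rewrite PhiE [X in _ * (_ * X)]supp_phitW ?mulr0//.
  by case: tt => tt; [left|right]; lra.
have [->|k0] := eqVneq k ord0; first by rewrite p0 mul0r.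
rewrite PhiE [X in _ * (_ * X)]supp_phit ?mulr0//; first by rewrite lt0n -(inj_eq val_inj) in k0 *.
by case: tt => tt; [left|right]; lra.
Qed.

(** [F (t / 2)] fills the two cells of [[0, 2]]. The outer two of its three nodes carry
    [F 0 = F 1 = 0], so no function beyond the two blocks is involved. *)
Lemma comb_exists F : VV (fun t => F (t / 2)) -> supp 0 1 F ->
  exists2 p : vec, p l0 0 = 0 & comb p = F.
Proof.
move=> vF sF.
have [|c [c0 cM cE]] := @VV_expand R n n3 (fun t => F (t / 2)) 0 2 vF.
  move=> t tt; apply: sF; rewrite add0r in tt.
  by case: tt => tt; [left|right]; lra.
exists (\col_s match fintype.split s with inl k => c 0%N k * nu k | inr k => c 1%N k * nu k end).
  by rewrite mxE (unsplitK (inl ord0)) c0 add0r mul0r sF ?mul0r//; left.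
apply/funext => t; have := cE (2 * t); have -> : 2 * t / 2 = t by field.
move=> ->; rewrite comb_split.
pose G (i : nat) := \sum_(k < n.+1) c i k * phit k (2 * t - (0 + i%:Z)%:~R).
transitivity (\sum_(i < 3) G i); last by [].
have -> : \sum_(i < 3) G i = G 0%N + G 1%N + G 2%N by rewrite !big_ord_recr big_ord0 /= add0r.
rewrite /G.
have nk k := gt_eqF (nu_gt0 k).
rewrite [X in _ = _ + X]big1 ?addr0 => [|k _]; last first.
  case: k => -[|k] kn; last by rewrite cM mul0r.
  by rewrite c0 /= sF ?mul0r//; right; rewrite add0r; lra.
congr (_ + _).
  apply: eq_bigr => k _; rewrite mxE (unsplitK (inl k)) PhiE mulrA mulfK ?nk//.
  by congr (_ * phit _ _); rewrite subr0.
apply: eq_bigr => k _; rewrite mxE (unsplitK (inr k)) PhiE mulrA mulfK ?nk//.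
Qed.

Lemma Phi_reflect (k : 'I_n.+1) t : k != ord0 -> Phi k (1 - t) = @bas_sign R n k * Phi k t.
Proof.
by move=> k0; rewrite PhiE phit_reflect ?lt0n//; ring.
Qed.

Lemma bas_sign2 k : @bas_sign R n k * @bas_sign R n k = 1.
Proof. by rewrite /bas_sign -expr2; case: eqP => _; rewrite ?sqrrN sqrr_sign. Qed.

(** Coordinates of the reflection in 1/2. It exchanges the blocks up to sign, except that
    [phit 0 (2 t - 1)] is its own mirror image; the mirror image of [phit 0 (2 t)] lies outside both
    blocks, and its entry is set to 0. *)
Definition refl p : vec := \col_s match fintype.split s with
  | inl k => if k == ord0 then 0 else @bas_sign R n k * p (rshift n.+1 k) 0
  | inr k => if k == ord0 then p r0 0 else @bas_sign R n k * p (lshift n.+1 k) 0 end.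

Lemma refl_l p k : refl p (lshift n.+1 k) 0 =
  if k == ord0 then 0 else @bas_sign R n k * p (rshift n.+1 k) 0.
Proof. by rewrite mxE (unsplitK (inl k)). Qed.

Lemma refl_r p k : refl p (rshift n.+1 k) 0 =
  if k == ord0 then p r0 0 else @bas_sign R n k * p (lshift n.+1 k) 0.
Proof. by rewrite mxE (unsplitK (inr k)). Qed.

Lemma comb_refl p t : p l0 0 = 0 -> comb (refl p) t = comb p (1 - t).
Proof.
move=> p0; rewrite !comb_split !big_ord_recl refl_l refl_r eqxx p0 !mul0r !add0r.
rewrite -/r0 [RHS]addrCA [LHS]addrCA; congr (_ + _).
  rewrite PhiE; congr (_ * (_ * _)); rewrite -phit0_opp//; congr (phit 0 _); ring.
rewrite [RHS]addrC; congr (_ + _); apply: eq_bigr => k _.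
  rewrite refl_l /=; have -> : 2 * (1 - t) - 1 = 1 - 2 * t by ring.
  by rewrite Phi_reflect//; ring.
rewrite refl_r /=; have -> : 2 * (1 - t) = 1 - (2 * t - 1) by ring.
by rewrite Phi_reflect//; ring.
Qed.

End Coordinates.

(** * The wavelets of the algorithm *)

Section Wavelets.
Context {R : realType} (n : nat).
Hypothesis n3 : (3 <= n)%N.
Implicit Types (f g h F G H : R -> R) (t x a b c : R) (i j : int).
Local Notation phit k := (@phit R n k).
Local Notation Phi := (@Phi R n).
Local Notation VV := (@VV R n).
Local Notation vec := 'cV[R]_(n.+1 + n.+1).
Local Notation comb := (combination Phi).
Local Notation xi := (@xi R n).
Local Notation xi' := (@xi' R n).
Implicit Types (p q v : vec).
Let l0 : 'I_(n.+1 + n.+1) := lshift n.+1 ord0.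
Let r0 : 'I_(n.+1 + n.+1) := rshift n.+1 ord0.

Lemma sym_l (b : 'cV[R]_n.+1) k : sym_form b (lshift n.+1 k) 0 = if k == ord0 then 0 else b k 0.
Proof. by rewrite /sym_form col_mxEu mxE. Qed.

Lemma sym_r (b : 'cV[R]_n.+1) k : sym_form b (rshift n.+1 k) 0 =
  if k == ord0 then b k 0 else bas_sign n k * b k 0.
Proof.
rewrite /sym_form col_mxEd mxE -[k == ord0]val_eqE /bas_sign; case: ifP => // k0.
by case: ifP => // _; rewrite exprS mulN1r.
Qed.

Lemma anti_l (b : 'cV[R]_n) k : antisym_form b (lshift n.+1 k) 0 =
  if unlift ord0 k is Some i then b i 0 else 0.
Proof. by rewrite /antisym_form col_mxEu mxE. Qed.

Lemma anti_r (b : 'cV[R]_n) k : antisym_form b (rshift n.+1 k) 0 =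
  - (bas_sign n k * (if unlift ord0 k is Some i then b i 0 else 0)).
Proof.
rewrite /antisym_form col_mxEd mxE /bas_sign.
case: unliftP => [i ->|->]; last by rewrite eqxx mulr0 oppr0.
by rewrite /=; case: ifP => // _; rewrite mulNr opprK.
Qed.

Lemma vec_eq p q : (forall k, p (lshift n.+1 k) 0 = q (lshift n.+1 k) 0) ->
  (forall k, p (rshift n.+1 k) 0 = q (rshift n.+1 k) 0) -> p = q.
Proof.
by move=> El Er; apply/colP => s; rewrite -[s]fintype.splitK; case: (fintype.split s) => k /=.
Qed.

Lemma sym_form0 (b : 'cV[R]_n.+1) : sym_form b = 0 -> b = 0.
Proof.
move=> H; apply/colP => k; rewrite mxE; have [->|k0] := eqVneq k ord0.
  by have := sym_r b ord0; rewrite H mxE eqxx => <-.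
by have := sym_l b k; rewrite H mxE (negbTE k0) => <-.
Qed.

Lemma antisym_form0 (b : 'cV[R]_n) : antisym_form b = 0 -> b = 0.
Proof.
move=> H; apply/colP => k; rewrite mxE.
by have := anti_l b (lift ord0 k); rewrite H mxE liftK => <-.
Qed.

Lemma sym_form_of0 : sym_form (0 : 'cV[R]_n.+1) = 0.
Proof.
apply: vec_eq => k; rewrite ?sym_l ?sym_r !mxE; case: ifP => // _.
by rewrite mulr0.
Qed.

Lemma antisym_form_of0 : antisym_form (0 : 'cV[R]_n) = 0.
Proof.
apply: vec_eq => k; rewrite ?anti_l ?anti_r [RHS]mxE; case: unliftP => [i _|_]; rewrite ?mxE//.
  by rewrite mulr0 oppr0.
by rewrite mulr0 oppr0.
Qed.

Lemma reflZ c p : refl (c *: p) = c *: refl p.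
Proof.
apply: vec_eq => k; rewrite ?refl_l ?refl_r [RHS]mxE ?refl_l ?refl_r; case: ifP => _;
  rewrite ?mxE ?mulr0//; ring.
Qed.

Lemma refl_sym (b : 'cV[R]_n.+1) : refl (sym_form b) = sym_form b.
Proof.
apply: vec_eq => k; rewrite ?refl_l ?refl_r !(sym_l, sym_r).
  by case: (eqVneq k ord0) => // _; rewrite mulrA bas_sign2 mul1r.
by case: (eqVneq k ord0) => // ->; rewrite eqxx.
Qed.

Lemma refl_anti (b : 'cV[R]_n) : refl (antisym_form b) = - antisym_form b.
Proof.
apply: vec_eq => k; rewrite ?refl_l ?refl_r [RHS]mxE !(anti_l, anti_r).
  case: (eqVneq k ord0) => [->|_]; first by rewrite unlift_none oppr0.
  by rewrite mulrN mulrA bas_sign2 mul1r.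
by case: (eqVneq k ord0) => [->|_]; rewrite ?unlift_none ?mulr0 opprK ?oppr0.
Qed.

Lemma sym_of p : p l0 0 = 0 -> exists b : 'cV[R]_n.+1, p + refl p = sym_form b.
Proof.
move=> p0; have aE s : (p + refl p) s 0 = p s 0 + refl p s 0 by rewrite mxE.
pose b : 'cV[R]_n.+1 := \col_k if k == ord0 then (p + refl p) (rshift n.+1 k) 0
  else (p + refl p) (lshift n.+1 k) 0.
have bE k : b k 0 = if k == ord0 then (p + refl p) (rshift n.+1 k) 0
  else (p + refl p) (lshift n.+1 k) 0 by rewrite mxE.
exists b; apply: vec_eq => k; rewrite ?sym_l ?sym_r bE; case: (eqVneq k ord0) => [->|k0] //.
  by rewrite aE refl_l eqxx p0 addr0.
rewrite !aE refl_l refl_r (negbTE k0) mulrDr mulrA bas_sign2 mul1r.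
by rewrite addrC.
Qed.

Lemma anti_of p : p l0 0 = 0 -> exists b : 'cV[R]_n, p - refl p = antisym_form b.
Proof.
move=> p0; have aE s : (p - refl p) s 0 = p s 0 - refl p s 0 by rewrite !mxE.
pose b : 'cV[R]_n := \col_k (p - refl p) (lshift n.+1 (lift ord0 k)) 0.
have bE k : b k 0 = (p - refl p) (lshift n.+1 (lift ord0 k)) 0 by rewrite mxE.
exists b; apply: vec_eq => k; rewrite ?anti_l ?anti_r; case: unliftP => [i ->|->]; rewrite ?bE//.
- by rewrite aE refl_l eqxx p0 subrr.
- rewrite !aE refl_r refl_l /= mulrBr mulrA bas_sign2 mul1r opprB.
  by [].
- by rewrite aE refl_r eqxx subrr mulr0 oppr0.
Qed.

Lemma cdot_refl p q : p l0 0 = 0 -> q l0 0 = 0 -> cdot (refl p) q = cdot p (refl q).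
Proof.
move=> p0 q0; have h : 1 / 2 != 0 :> R by rewrite mulf_neq0 ?oner_neq0 ?invr_neq0 ?pnatr_eq0.
apply: (mulfI h); rewrite -(dot_comb n3) -(dot_comb n3).
rewrite -(dot_reflect 1); [|exact: cc_comb|exact: cc_comb].
have -> : (fun t => comb (refl p) (1 - t)) = comb p.
  by apply/funext => t; rewrite comb_refl// opprB addrC subrK.
by have -> : (fun t => comb q (1 - t)) = comb (refl q) by apply/funext => t; rewrite comb_refl.
Qed.

Lemma dot_comb_shift_reflect F p : cc F -> p l0 0 = 0 ->
  dot F (comb (refl p)) = dot (fun t => F (1 - t)) (comb p).
Proof.
move=> cF p0; rewrite -(dot_reflect 1 cF (cc_comb n3 _)); congr dot.
by apply/funext => t; rewrite comb_refl// opprB addrC subrK.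
Qed.

Lemma comb_delta : comb (delta_mx l0 0) = fun t => Phi ord0 (2 * t).
Proof.
apply/funext => t; rewrite combE (bigD1 l0)//= big1 ?addr0 => [|s sl].
  by rewrite mxE !eqxx mul1r lvl_l.
by rewrite mxE (negbTE sl) mul0r.
Qed.

Lemma cdot_delta p : cdot (delta_mx l0 0) p = p l0 0.
Proof.
rewrite cdotE (bigD1 l0)//= big1 ?addr0 => [|s sl]; first by rewrite mxE !eqxx mul1r.
by rewrite mxE (negbTE sl) mul0r.
Qed.

Lemma dot_phid_comb p : dot (@phid R n) (comb p) = 1 / 2 * nu n 0 * p l0 0.
Proof.
have -> : @phid R n = comb (nu n 0 *: delta_mx l0 0).
  rewrite combZ comb_delta; apply/funext => t.
  by rewrite PhiE mulrA mulfV ?mul1r// gt_eqF// nu_gt0.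
by rewrite dot_comb// cdotZl cdot_delta mulrA.
Qed.

(** The support of [comb p] in [[0, 1]] trades [xi] for [hfun], and [phid] is a multiple of the
    function at position [l0], where [p] vanishes. *)
Lemma dot_xi_comb p : p l0 0 = 0 -> dot xi (comb p) = dot (phit 0) (comb p).
Proof.
move=> p0; rewrite dot_xi//; [|exact: cc_comb|].
  rewrite dotBl; [|exact: cc_phit|exact: cc_phid|exact: cc_comb].
  by rewrite dot_phid_comb p0 mulr0 subr0.
by apply: suppW (supp_comb n3 p0) => //; lra.
Qed.

Lemma dot_Phi_comb (k : 'I_n.+1) p : dot (Phi k) (comb p) = (nu n k)^-1 * dot (phit k) (comb p).
Proof. by rewrite PhiE dotZl//; [exact: cc_phit|exact: cc_comb]. Qed.

Lemma Emx_of p : p l0 0 = 0 -> (forall k, (0 < k <= n)%N -> dot (phit k) (comb p) = 0) ->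
  dot xi (comb p) = 0 -> Emx Phi *m p = 0.
Proof.
move=> p0 Pk xp; apply/(Emx_comb0 n3) => k; rewrite dot_Phi_comb.
have [->|k0] := eqVneq k ord0; first by rewrite -dot_xi_comb// xp mulr0.
by rewrite Pk ?mulr0// lt0n k0 -ltnS ltn_ord.
Qed.

Lemma Emx_phit p k : Emx Phi *m p = 0 -> (k <= n)%N -> dot (phit k) (comb p) = 0.
Proof.
move=> /(Emx_comb0 n3) H kn; have := H (Ordinal (kn : (k < n.+1)%N)).
rewrite dot_Phi_comb => /eqP; rewrite mulf_eq0 invr_eq0 gt_eqF ?nu_gt0//.
by move/eqP.
Qed.

Lemma phit_reflectf k : (0 < k)%N ->
  (fun t => phit k (1 - t)) = fun t => bas_sign n k * phit k t.
Proof. by move=> k0; apply/funext => t; rewrite phit_reflect. Qed.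

(** [e] is the symmetry: 1 for the output of the symmetric case, -1 for the antisymmetric one. *)
Definition wavelet_vec e v := [/\ v l0 0 = 0, Emx Phi *m v = 0, cdot v v = 1 & refl v = e *: v].

Lemma wavelet_vec_xi e v : wavelet_vec e v -> dot xi (comb v) = 0.
Proof. by move=> [v0 Ev _ _]; rewrite dot_xi_comb// Emx_phit. Qed.

Lemma wavelet_vec_xi' e v : e != 0 -> wavelet_vec e v -> dot xi' (comb v) = 0.
Proof.
move=> e0 wv; have [v0 _ _ rv] := wv.
have := dot_comb_shift_reflect (cc_xi n3) v0; rewrite rv combZ.
by rewrite dotZr; [rewrite (wavelet_vec_xi wv) mulr0|exact: cc_comb|exact: cc_xi].
Qed.

Variables vs va : seq vec.
Hypothesis hs : algorithm_run (@sym_form R n) (Emx Phi) vs.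
Hypothesis ha : algorithm_run (@antisym_form R n) (Emx Phi) va.

Lemma wavelet_vec_vs v : v \in vs -> wavelet_vec 1 v.
Proof.
have [H1 H2 _ _] := runP sym_form0 hs.
move=> vv; have [c [b [vE Eb]]] := H1 v vv; split.
- by rewrite vE mxE sym_l eqxx mulr0.
- by rewrite vE -scalemxAr Eb scaler0.
- exact: H2.
by rewrite vE reflZ refl_sym scale1r.
Qed.

Lemma wavelet_vec_va v : v \in va -> wavelet_vec (-1) v.
Proof.
have [H1 H2 _ _] := runP antisym_form0 ha.
move=> vv; have [c [b [vE Eb]]] := H1 v vv; split.
- by rewrite vE mxE anti_l unlift_none mulr0.
- by rewrite vE -scalemxAr Eb scaler0.
- exact: H2.
by rewrite vE reflZ refl_anti scalerN scaleN1r.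
Qed.

(** Across the two lists: [refl] is self-adjoint, with eigenvalue 1 on [vs] and -1 on [va]. *)
Lemma orthseq_wavelets : orthseq (vs ++ va).
Proof.
have [_ _ os _] := runP sym_form0 hs; have [_ _ oa _] := runP antisym_form0 ha.
rewrite /orthseq pairwise_cat; apply/and3P; split => //.
apply/allrelP => u v /wavelet_vec_vs[u0 _ _ ru] /wavelet_vec_va[v0 _ _ rv].
have := cdot_refl u0 v0; rewrite ru rv cdotZl cdotZr mul1r mulN1r => E.
by apply/eqP; lra.
Qed.

Lemma exists_coordinates : exists (P : 'I_n -> vec) (X X' : vec),
  [/\ forall k, P k l0 0 = 0 /\ comb (P k) = phit k.+1,
      X l0 0 = 0 /\ comb X = xi & X' l0 0 = 0 /\ comb X' = xi'].
Proof.
have exP (k : 'I_n) : exists p, p l0 0 = 0 /\ comb p = phit k.+1.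
  have [||p p0 pE] := @comb_exists R n n3 (phit k.+1); last by exists p.
    exact: (VV_half n3 (VV_phit n3 (ltn_ord k))).
  exact: supp_phit.
have [P HP] := choice exP.
have [X X0 XE] := comb_exists n3 (@VV_xi_half R n n3) (@supp_xi R n n3).
have [X' X'0 X'E] := comb_exists n3 (@VV_xi'_half R n n3) (@supp_xi' R n n3).
by exists P, X, X'.
Qed.

(* The functions listed here and the output of the algorithm have orthogonal
   coordinate vectors; counting them gives the number of wavelets. *)
Lemma wavelet_complete : exists L : seq vec, [/\ complete L,
   size L = (n + 3 + size (vs ++ va))%N, orthseq L, (forall v, v \in L -> v != 0) &
   forall v, v \in L -> v \in vs ++ va \/
     (comb v = (fun t => Phi ord0 (2 * t)) \/ (exists2 k, (0 < k <= n)%N & comb v = phit k) \/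
      comb v = xi \/ comb v = xi')].
Proof.
have [P [X [X' [HP [X0 XE] [X'0 X'E]]]]] := exists_coordinates.
have h : 1 / 2 != 0 :> R by rewrite mulf_neq0 ?oner_neq0 ?invr_neq0 ?pnatr_eq0.
have cdP u v : dot (comb u) (comb v) = 0 -> cdot u v = 0.
  by rewrite dot_comb// => /eqP; rewrite mulf_eq0 (negbTE h) => /eqP.
have cdP' u v : cdot u v = 0 -> dot (comb u) (comb v) = 0.
  by rewrite dot_comb// => ->; rewrite mulr0.
have e1 : -1 != 0 :> R by rewrite oppr_eq0 oner_eq0.
have [_ _ _ cs] := runP sym_form0 hs.
have [_ _ _ ca] := runP antisym_form0 ha.
have xi'phit k : (0 < k <= n)%N -> dot xi' (phit k) = 0.
  move=> kn; have /andP[k0 _] := kn.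
  rewrite -(dot_reflect 1); [|exact: cc_xi'|exact: cc_phit].
  rewrite phit_reflectf// dotZr; [|exact: cc_phit|exact/cc_reflect/cc_xi'].
  have -> : (fun t => xi' (1 - t)) = xi by apply/funext => t; rewrite /xi' opprB addrC subrK.
  by rewrite dot_xi_phit ?mulr0.
pose Ps := [seq P k | k <- enum 'I_n].
have [XX [sXX oXX mXX XXm]] : exists XX : seq vec, [/\ size XX = 2%N, orthseq XX,
    (X \in XX) && (X' \in XX) & forall u, u \in XX -> u = X \/ u = X'].
  exists [:: X; X']; split=> //.
  - by rewrite /orthseq /= !andbT; apply/eqP/cdP; rewrite XE X'E dot_xi_xi'.
  - by rewrite !inE !eqxx orbT.
  - by move=> u; rewrite !inE => /orP[/eqP ->|/eqP ->]; [left|right].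
have /andP[XXX XXX'] := mXX.
pose L := delta_mx l0 0 :: (Ps ++ XX ++ (vs ++ va)).
have LP v : v \in L -> [\/ v = delta_mx l0 0, exists k, v = P k, v = X \/ v = X' | v \in vs ++ va].
  rewrite inE mem_cat mem_cat => /or4P[/eqP ->|/mapP[k _ ->]|/XXm|].
  - by constructor 1.
  - by constructor 2; exists k.
  - by constructor 3.
  - by constructor 4.
exists L; split.
- move=> p Hp.
  have p0 : p l0 0 = 0 by rewrite -cdot_delta Hp// mem_head.
  have pP k : (0 < k <= n)%N -> dot (phit k) (comb p) = 0.
    case: k => // k kn; rewrite -(HP (Ordinal kn)).2; apply: cdP'; apply: Hp.
    by rewrite inE mem_cat map_f ?mem_enum ?orbT.
  have pX : dot xi (comb p) = 0.
    by rewrite -XE; apply: cdP'; apply: Hp; rewrite inE !mem_cat ?XXX ?XXX' !orbT.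
  have pX' : dot xi' (comb p) = 0.
    by rewrite -X'E; apply: cdP'; apply: Hp; rewrite inE !mem_cat ?XXX ?XXX' !orbT.
  (* Orthogonality to [xi] puts [p] into the null space, orthogonality to [xi'] its reflection. Then
     [p + refl p] and [p - refl p] have the two forms searched by the algorithm, are perpendicular
     to its output, and must vanish. *)
  have Ep : Emx Phi *m p = 0 by exact: Emx_of.
  have Er : Emx Phi *m refl p = 0.
    apply: Emx_of; first by rewrite refl_l eqxx.
      move=> k kn; have /andP[k0 _] := kn.
      rewrite dot_comb_shift_reflect//; last exact: cc_phit.
      by rewrite phit_reflectf// dotZl ?pP ?mulr0//; [exact: cc_phit|exact: cc_comb].
    by rewrite dot_comb_shift_reflect//; exact: cc_xi.
  have S0 : p + refl p = 0.
    have [b bE] := sym_of p0; rewrite bE -[RHS]sym_form_of0; congr sym_form.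
    apply: cs; rewrite -bE; first by rewrite mulmxDr Ep Er addr0.
    move=> v vv; have [v0 _ _ rv] := wavelet_vec_vs vv.
    rewrite cdotDr -cdot_refl// rv scale1r Hp ?addr0//.
    by rewrite inE !mem_cat vv !orbT.
  have A0 : p - refl p = 0.
    have [b bE] := anti_of p0; rewrite bE -[RHS]antisym_form_of0; congr antisym_form.
    apply: ca; rewrite -bE; first by rewrite mulmxBr Ep Er subrr.
    move=> v vv; have [v0 _ _ rv] := wavelet_vec_va vv.
    rewrite -scaleN1r cdotDr cdotZr -cdot_refl// rv cdotZl Hp ?mulr0 ?addr0//.
    by rewrite inE !mem_cat vv !orbT.
  have : p + p = 0 by rewrite -[RHS](addr0 0) -{1}S0 -A0 addrACA subrr addr0.
  rewrite -mulr2n -scaler_nat => /eqP; rewrite scaler_eq0 pnatr_eq0 => /eqP //.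
- by rewrite /L /= size_cat size_cat sXX /Ps size_map size_enum_ord; lia.
- have allv v : v \in vs ++ va -> exists2 e, e != 0 & wavelet_vec e v.
    rewrite mem_cat => /orP[vv|vv].
      by exists 1; [exact: oner_neq0|exact: wavelet_vec_vs].
    by exists (-1) => //; exact: wavelet_vec_va.
  rewrite /orthseq /= pairwise_cat pairwise_cat; apply/and5P; split.
  + apply/allP => v; rewrite cdot_delta mem_cat mem_cat => /or3P[|/XXm|].
    * by move=> /mapP[k _ ->]; rewrite (HP k).1.
    * by move=> [->|->]; apply/eqP.
    * by move=> /allv[e _ [-> _ _ _]].
  + apply/allrelP => u v /mapP[k _ ->]; rewrite mem_cat => /orP[/XXm|].
      move=> [->|->]; apply/eqP/cdP; rewrite (HP k).2 dotC ?XE ?X'E.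
        by rewrite dot_xi_phit//= ltn_ord.
      by rewrite xi'phit//= ltn_ord.
    move=> /allv[e _ [_ Ev _ _]]; apply/eqP/cdP; rewrite (HP k).2.
    by rewrite Emx_phit.
  + rewrite pairwise_map; apply: (sub_pairwise (r := [rel x y | x != y])); last first.
      by rewrite -uniq_pairwise enum_uniq.
    move=> k l /= kl; apply/eqP/cdP; rewrite (HP k).2 (HP l).2.
    have := @phit_orth R n n3 k.+1 l.+1 0 (ltn_ord k) (ltn_ord l).
    rewrite eqSS kl => /(_ isT) <-; congr dot; apply/funext => t; rewrite subr0//.
  + apply/allrelP => u v /XXm[->|->] /allv[e e0 wv]; apply/eqP/cdP; rewrite ?XE ?X'E.
      exact: wavelet_vec_xi wv.
    exact: wavelet_vec_xi' e0 wv.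
  + by apply/andP; split => //; exact: orthseq_wavelets.
- have nz p f : comb p = f -> (exists t, f t != 0) -> p != 0.
    by move=> pf [t ft]; apply/eqP => p0; move: ft; rewrite -pf p0 comb0 eqxx.
  have nd f : 0 < dot f f -> exists t, f t != 0.
    move=> f0; apply: contrapT => /forallNP ff; move: f0; rewrite dot_disj ?ltxx// => t.
    by have /negP := ff t; rewrite negbK => /eqP ->; rewrite mul0r.
  move=> v /LP[->|[k ->]||].
  + apply/eqP => /(congr1 (fun v : vec => v l0 0)); rewrite !mxE !eqxx.
    exact/eqP/oner_neq0.
  + by apply: (nz _ _ (HP k).2); apply/nd/phit_norm_gt0.
  + move=> [->|->]; first exact: (nz _ _ XE (xi_neq0 n3)).
    apply: (nz _ _ X'E); have [t t0] := @xi_neq0 R n n3.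
    by exists (1 - t); rewrite /xi' opprB addrC subrK.
  + rewrite mem_cat => /orP[/wavelet_vec_vs|/wavelet_vec_va] [_ _ v1 _]; apply/eqP => v0;
      move: v1; rewrite v0 cdotE big1 => [/eqP|s _]; rewrite ?mxE ?mul0r//;
      by rewrite eq_sym oner_eq0.
- move=> v /LP[->|[k ->]||].
  + by right; left; exact: comb_delta.
  + by right; right; left; exists k.+1; [exact: ltn_ord|exact: (HP k).2].
  + move=> [->|->]; first by right; right; right; left.
    by right; right; right; right.
  + by left.
Qed.

(** Of the [2 n + 2] members of the complete list, [n + 3] are not wavelets: the vector at [l0], [n]
    scaling functions, [xi] and [xi']. *)
Lemma size_wavelets : size (vs ++ va) = n.-1.
Proof.
have [L [cL sL oL nL _]] := wavelet_complete.
have := orth_complete_size oL cL nL; rewrite sL; lia.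
Qed.

End Wavelets.

(** * The decomposition of V_1 *)

Section Span.
Context {R : realType}.
Implicit Types (S T : (R -> R) -> Prop) (F G : R -> R).

Inductive funspan S : (R -> R) -> Prop :=
| span0 : funspan S (fun=> 0)
| spanS c F G : S F -> funspan S G -> funspan S (fun t => c * F t + G t).

Lemma span_gen S F : S F -> funspan S F.
Proof.
move=> SF; have := spanS 1 SF (span0 S).
by under eq_fun do rewrite mul1r addr0.
Qed.

Lemma spanD S F G : funspan S F -> funspan S G -> funspan S (fun t => F t + G t).
Proof.
elim=> [|c F' G' SF' _ IH] sG; first by under eq_fun do rewrite add0r.
by have := spanS c SF' (IH sG); under eq_fun do rewrite addrA.
Qed.

Lemma spanZ S c F : funspan S F -> funspan S (fun t => c * F t).
Proof.
elim=> [|d F' G' SF' _ IH]; first by under eq_fun do rewrite mulr0; exact: span0.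
by have := spanS (c * d) SF' IH; under eq_fun do rewrite -mulrA -mulrDr.
Qed.

Lemma spanB S F G : funspan S F -> funspan S G -> funspan S (fun t => F t - G t).
Proof.
move=> sF sG; have := spanD sF (spanZ (-1) sG).
by under eq_fun do rewrite mulN1r.
Qed.

Lemma span_sum S (I : Type) (s : seq I) (F : I -> R -> R) :
  (forall i, funspan S (F i)) -> funspan S (fun t => \sum_(i <- s) F i t).
Proof.
move=> cF; elim: s => [|i s IH].
  by under eq_fun do rewrite big_nil; exact: span0.
by under eq_fun do rewrite big_cons; exact: spanD.
Qed.

Lemma span_comp S T (a : R -> R) : (forall F, S F -> funspan T (fun t => F (a t))) ->
  forall F, funspan S F -> funspan T (fun t => F (a t)).
Proof.
move=> ST F; elim=> [|c F' G SF _ IH]; first exact: span0.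
by apply: spanD => //; apply: spanZ; exact: ST.
Qed.

End Span.

(** * Orthogonality and span of the wavelets on one scale *)

Section WaveletRelations.
Context {R : realType} (n : nat).
Hypothesis n3 : (3 <= n)%N.
Implicit Types (f g h F G H : R -> R) (t x a b c : R) (i : int).
Local Notation phit k := (@phit R n k).
Local Notation phid := (@phid R n).
Local Notation Phi := (@Phi R n).
Local Notation VV := (@VV R n).
Local Notation vec := 'cV[R]_(n.+1 + n.+1).
Local Notation comb := (combination Phi).
Local Notation xi := (@xi R n).
Local Notation xi' := (@xi' R n).
Implicit Types (p q v : vec).
Variables vs va : seq vec.
Hypothesis hs : algorithm_run (@sym_form R n) (Emx Phi) vs.
Hypothesis ha : algorithm_run (@antisym_form R n) (Emx Phi) va.
Local Notation ps := (@psi R n vs va).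

Lemma wavelet_vec_wavelet v : v \in vs ++ va -> exists e, e != 0 /\ wavelet_vec e v.
Proof.
rewrite mem_cat => /orP[vv|vv].
  by exists 1; rewrite oner_neq0; split=> //; exact: (wavelet_vec_vs hs).
by exists (-1); rewrite oppr_eq0 oner_neq0; split=> //; exact: (wavelet_vec_va ha).
Qed.

Lemma psi_comb j : (1 < j <= n)%N -> nth 0 (vs ++ va) (j - 2) \in vs ++ va /\
  ps j = comb (nth 0 (vs ++ va) (j - 2)).
Proof.
case: j => [|[|j]] //= jn; rewrite subn2 /=.
have jk : (j < size (vs ++ va))%N by rewrite (size_wavelets n3 hs ha); lia.
by split; [exact: mem_nth|rewrite /psi /= (nth_map 0)].
Qed.

Lemma ps0 : ps 0 = psi0 n. Proof. by []. Qed.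

Lemma ps1 : ps 1 = psi1 n. Proof. by []. Qed.

Lemma psi_cases j : (j <= n)%N -> [\/ j = 0%N, j = 1%N |
  (1 < j)%N /\ exists e v, [/\ e != 0, wavelet_vec e v, v = nth 0 (vs ++ va) (j - 2) & ps j = comb v]].
Proof.
case: j => [|[|j]] jn; [by constructor 1|by constructor 2|constructor 3; split=> //].
have [|vm ->] := @psi_comb j.+2; first by rewrite jn.
by have [e [e0 wv]] := wavelet_vec_wavelet vm; exists e, (nth 0 (vs ++ va) (j.+2 - 2)).
Qed.

Lemma VV_comb_half p : VV (fun t => comb p (t / 2)).
Proof.
have -> : (fun t => comb p (t / 2)) = fun t => \sum_(k < n.+1) p (lshift n.+1 k) 0 * Phi k t
   + \sum_(k < n.+1) p (rshift n.+1 k) 0 * Phi k (t - 1).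
  apply/funext => t; rewrite comb_split; congr (_ + _); apply: eq_bigr => k _; congr (_ * Phi k _).
    by field.
  by field.
apply: VVD; apply: VV_sum => k; apply: VVZ; first exact: VV_Phi.
exact: (VV_shift n3 1 (VV_Phi n3 k)).
Qed.

Lemma psi_half j : (j <= n)%N -> VV (fun t => ps j (t / 2)).
Proof.
case/psi_cases => [->|->|[_ [e [v [_ _ _ ->]]]]]; last exact: VV_comb_half.
  exact: VV_psi0_half.
exact: VV_psi1_half.
Qed.

Lemma cc_of_half F : cc (fun t => F (t / 2)) -> cc F.
Proof. by move=> /cc_double; rewrite double_halfK. Qed.

Lemma cc_psi j : (j <= n)%N -> cc (ps j).
Proof. by move=> /psi_half/VV_cc/cc_of_half. Qed.

Lemma supp01_int F i : supp 0 1 F -> F i%:~R = 0.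
Proof.
move=> sF; apply: sF; have [i0|i1] : i <= 0 \/ 1 <= i by lia.
  by left; move: i0; rewrite -(ler_int R).
by right; move: i1; rewrite -(ler_int R).
Qed.

(** Serves with [dot_psi0], which turns inner products with [psi 0] into values at 0. *)
Lemma psi_int j i : (j <= n)%N -> (j != 0%N) || (i != 0) -> ps j i%:~R = 0.
Proof.
move=> /psi_cases[->|->|[_ [e [v [_ [v0 _ _ _] _ ->]]]]] ji.
- rewrite ps0 psi0E// supp_phid ?supp_phit0 ?mulr0 ?subrr//.
    have [i1|i1] : i <= -1 \/ 1 <= i by move: ji; rewrite /=; lia.
      by left; move: i1; rewrite -(ler_int R); lra.
    by right; move: i1; rewrite -(ler_int R); lra.
  have [i1|i1] : i <= -1 \/ 1 <= i by move: ji; rewrite /=; lia.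
    by left; move: i1; rewrite -(ler_int R); lra.
  by right; move: i1; rewrite -(ler_int R); lra.
- rewrite ps1 psi1E// -rmorphN/= !supp01_int ?subrr//; exact: supp_xi.
- by rewrite supp01_int//; exact: supp_comb.
Qed.

(** [G] belongs to [V_1]: after dilation, its inner product with [phid] is one with [phit 0] and
    reads off [G 0]. *)
Lemma dot_psi0 G : VV (fun t => G (t / 2)) -> dot (phit 0) G = 0 ->
  dot (ps 0) G = G 0 / 2 * dot phid phid.
Proof.
move=> vG fG; have cG := cc_of_half (VV_cc vG); have cf : cc (phit 0) by exact: cc_phit.
rewrite ps0 psi0E// dotBl//; [|exact: cc_phid|exact: ccZ].
rewrite dotZl// fG mulr0 subr0 dotC -{1}[G]double_halfK.
rewrite (dot_double (VV_cc vG) cf) (dot_VV_phit0 n3 vG) dot_phid_phid// mul0r.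
by ring.
Qed.

Lemma dot_xi_shift F i : supp 0 1 F -> dot xi F = 0 -> dot xi (fun t => F (t - i%:~R)) = 0.
Proof.
move=> sF xF; have [->|i0] := eqVneq i 0.
  by have -> : (fun t => F (t - 0%:~R)) = F by apply/funext => t; rewrite subr0.
have s1 := supp_shift (c := i%:~R) sF; have sx := @supp_xi R n n3.
apply: dot_disj => t; have [i1|i1] : i <= -1 \/ 1 <= i by lia.
  by rewrite mulrC; apply: (supp_disj s1 sx); move: i1; rewrite -(ler_int R); lra.
by apply: (supp_disj sx s1); move: i1; rewrite -(ler_int R); lra.
Qed.

Lemma dot_psi1 F i : cc F -> dot (ps 1) (fun t => F (t - i%:~R)) =
  dot xi (fun t => F (t - i%:~R)) - dot xi (fun t => F (- t - i%:~R)).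
Proof.
move=> cF; have cFi := cc_shiftB i%:~R cF.
rewrite ps1 psi1E// dotBl//; [|exact: cc_xi|exact/cc_opp/cc_xi].
rewrite -(dot_opp (cc_opp (cc_xi n3)) cFi).
by have -> : (fun t => xi (- - t)) = xi by apply/funext => t; rewrite opprK.
Qed.

(** The mirrored half of [psi 1] meets a translate of [F] as [xi] meets the mirror image of that
    translate, which is [e] times another translate of [F]. Translates by nonzero integers miss [xi]
    altogether. *)
Lemma dot_psi1_reflect F i e : cc F -> supp 0 1 F -> (forall t, F (1 - t) = e * F t) ->
  dot xi F = 0 -> dot (ps 1) (fun t => F (t - i%:~R)) = 0.
Proof.
move=> cF sF eF xF; rewrite dot_psi1// dot_xi_shift// sub0r.
have -> : (fun t => F (- t - i%:~R)) = (fun t => e * F (t - (- i - 1)%:~R)).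
  by apply/funext => t; rewrite -eF; congr F; rewrite rmorphB rmorphN/=; ring.
by rewrite dotZr ?dot_xi_shift ?mulr0 ?oppr0//; [exact: cc_shiftB|exact: cc_xi].
Qed.

Lemma comb_reflect e v t : wavelet_vec e v -> comb v (1 - t) = e * comb v t.
Proof. by move=> [v0 _ _ rv]; rewrite -comb_refl// rv combZ. Qed.

Lemma dot_supp_far F G i : supp 0 1 F -> supp (-1) 1 G -> i != 0 -> i != 1 ->
  dot F (fun t => G (t - i%:~R)) = 0.
Proof.
move=> sF sG i0 i1; have s1 := supp_shift (c := i%:~R) sG.
apply: dot_disj => t; have [i2|i2] : i <= -1 \/ 2 <= i by lia.
  by rewrite mulrC; apply: (supp_disj s1 sF); move: i2; rewrite -(ler_int R); lra.
by apply: (supp_disj sF s1); move: i2; rewrite -(ler_int R); lra.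
Qed.

Lemma psi_phit j k i : (j <= n)%N -> (k <= n)%N -> dot (ps j) (fun t => phit k (t - i%:~R)) = 0.
Proof.
move=> jn kn; have vF : VV (fun t => phit k (t - i%:~R)) by exact/VV_shift/VV_phit.
case/psi_cases: jn => [->|->|[_ [e [v [e0 wv _ ->]]]]].
- rewrite ps0 psi0E// dotBl; [|exact: cc_phid|exact/ccZ/cc_phit|exact: (VV_cc vF)].
  rewrite dotZl; [|exact: cc_phit|exact: (VV_cc vF)].
  rewrite dotC dot_VV_phid// [dot (phit 0) _]dotC dot_VV_phit0// dot_phid_phid//.
  by field.
- case: k kn vF => [|k] kn vF; last first.
    apply: (@dot_psi1_reflect _ _ (bas_sign n k.+1)).
    + exact: cc_phit.
    + exact: supp_phit.
    + by move=> t; rewrite phit_reflect.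
    + by rewrite dot_xi_phit.
  have A m : m != 0 -> dot xi (fun t => phit 0 (t - m%:~R)) = 0.
    move=> m0; have [->|m1] := eqVneq m 1.
      rewrite dot_xi//; last first.
      - have := supp_shift (c := 1) (@supp_phit0 R n n3).
        by apply: suppW; lra.
      - exact/cc_shiftB/cc_phit.
      apply: hfun_VV => //; first exact: VV_phit0_shift1.
        by apply: supp_phit0 => //; left; lra.
      exact: dot_phit0_shift1.
    by apply: dot_supp_far => //; [exact: supp_xi|exact: supp_phit0].
  rewrite dot_psi1; last exact: cc_phit.
  have -> : (fun t => phit 0 (- t - i%:~R)) = (fun t => phit 0 (t - (- i)%:~R)).
    by apply/funext => t; rewrite -phit0_opp//; congr (phit 0 _); rewrite rmorphN/=; ring.
  have [->|i0] := eqVneq i 0; first by rewrite oppr0 subrr.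
  by rewrite !A ?oppr_eq0// subrr.
- have [v0 Ev _ _] := wv; have sv := supp_comb n3 v0; have cv := @cc_comb R n n3 v.
  have [->|i0] := eqVneq i 0.
    have -> : (fun t => phit k (t - 0%:~R)) = phit k by apply/funext => t; rewrite subr0.
    by rewrite dotC (Emx_phit n3 Ev kn).
  have [i1|i1] := eqVneq i 1; last by apply: dot_supp_far => //; exact: supp_phitW.
  case: k kn vF => [|k] kn vF; last first.
    have s1 := supp_shift (c := i%:~R) (@supp_phit R n n3 _ (ltn0Sn k)).
    by apply: dot_disj; apply: (supp_disj sv s1); rewrite i1; lra.
  (* [Emx] knows only untranslated generators. Reflection in 1/2 carries [phit 0 (t - 1)] to
     [phit 0] and [comb v] to a multiple of itself. *)
  rewrite -(dot_reflect 1 cv); last exact/cc_shiftB/cc_phit.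
  have -> : (fun t => comb v (1 - t)) = fun t => e * comb v t.
    by apply/funext => t; exact: comb_reflect.
  have -> : (fun t => phit 0 (1 - t - i%:~R)) = phit 0.
    by apply/funext => t; rewrite i1 -[RHS]phit0_opp//; congr (phit 0 _); ring.
  by rewrite dotZl// ?(dotC (comb v)) ?(Emx_phit n3 Ev) ?mulr0//; exact: cc_phit.
Qed.

Lemma psi_VV j F : (j <= n)%N -> VV F -> dot (ps j) F = 0.
Proof.
move=> jn vF; have [M [c [_ ->]]] := VV_expand_sym n3 vF.
have cp := cc_psi jn.
have ct (i k : nat) : cc (fun t => c i k * phit k (t - (- M%:Z + i%:Z)%:~R)).
  by apply/ccZ/cc_shiftB/cc_phit.
rewrite dot_sumr//; last by move=> i; apply: cc_sum => k; exact: ct.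
rewrite big1// => i _; rewrite dot_sumr// big1// => k _; rewrite dotZr//; last exact/cc_shiftB/cc_phit.
by rewrite psi_phit ?mulr0//; exact: (ltn_ord k).
Qed.

Lemma dot_shiftl F G i : cc F -> cc G ->
  dot F (fun t => G (t - i%:~R)) = dot G (fun t => F (t - (- i)%:~R)).
Proof.
move=> cF cG; rewrite -(dot_shift i%:~R cF (cc_shiftB _ cG)) dotC.
have -> : (fun t => G (t + i%:~R - i%:~R)) = G by apply/funext => t; rewrite addrK.
by under [in RHS]eq_fun do rewrite rmorphN opprK.
Qed.

(** Values at integers settle the pairs with [psi 0], reflection those with [psi 1]. The others live
    on one cell each, where their coordinate vectors are orthogonal; translation moves the special
    wavelet to the left factor. *)
Lemma psi_orth j l i : (j <= n)%N -> (l <= n)%N -> (j != l) || (i != 0) ->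
  dot (ps j) (fun t => ps l (t - i%:~R)) = 0.
Proof.
have P0 l' m : (l' <= n)%N -> (0%N != l') || (m != 0) -> dot (ps 0) (fun t => ps l' (t - m%:~R)) = 0.
  move=> ln lm; have cl := cc_psi ln.
  rewrite dot_psi0.
  - by rewrite sub0r -rmorphN/= psi_int ?mul0r// oppr_eq0 eq_sym.
  - have := VV_shift n3 (2 * m) (psi_half ln); congr (VV _); apply/funext => t.
    by congr (ps l' _); rewrite rmorphM/=; field.
  - rewrite dot_shiftl//; last exact: cc_phit.
    by rewrite psi_VV//; apply: VV_shift => //; exact: VV_phit.
have P1 l' m : (0 < l' <= n)%N -> (1%N != l') || (m != 0) -> dot (ps 1) (fun t => ps l' (t - m%:~R)) = 0.
  move=> /andP[l0 ln] lm; have cl := cc_psi ln.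
  case/psi_cases: (ln) l0 lm cl => [->|->|[_ [e [v [e0 wv _ ->]]]]] //= _ lm cl; last first.
    have [v0 _ _ _] := wv; apply: (@dot_psi1_reflect _ _ e) => //.
    - exact: supp_comb.
    - by move=> t; exact: comb_reflect.
    - exact: (wavelet_vec_xi n3 wv).
  have sx := @supp_xi R n n3; have cx := @cc_xi R n n3.
  have X1 r : r != 0 -> dot xi (fun t => xi (t - r%:~R)) = 0.
    move=> r0; have s1 := supp_shift (c := r%:~R) sx.
    apply: dot_disj => t; have [r1|r1] : r <= -1 \/ 1 <= r by lia.
      by rewrite mulrC; apply: (supp_disj s1 sx); move: r1; rewrite -(ler_int R); lra.
    by apply: (supp_disj sx s1); move: r1; rewrite -(ler_int R); lra.
  have X2 r : dot xi (fun t => xi (r%:~R - t)) = 0.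
    have -> : (fun t => xi (r%:~R - t)) = (fun t => xi' (t - (r - 1)%:~R)).
      by apply/funext => t; rewrite /xi'; congr xi; rewrite rmorphB/=; ring.
    by apply: dot_xi_shift; [exact: supp_xi'|exact: dot_xi_xi'].
  have cr r : cc (fun t => xi (r - t)) by exact: cc_reflect.
  have cd : cc (fun t => xi t - xi (- t)) by exact: (ccB cx (cc_opp cx)).
  have E1 : ps 1 = fun t => xi t - xi (- t) by rewrite ps1 psi1E.
  rewrite (dot_psi1 m cl) E1.
  have -> : (fun t => xi (t - m%:~R) - xi (- (t - m%:~R))) =
            (fun t => xi (t - m%:~R) - xi (m%:~R - t)).
    by apply/funext => t; congr (_ - xi _); ring.
  have -> : (fun t => xi (- t - m%:~R) - xi (- (- t - m%:~R))) =
            (fun t => xi ((- m)%:~R - t) - xi (t - (- m)%:~R)).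
    by apply/funext => t; rewrite rmorphN/=; congr (xi _ - xi _); ring.
  rewrite (dotBr (cc_shiftB m%:~R cx) (cr m%:~R) cx).
  rewrite (dotBr (cr (- m)%:~R) (cc_shiftB (- m)%:~R cx) cx).
  by rewrite !X1 ?oppr_eq0// !X2 !subrr.
move=> jn ln jl; have cj := cc_psi jn; have cl := cc_psi ln.
have [j0|j0] := eqVneq j 0%N; first by rewrite j0 in jl *; exact: P0.
have [l0|l0] := eqVneq l 0%N.
  by rewrite dot_shiftl// l0 P0// eq_sym j0.
have [j1|j1] := eqVneq j 1%N; first by rewrite j1 in jl *; apply: P1; rewrite ?lt0n ?l0.
have [l1|l1] := eqVneq l 1%N.
  by rewrite dot_shiftl// l1 P1 ?lt0n ?j0// eq_sym j1.
have [j2|j2|[_ [e [v [_ wv vE jE]]]]] := psi_cases jn; [by rewrite j2 in j0|by rewrite j2 in j1|].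
have [l2|l2|[_ [e' [v' [_ wv' vE' lE]]]]] := psi_cases ln; [by rewrite l2 in l0|by rewrite l2 in l1|].
have [v0 _ _ _] := wv; have [v'0 _ _ _] := wv'.
have sv := supp_comb n3 v0; have sv' := supp_comb n3 v'0.
rewrite jE lE; have [i0|i0] := eqVneq i 0; last first.
  have s1 := supp_shift (c := i%:~R) sv'.
  apply: dot_disj => t; have [r1|r1] : i <= -1 \/ 1 <= i by lia.
    by rewrite mulrC; apply: (supp_disj s1 sv); move: r1; rewrite -(ler_int R); lra.
  by apply: (supp_disj sv s1); move: r1; rewrite -(ler_int R); lra.
have -> : (fun t => comb v' (t - i%:~R)) = comb v' by apply/funext => t; rewrite i0 subr0.
rewrite i0 eqxx orbF in jl; rewrite dot_comb// vE vE'.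
have := orthseq_wavelets n3 hs ha; move/(pairwiseP 0) => o.
have sz := size_wavelets n3 hs ha.
have jk : (j - 2 < size (vs ++ va))%N by rewrite sz; lia.
have lk : (l - 2 < size (vs ++ va))%N by rewrite sz; lia.
have [jl'|lj] : (j - 2 < l - 2)%N \/ (l - 2 < j - 2)%N by lia.
  by have /eqP -> := o _ _ jk lk jl'; rewrite mulr0.
by rewrite cdotC; have /eqP -> := o _ _ lk jk lj; rewrite mulr0.
Qed.

Lemma psi_norm_gt0 j : (j <= n)%N -> 0 < dot (ps j) (ps j).
Proof.
move=> jn; have cp := cc_psi jn; case/psi_cases: jn cp => [->|->|[_ [e [v [_ wv _ ->]]]]] cp.
- apply: (dot_gt0 (t := 0)) => //; rewrite ps0 psi0E// /phid mulr0 phit0_0//.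
  by rewrite div1r mulVf ?pnatr_eq0//; lra.
- have [t t0] := @xi_neq0 R n n3; apply: (dot_gt0 (t := t)) => //.
  rewrite ps1 psi1E// [xi (- t)]supp_xi ?subr0//; left.
  have [tp|tn] := leP 0 t; first by lra.
  by move: t0; rewrite supp_xi ?eqxx//; left; lra.
- by rewrite dot_comb//; have [_ _ -> _] := wv; lra.
Qed.

Definition level1_generators F := (exists k i, (k <= n)%N /\ F = fun t => phit k (t - i%:~R)) \/
  (exists j i, (j <= n)%N /\ F = fun t => ps j (t - i%:~R)).

Lemma span_phit k i : (k <= n)%N -> funspan level1_generators (fun t => phit k (t - i%:~R)).
Proof. by move=> kn; apply: span_gen; left; exists k, i. Qed.

Lemma span_psi j i : (j <= n)%N -> funspan level1_generators (fun t => ps j (t - i%:~R)).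
Proof. by move=> kn; apply: span_gen; right; exists j, i. Qed.

Lemma span_shift F i : funspan level1_generators F -> funspan level1_generators (fun t => F (t - i%:~R)).
Proof.
apply: (@span_comp _ _ _ (fun t => t - i%:~R)) => G.
move=> [[k [m [kn ->]]]|[j [m [jn ->]]]].
  have := span_phit (i + m) kn; congr (funspan level1_generators _); apply/funext => t.
  by congr (phit k _); rewrite rmorphD/=; ring.
have := span_psi (i + m) jn; congr (funspan level1_generators _); apply/funext => t.
by congr (ps j _); rewrite rmorphD/=; ring.
Qed.

Lemma span_phid i : funspan level1_generators (fun t => phid (t - i%:~R)).
Proof.
have -> : (fun t => phid (t - i%:~R)) = fun t => ps 0 (t - i%:~R) + 1 / 2 * phit 0 (t - i%:~R).
  by apply/funext => t; rewrite ps0 psi0E// subrK.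
by apply: spanD; [exact: span_psi|apply: spanZ; exact: span_phit].
Qed.

(** The complete list spans, so its members suffice. [phid] comes from [psi 0] and [phit 0]; adding
    or subtracting [hfun] and [psi 1], or their translates by 1, recovers [xi] and [xi']. *)
Lemma span_comb p : funspan level1_generators (comb p).
Proof.
have [L [cL _ _ _ HL]] := wavelet_complete n3 hs ha.
have [c ->] := complete_span p cL; rewrite comb_sum.
apply: span_sum => k; apply: spanZ.
have id0 F : funspan level1_generators (fun t => F (t - 0%:~R)) -> funspan level1_generators F.
  by congr (funspan level1_generators _); apply/funext => t; rewrite subr0.
have sh i : funspan level1_generators (fun t => hfun n (t - i%:~R)).
  by apply: spanB; [exact: span_phit|exact: span_phid].
case: (HL _ (mem_nth 0 (ltn_ord k))) => [vv|[->|[[l ln ->]|[->|->]]]].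
- move: vv => /(nthP 0)[j jk <-].
  have jn : (1 < j.+2 <= n)%N by move: jk; rewrite (size_wavelets n3 hs ha); lia.
  have [_ E] := psi_comb jn; rewrite subn2 /= in E; rewrite -E.
  by apply: id0; apply: span_psi; lia.
- have -> : (fun t => Phi ord0 (2 * t)) = fun t => (nu n 0)^-1 * phid t by [].
  by apply: spanZ; apply: id0; exact: span_phid.
- by apply: id0; apply: span_phit; lia.
- have -> : xi = fun t => 1 / 2 * (ps 1 t + hfun n t).
    by apply/funext => t; rewrite ps1 psi1E// hfun_split//; field.
  by apply: spanZ; apply: spanD; apply: id0; [apply: span_psi; lia|exact: sh].
- have -> : xi' = fun t => 1 / 2 * (hfun n (t - 1%:~R) - ps 1 (t - 1%:~R)).
    by apply/funext => t; rewrite ps1 psi1E// hfun_split// opprB /xi'; field.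
  by apply: spanZ; apply: spanB; [exact: sh|apply: span_psi; lia].
Qed.

Lemma span_phit_double k i : (k <= n)%N -> funspan level1_generators (fun t => phit k (2 * t - i%:~R)).
Proof.
move=> kn; pose k' : 'I_n.+1 := Ordinal (kn : (k < n.+1)%N).
pose m := (i %/ 2)%Z.
have nk : nu n k != 0 :> R by rewrite gt_eqF// nu_gt0.
have E (s : 'I_(n.+1 + n.+1)) : comb (delta_mx s 0) = lvl s.
  apply/funext => t; rewrite combE (bigD1 s)//= big1 ?addr0 => [|r sr].
    by rewrite mxE !eqxx mul1r.
  by rewrite mxE (negbTE sr) mul0r.
have [iE|iE] : i = 2 * m \/ i = 2 * m + 1 by rewrite /m; lia.
  have := spanZ (nu n k) (span_shift m (span_comb (delta_mx (lshift n.+1 k') 0))).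
  rewrite E lvl_l; congr (funspan level1_generators _); apply/funext => t.
  by rewrite PhiE mulrA mulfV// mul1r; congr (phit k _); rewrite [in RHS]iE rmorphM/=; ring.
have := spanZ (nu n k) (span_shift m (span_comb (delta_mx (rshift n.+1 k') 0))).
rewrite E lvl_r; congr (funspan level1_generators _); apply/funext => t.
by rewrite PhiE mulrA mulfV// mul1r; congr (phit k _); rewrite [in RHS]iE rmorphD rmorphM/=; ring.
Qed.

Lemma VV_double_span F : VV F -> funspan level1_generators (fun t => F (2 * t)).
Proof.
move=> vF; have [M [c [_ ->]]] := VV_expand_sym n3 vF.
apply: span_sum => i; apply: span_sum => k; apply: spanZ.
by apply: span_phit_double; exact: (ltn_ord k).
Qed.

Definition psi_translate F := exists j i, (j <= n)%N /\ F = fun t => ps j (t - i%:~R).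

Lemma VV_double_split F : VV F -> exists H E, [/\ VV H, funspan psi_translate E &
  forall t, F (2 * t) = H t + E t].
Proof.
move=> /VV_double_span.
suff HE G : funspan level1_generators G -> exists H E, [/\ VV H, funspan psi_translate E & forall t, G t = H t + E t].
  by move=> /HE.
elim=> [|c F' G' gF _ [H [E [vH sE E']]]].
  exists (fun=> 0), (fun=> 0); split; [exact: VV0|exact: span0|move=> t; by rewrite addr0].
case: gF => [[k [i [kn ->]]]|wF].
  exists (fun t => c * phit k (t - i%:~R) + H t), E; split=> // [|t].
    by apply: VVD => //; apply: VVZ; apply: VV_shift => //; exact: VV_phit.
  by rewrite E' addrA.
exists H, (fun t => c * F' t + E t); split=> // [|t]; first exact: spanS.
by rewrite E' addrCA.
Qed.

End WaveletRelations.

(** * Approximation in L^2 by continuous functions *)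

Section SquareIntegrals.
Context {R : realType}.
Notation mu := (@lebesgue_measure R).
Implicit Types (f g h F G : R -> R) (a b c k eps : R).

Definition sqint f : \bar R := (\int[mu]_t ((f t) ^+ 2)%:E)%E.

Lemma sqint_ge0 f : (0 <= sqint f)%E.
Proof. by apply: integral_ge0 => t _; rewrite lee_fin sqr_ge0. Qed.

Lemma measurable_sqr f : measurable_fun setT f -> measurable_fun setT (EFin \o (fun t => f t ^+ 2)).
Proof. by move=> mf; apply/measurable_EFinP; exact: measurable_funX. Qed.

Lemma Lnorm2_sqint f : ('N[mu]_(2%:E)[EFin \o f] = (sqint f) `^ 2^-1)%E.
Proof.
rewrite unlock; congr (_ `^ _)%E; apply: eq_integral => t _ /=.
by rewrite powR_mulrn// -normrX ger0_norm// sqr_ge0.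
Qed.

Lemma Lnorm2_lt f eps : 0 < eps -> (sqint f < (eps ^+ 2)%:E)%E ->
  ('N[mu]_(2%:E)[EFin \o f] < eps%:E)%E.
Proof.
move=> e0; rewrite Lnorm2_sqint; have := sqint_ge0 f; case: (sqint f) => [r| |]//=.
rewrite !lee_fin !lte_fin => r0 re.
rewrite -[ltRHS]gtr0_norm// -sqrtr_sqr -powR12_sqrt ?sqr_ge0//.
by apply: gt0_ltr_powR; rewrite ?nnegrE ?sqr_ge0// invr_gt0.
Qed.

(** The quarter comes from [(f + g)^2 <= 2 f^2 + 2 g^2]. *)
Lemma sqintD_lt f g eps : measurable_fun setT f -> measurable_fun setT g ->
  (sqint f < (eps / 4)%:E)%E -> (sqint g < (eps / 4)%:E)%E ->
  (sqint (fun t => f t + g t)%R < eps%:E)%E.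
Proof.
move=> mf mg sf sg.
have mZ h : measurable_fun setT h -> measurable_fun setT (EFin \o (fun t => 2 * h t ^+ 2)).
  by move=> mh; apply/measurable_EFinP/measurable_funM => //; exact: measurable_funX.
have E h : measurable_fun setT h -> (\int[mu]_t (2 * (h t) ^+ 2)%:E = 2%:E * sqint h)%E.
  move=> mh; under eq_integral do rewrite EFinM.
  rewrite ge0_integralZl_EFin//; first by move=> t _; rewrite lee_fin sqr_ge0.
  exact: measurable_sqr.
apply: (@le_lt_trans _ _ (2%:E * sqint f + 2%:E * sqint g)%E).
  rewrite -!E// -ge0_integralD//; last 4 first.
  - by move=> t _; rewrite lee_fin mulr_ge0// sqr_ge0.
  - exact: mZ.
  - by move=> t _; rewrite lee_fin mulr_ge0// sqr_ge0.
  - exact: mZ.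
  apply: ge0_le_integral => //.
  - by move=> t _; rewrite lee_fin sqr_ge0.
  - by apply: measurable_sqr; exact: measurable_funD.
  - by apply: emeasurable_funD; exact: mZ.
  - move=> t _; rewrite lee_fin -subr_ge0.
    have -> : 2 * f t ^+ 2 + 2 * g t ^+ 2 - (f t + g t) ^+ 2 = (f t - g t) ^+ 2 by ring.
    exact: sqr_ge0.
have := sqint_ge0 f; have := sqint_ge0 g; move: sf sg.
case: (sqint f) (sqint g) => [r| |] [s| |]//=.
by rewrite !lte_fin !lee_fin; lra.
Qed.

Lemma cc_measurable F : cc F -> measurable_fun setT F.
Proof. by move=> [cF _]; exact: continuous_measurable_fun. Qed.

Lemma sqint_cc F : cc F -> sqint F = (dot F F)%:E.
Proof.
move=> cF; have cFF := ccM cF (cc_cont cF).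
have iF := cc_integrable cFF.
rewrite /dot /inner /Rintegral fineK; last exact: integrable_fin_num.
by apply: eq_integral => t _; rewrite expr2.
Qed.

Lemma Lfun2_cc F : cc F -> F \in Lfun mu 2%:E.
Proof.
move=> cF; rewrite inE; apply/andP; split; rewrite inE/=; first exact: cc_measurable.
by rewrite /finite_norm Lnorm2_sqint sqint_cc//= ltry.
Qed.

Lemma Lfun2_measurable f : f \in Lfun mu 2%:E -> measurable_fun setT f.
Proof. by rewrite inE => /andP[]; rewrite inE. Qed.

Lemma cvg0_lt (v : nat -> \bar R) eps : v @ \oo --> 0%E -> 0 < eps ->
  exists m : nat, (v m < eps%:E)%E.
Proof.
move=> /fine_cvgP[fv /cvgrPdist_lt/(_ _)] vl e0.
have [m [vm]] := filter_ex (filterI fv (vl _ e0)).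
rewrite /= sub0r normrN => h; exists m; rewrite -(fineK vm) lte_fin.
exact: le_lt_trans (ler_norm _) h.
Qed.

Definition trunc f (m : nat) t : R :=
  if (`|f t| <= m%:R) && (`|t| <= m%:R) then f t else 0.

Lemma measurable_trunc f m : measurable_fun setT f -> measurable_fun setT (trunc f m).
Proof.
move=> mf.
have -> : trunc f m = fun t => f t * (\1_[set x | `|f x| <= m%:R] t * \1_[set x | `|x| <= m%:R] t).
  apply/funext => t; rewrite /trunc !indicE.
  case: ifPn => [/andP[h1 h2]|]; first by rewrite !mem_set// !mulr1.
  rewrite negb_and => /orP[] h.
    by rewrite [t \in [set x | `|f x| <= _]]memNset/= ?mul0r ?mulr0//; apply/negP.
  by rewrite [t \in [set x | `|x| <= _]]memNset/= ?mulr0//; apply/negP.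
have ms h : measurable_fun setT h -> measurable [set x : R | `|h x| <= m%:R].
  move=> mh; rewrite -[X in measurable X]setTI; apply: measurable_fun_le => //.
  exact: measurableT_comp.
apply: measurable_funM => //; apply: measurable_funM; apply: measurable_indic.
  exact: ms.
exact: (ms id).
Qed.

(** Dominated convergence: the squared error is at most [f^2] and vanishes at [t] once [m] exceeds
    [|f t|] and [|t|]. *)
Lemma trunc_approx f eps : f \in Lfun mu 2%:E -> 0 < eps ->
  exists m, (sqint (fun t => f t - trunc f m t)%R < eps%:E)%E.
Proof.
move=> lf e0; have mf := Lfun2_measurable lf.
have iff' := Lfun2_integrable_sqr lf.
pose F m t := (((f t - trunc f m t) ^+ 2)%:E : \bar R).
have mF m : measurable_fun setT (F m).
  by apply: measurable_sqr; apply: measurable_funB => //; exact: measurable_trunc.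
have := @dominated_convergence _ _ R mu setT measurableT F (fun=> 0%E)
  (EFin \o (fun t => f t ^+ 2)) mF (measurable_cst _) _ iff' _.
case.
- apply: aeW => t _; apply: cvg_near_cst; near=> m.
  rewrite /F /trunc ifT ?subrr ?expr0n//.
  by apply/andP; split; near: m; exact: nbhs_infty_ger.
- apply: aeW => t m _; rewrite /F /trunc gee0_abs ?lee_fin ?sqr_ge0//.
  by case: ifP => _; rewrite ?subr0// subrr expr0n/= sqr_ge0.
move=> _ _; rewrite integral0 => lim.
exact: (cvg0_lt lim e0).
Unshelve. all: by end_near. Qed.

(** A cutoff: 1 on [[-m, m]] and 0 outside [[-m - 1, m + 1]]. *)
Definition tent (m : nat) (t : R) : R := Num.max 0 (Num.min 1 (m.+1%:R - `|t|)).

Definition clip (b x : R) : R := Num.max (- b) (Num.min b x).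

Lemma clip_norm b x : 0 <= b -> `|clip b x| <= `|x|.
Proof.
move=> b0; rewrite /clip; case: (leP b x) => bx.
  by rewrite max_r; [rewrite !ger0_norm; lra|lra].
by case: (leP (- b) x) => h //; rewrite normrN ger0_norm// ltr0_norm; lra.
Qed.

Lemma clip_dist b x y : - b <= y <= b -> `|y - clip b x| <= `|y - x|.
Proof.
move=> yb; rewrite /clip; case: (leP b x) => bx.
  by rewrite max_r; [rewrite !ler0_norm; lra|lra].
by case: (leP (- b) x) => h //; rewrite opprK !ger0_norm; lra.
Qed.

(** From L^1 to L^2: clipping a continuous L^1 approximant to the range of [g] and cutting it off by
    [tent] does not increase the error at any point and bounds it by [2 m], so the squared error is
    controlled by the L^1 error. *)
Lemma bounded_approx g (m : nat) eps : measurable_fun setT g ->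
  (forall t, `|g t| <= m%:R) -> (forall t, m%:R < `|t| -> g t = 0) -> 0 < eps ->
  exists2 G, cc G & (sqint (fun t => g t - G t)%R < eps%:E)%E.
Proof.
move=> mg gm g0 e0.
pose E := `[- m.+1%:R, m.+1%:R]%classic : set R.
have mE : measurable E by exact: measurable_itv.
have muE : (mu E < +oo)%E by rewrite lebesgue_measure_itv/=; case: ifP; rewrite ?ltry.
have ig : mu.-integrable E (EFin \o g).
  apply: measurable_bounded_integrable => //; first exact: measurable_funTS.
  by exists m%:R; split; rewrite ?num_real// => x mx t _; apply: le_trans (gm t) (ltW mx).
have [g_ [cg ig_ lim]] := approximation_continuous_integrable mE muE ig.
(* The summand 1 keeps the factor positive when [m = 0]. *)
have m0 : 0 < 2 * m%:R + 1 :> R by have := ler0n R m; lra.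
have [k hk] := cvg0_lt lim (divr_gt0 e0 m0).
pose cl := clip m%:R.
pose G t := tent m t * cl (g_ k t).
have cG : continuous G.
  apply: continuousMf.
    apply: continuous_maxf; first exact: cst_continuous.
    apply: continuous_minf; first exact: cst_continuous.
    apply: continuousBf; first exact: cst_continuous.
    by move=> t; exact: norm_continuous.
  apply: continuous_maxf; first exact: cst_continuous.
  by apply: continuous_minf; [exact: cst_continuous|exact: cg].
have G0 t : m.+1%:R <= `|t| -> G t = 0.
  move=> h; rewrite /G /tent max_l ?mul0r// ge_min; apply/orP; right; lra.
have ccG : cc G.
  split=> //; exists (- m.+1%:R), m.+1%:R => t h; apply: G0.
  by rewrite ler_normr; case: h => h; apply/orP; [right|left]; lra.
exists G => //.
have mF : measurable_fun setT (fun t => g t - G t).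
  by apply: measurable_funB => //; exact: cc_measurable.
have -> : sqint (fun t => g t - G t) = (\int[mu]_(t in E) ((g t - G t) ^+ 2)%:E)%E.
  rewrite [RHS]integral_mkcond; apply: eq_integral => t _.
  rewrite patchE; case: ifPn => // /negP tE.
  have mt : m.+1%:R < `|t|.
    rewrite ltNge; apply/negP => h; apply: tE.
    by apply: mem_set; rewrite /E /= in_itv/= -ler_norml.
  have mt' : m%:R < `|t| by apply: lt_trans mt; rewrite ltr_nat.
  by rewrite g0 ?G0 ?(ltW mt)// subr0 expr0n.
have ineq t : E t -> (g t - G t) ^+ 2 <= (2 * m%:R + 1) * `|g t - g_ k t|.
  move=> _; rewrite /G -[leLHS]ger0_norm ?sqr_ge0// normrX.
  set x := g_ k t; set y := g t; set s := tent m t.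
  have ym : - m%:R <= y <= m%:R by rewrite -ler_norml; exact: gm.
  have s01 : 0 <= s <= 1 by rewrite /s /tent le_max lexx/= ge_max ler01 ge_min lexx.
  have s1 : s = 1 \/ y = 0.
    have [tm|tm] := leP `|t| m%:R; [left|by right; exact: g0].
    by rewrite /s /tent -natr1 min_l ?max_r//; lra.
  have m0' := ler0n R m.
  have c1 : - m%:R <= cl x <= m%:R by rewrite /cl /clip le_max lexx/= ge_max ge_min lexx; lra.
  have c2 : `|cl x| <= `|x|.
    exact: clip_norm.
  have c3 : `|y - cl x| <= `|y - x| by exact: clip_dist.
  have d1 : `|y - s * cl x| <= `|y - x|.
    have [->|->] := s1; first by rewrite mul1r.
    rewrite !sub0r !normrN normrM; apply: le_trans c2.
    by rewrite ler_piMl// ger0_norm; lra.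
  have d2 : `|y - s * cl x| <= 2 * m%:R.
    have [->|->] := s1; first by rewrite mul1r ler_norml; lra.
    rewrite sub0r normrN normrM; apply: (@le_trans _ _ `|cl x|).
      by rewrite ler_piMl// ger0_norm; lra.
    by rewrite ler_norml; lra.
  rewrite expr2; apply: (@le_trans _ _ (2 * m%:R * `|y - x|)).
    exact: ler_pM.
  by rewrite ler_wpM2r//; lra.
have mgk : measurable_fun E (fun t => `|g t - g_ k t|).
  apply: measurable_funTS; apply: measurableT_comp => //; apply: measurable_funB => //.
  exact: continuous_measurable_fun.
apply: (@le_lt_trans _ _ (\int[mu]_(t in E) ((2 * m%:R + 1) * `|g t - g_ k t|)%:E)%E).
  apply: ge0_le_integral => //.
  - by move=> t _; rewrite lee_fin sqr_ge0.
  - by apply: measurable_funTS; exact: measurable_sqr.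
  - by apply/measurable_EFinP; exact: measurable_funM.
under eq_integral do rewrite EFinM.
rewrite ge0_integralZl_EFin//; last by apply/measurable_EFinP; exact: mgk.
move: hk => /=.
have : (0 <= \int[mu]_(t in E) (`|g t - g_ k t|)%:E)%E by exact: integral_ge0.
case: (\int[mu]_(t in E) _)%E => [r| |]//.
rewrite lee_fin -EFinM !lte_fin => r0 rk.
by rewrite mulrC -ltr_pdivlMr.
Qed.

Lemma cc_approx f eps : f \in Lfun mu 2%:E -> 0 < eps ->
  exists2 G, cc G & (sqint (fun t => f t - G t)%R < eps%:E)%E.
Proof.
move=> lf e0; have e4 : 0 < eps / 4 by lra.
have mf := Lfun2_measurable lf.
have [m hm] := trunc_approx lf e4.
have mt := measurable_trunc m mf.
have [||G cG hG] := bounded_approx (m := m) mt _ _ e4.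
- by move=> t; rewrite /trunc; case: ifP => [/andP[]//|_]; rewrite normr0.
- by move=> t mt'; rewrite /trunc [X in _ && X]leNgt mt' andbF.
exists G => //.
have -> : (fun t => f t - G t) = fun t => (f t - trunc f m t) + (trunc f m t - G t).
  by apply/funext => t; rewrite addrA subrK.
by apply: sqintD_lt => //; apply: measurable_funB => //; exact: cc_measurable.
Qed.

End SquareIntegrals.

(** * Approximation by piecewise linear functions *)

Section HatApproximation.
Context {R : realType} (n : nat).
Hypothesis n3 : (3 <= n)%N.
Implicit Types (F G : R -> R) (t x eps : R).
Local Notation VV := (@VV R n).

Lemma cc_unif_continuous G eps : cc G -> 0 < eps ->
  exists2 d, 0 < d & forall x y, `|x - y| < d -> `|G x - G y| < eps.
Proof.
move=> cG e0; have [a [b [ab sG]]] := cc_supp_lt cG; have [contG _] := cG.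
pose P d x := forall y, `|x - y| < d -> `|G x - G y| < eps.
have /compact_near_coveringP/(_ R (0:R)^'+ P _) : compact `[a - 1, b + 1].
  exact: segment_compact.
case=> [x _|].
  have e2 : 0 < eps / 2 by lra.
  have := contG x; move=> /cvgrPdist_lt/(_ _ e2)/nbhs_ballP[r /= r0 rG].
  have Gr z : `|x - z| < r -> `|G x - G z| < eps / 2 by move=> h; exact: rG.
  exists (ball x (r / 2), [set d | d < r / 2]); first split.
  - by apply: nbhsx_ballx; lra.
  - by apply: nbhs_right_lt; lra.
  move=> [x' d] [/= bx dr] y xy; rewrite -ball_normE/= in bx.
  have h1 := Gr x' (lt_trans bx (ltac:(lra) : r / 2 < r)).
  have h2 : `|x - y| < r.
    rewrite -(subrK x' x) -addrA; apply: le_lt_trans (ler_normD _ _) _; lra.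
  have h3 := Gr y h2.
  rewrite -(subrK (G x) (G x')) -addrA; apply: le_lt_trans (ler_normD _ _) _.
  by rewrite distrC; lra.
(* The bound [d <= 1] handles points outside [[a - 1, b + 1]]: a neighbour closer than [d] also lies
   where [G] vanishes. *)
move=> e /= e0' ee; pose d := Num.min (e / 2) 1.
have d0 : 0 < d by rewrite lt_min; apply/andP; split; lra.
have dP := ee d _ d0.
have d1 : d <= 1 by rewrite ge_min lexx orbT.
have dQ x : a - 1 <= x <= b + 1 -> P d x.
  move=> xab; apply: dP; last by rewrite /= in_itv.
  rewrite /ball_/= sub0r normrN gtr0_norm//.
  by apply: (@le_lt_trans _ _ (e / 2)); [rewrite ge_min lexx|lra].
exists d => // x y xy.
have [xab|xab] := boolP (a - 1 <= x <= b + 1); first exact: dQ.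
have sup z : z <= a \/ b <= z -> G z = 0 by exact: sG.
have xy' : - d < x - y < d by rewrite -ltr_norml.
rewrite negb_and -!ltNge in xab.
by rewrite !sup ?subrr ?normr0//; case/orP: xab => h; [left|right|left|right]; lra.
Qed.

Definition hat t : R := Num.max 0 (1 - `|t|).

Lemma hat_ge0 t : 0 <= hat t. Proof. by rewrite le_max lexx. Qed.

Lemma hat_far t : 1 <= `|t| -> hat t = 0.
Proof. by move=> h; rewrite /hat max_l//; lra. Qed.

Lemma hat_pos t : 0 <= t <= 1 -> hat t = 1 - t.
Proof. by move=> h; rewrite /hat ger0_norm ?max_r//; lra. Qed.

Lemma hat_neg t : -1 <= t <= 0 -> hat t = 1 + t.
Proof. by move=> h; rewrite /hat ler0_norm ?max_r//; lra. Qed.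

Lemma cc_hat : cc hat.
Proof.
split.
  apply: continuous_maxf; first exact: cst_continuous.
  apply: continuousBf; first exact: cst_continuous.
  by move=> t; exact: norm_continuous.
by exists (-1), 1 => t h; apply: hat_far; rewrite ler_normr; case: h => h; apply/orP; [right|left]; lra.
Qed.

Lemma VV_hat : VV hat.
Proof.
split; first exact: cc_hat.
have s2 (p : {poly R}) : (size p <= 2)%N -> (size p <= n.+1)%N.
  by move=> /leq_trans; apply; lia.
move=> i; have [->|i0] := eqVneq i 0.
  apply: (@cell_poly _ _ _ _ (1 - 'X)).
    apply: s2; apply: leq_trans (size_polyD _ _) _.
    by rewrite size_polyN size_poly1 size_polyX.
  by move=> t tt; rewrite !hornerE hat_pos//; lra.
have [->|i1] := eqVneq i (-1).
  apply: (@cell_poly _ _ _ _ (1 + 'X)).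
    by apply: s2; apply: leq_trans (size_polyD _ _) _; rewrite size_poly1 size_polyX.
  by move=> t; rewrite mulrN1z => tt; rewrite !hornerE hat_neg//; lra.
apply: cell0 => t tt; apply: hat_far; rewrite ler_normr; apply/orP.
have [ip|im] : 1 <= i \/ i <= - 2 by lia.
  by left; move: ip; rewrite -(ler_int R); lra.
by right; move: im; rewrite -(ler_int R); lra.
Qed.

(** A partition of unity on [[0, N]]; the slope of the last hat remains up to [N + 1]. *)
Lemma sum_hat (N : nat) t : 0 <= t ->
  \sum_(j < N.+1) hat (t - j%:R) = Num.max 0 (Num.min 1 (N.+1%:R - t)).
Proof.
move=> t0; elim: N => [|N IH].
  rewrite big_ord1 subr0 /hat ger0_norm//; congr (Num.max 0 _).
  by rewrite min_r//; lra.
rewrite big_ord_recr/= IH; have N0 := ler0n R N; rewrite -!natr1.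
have [h1|h1] := leP t (N%:R); first by rewrite hat_far ?ler0_norm; first rewrite !min_l ?addr0//; lra.
have [h2|h2] := leP t (N%:R + 1).
  by rewrite hat_neg; [rewrite [Num.min 1 (_ - _)]min_r ?[Num.min 1 _]min_l ?max_r; lra|lra].
have [h3|h3] := leP t (N%:R + 2).
  rewrite hat_pos; last lra.
  rewrite [Num.max 0 _]max_l ?min_r ?max_r; lra.
by rewrite hat_far ?ger0_norm; first rewrite !min_r ?max_l; lra.
Qed.

(** Piecewise linear interpolation at the multiples of [2^-p]: since the hats sum to 1, the error at
    [t] is an average of differences between [G t] and values of [G] at nodes closer than [2^-p]. *)
Lemma VV_approx G eps : cc G -> 0 < eps -> exists (p : nat) F, VV F /\
  dot (fun t => G t - F (2 ^+ p * t)) (fun t => G t - F (2 ^+ p * t)) < eps.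
Proof.
move=> cG e0; have [M sG] := supp_int cG.
(* With [del <= 1], the squared error over [[-M, M]] is at most [2 M del^2 <= 2 M del < eps]. *)
pose del := Num.min 1 (eps / (2 * M%:R + 1)).
have M0 := ler0n R M.
have del0 : 0 < del by rewrite lt_min ltr01/=; apply: divr_gt0 => //; lra.
have [d d0 unif] := cc_unif_continuous cG del0.
pose p := (Num.trunc d^-1).+1.
have pd : d^-1 < 2 ^+ p.
  have /andP[_ h] := truncn_itv (ltW (ltac:(by rewrite invr_gt0) : 0 < d^-1)).
  apply: lt_trans h _; rewrite -natrX ltr_nat; exact: ltn_expl.
have p0 : 0 < 2 ^+ p :> R by rewrite exprn_gt0//; lra.
pose h : R := (2 ^+ p)^-1.
have hd : h < d by rewrite /h -[ltRHS]invrK ltf_pV2 ?posrE// invr_gt0.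
have hp : 2 ^+ p * h = 1 by rewrite /h mulfV// gt_eqF.
have [N NE] : exists N : nat, N%:R = 2 ^+ p * M%:R :> R.
  by exists (2 ^ p * M)%N; rewrite natrM natrX.
have jN (j : nat) : (j%:Z - N%:Z)%:~R = j%:R - N%:R :> R by rewrite rmorphB.
pose F t : R := \sum_(j < (2 * N).+1) G (h * (j%:R - N%:R)) * hat (t - (j%:Z - N%:Z)%:~R).
exists p, F; have vF : VV F.
  by rewrite /F; apply: VV_sum => j; apply: VVZ; apply: VV_shift => //; exact: VV_hat.
split=> //.
set D := fun t => _.
have cD : cc D.
  apply: ccB => //; have := cc_affine 0 p0 (VV_cc vF).
  by under eq_fun do rewrite addr0.
have err t : - M%:R <= t <= M%:R -> `|D t| <= del.
  move=> tM; rewrite /D.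
  have one : \sum_(j < (2 * N).+1) hat (2 ^+ p * t - (j%:Z - N%:Z)%:~R) = 1.
    have tN : 0 <= 2 ^+ p * t + N%:R.
      by rewrite NE -mulrDr mulr_ge0 ?(ltW p0)//; lra.
    have := sum_hat (2 * N) tN.
    rewrite -[(2 * N).+1%:R]natr1 natrM min_l ?max_r//; last first.
      have : 2 ^+ p * t <= N%:R by rewrite NE ler_wpM2l ?(ltW p0)//; lra.
      by lra.
    move=> E; rewrite -[RHS]E; apply: eq_bigr => j _; congr hat.
    by rewrite jN; ring.
  have one' x : x = \sum_(j < (2 * N).+1) hat (2 ^+ p * t - (j%:Z - N%:Z)%:~R) * x.
    by rewrite -mulr_suml one mul1r.
  rewrite [G t]one' /F -sumrB; apply: le_trans (ler_norm_sum _ _ _) _.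
  rewrite [leRHS]one'; apply: ler_sum => j _.
  rewrite [G _ * _]mulrC -mulrBr normrM ger0_norm ?hat_ge0//.
  set s := _ - (_)%:~R.
  have [s1|s1] := leP 1 `|s|; first by rewrite hat_far// !mul0r.
  rewrite ler_wpM2l ?hat_ge0//; apply: ltW; apply: unif.
  have -> : t - h * (j%:R - N%:R) = h * s.
    by rewrite /s jN [RHS]mulrBr mulrA [h * 2 ^+ p]mulrC hp mul1r.
  rewrite normrM gtr0_norm ?invr_gt0//; apply: le_lt_trans hd.
  by rewrite ler_piMr ?(ltW s1)// invr_ge0 ltW.
have D0 t : t <= - M%:R \/ M%:R <= t -> D t = 0.
  move=> tM; rewrite /D sG// sub0r /F big1 ?oppr0// => j _.
  have jN' : (j <= 2 * N)%N by rewrite -ltnS.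
  have jR0 := ler0n R j; have := ler_nat R j (2 * N); rewrite jN' natrM => jR.
  have [j0|j0] := eqVneq (j : nat) 0%N.
    rewrite sG ?mul0r//; left; rewrite j0 sub0r mulrN NE mulrA [h * _]mulrC hp mul1r; lra.
  have [j1|j1] := eqVneq (j : nat) (2 * N)%N.
    rewrite sG ?mul0r//; right.
    have -> : j%:R - N%:R = N%:R :> R by rewrite j1 natrM; ring.
    by rewrite NE mulrA [h * _]mulrC hp mul1r; lra.
  have j2 : 1 <= j%:R :> R by rewrite ler1n lt0n.
  have j3 : j%:R + 1 <= 2 * N%:R :> R.
    by rewrite natr1 -natrM ler_nat ltn_neqAle j1.
  rewrite [hat _]hat_far ?mulr0// ler_normr jN; apply/orP.
  case: tM => tM; [right|left].
    have : 2 ^+ p * t <= - N%:R by rewrite NE -mulrN ler_wpM2l// ltW.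
    by lra.
  have : N%:R <= 2 ^+ p * t by rewrite NE ler_wpM2l// ltW.
  by lra.
have sD : supp (- M%:R) M%:R D by [].
rewrite (dot_supp _ sD).
have cDD := continuousMf (cc_cont cD) (cc_cont cD).
have MM : - M%:R <= M%:R :> R by lra.
apply: (@le_lt_trans _ _ (itg (- M%:R) M%:R (fun=> del ^+ 2))).
  apply: le_itg => // [|t tM]; first exact: cst_continuous.
  by rewrite -expr2 -[leLHS]ger0_norm ?sqr_ge0// normrX lerXn2r ?nnegrE ?(ltW del0) ?err.
rewrite itg_cst//.
have dm : del * (2 * M%:R + 1) <= eps.
  by rewrite -ler_pdivlMr ?ge_min ?lexx ?orbT//; lra.
have d1 : del <= 1 by rewrite ge_min lexx.
have : del ^+ 2 <= del by rewrite expr2 ler_piMr// ltW.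
nra.
Qed.

End HatApproximation.

(** * Coarse scales *)

Section CoarseScales.
Context {R : realType} (n : nat).
Hypothesis n3 : (3 <= n)%N.
Implicit Types (F G H E : R -> R) (t x a b c eps : R) (i : int) (q l : nat).
Local Notation phit k := (@phit R n k).
Local Notation VV := (@VV R n).
Local Notation vec := 'cV[R]_(n.+1 + n.+1).
Variables vs va : seq vec.
Hypothesis hs : algorithm_run (@sym_form R n) (Emx (@Phi R n)) vs.
Hypothesis ha : algorithm_run (@antisym_form R n) (Emx (@Phi R n)) va.
Local Notation ps := (@psi R n vs va).

Lemma exp2_gt0 q : 0 < 2 ^+ q :> R. Proof. by rewrite exprn_gt0//; lra. Qed.

Lemma VV_halfn q F : VV F -> VV (fun t => F (t / 2 ^+ q)).
Proof.
elim: q F => [|q IH] F vF; first by under eq_fun do rewrite expr0 divr1.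
have := IH _ (VV_half n3 vF); congr (VV _); apply/funext => t.
by rewrite exprS invfM mulrCA [2^-1 * _]mulrC.
Qed.

Lemma VV_psi_coarse j l i : (j <= n)%N -> VV (fun t => ps j (t / 2 ^+ l.+1 - i%:~R)).
Proof.
move=> jn; have := VV_halfn l (VV_shift n3 (2 * i) (psi_half n3 hs ha jn)).
congr (VV _); apply/funext => t; congr (ps j _).
by rewrite exprS rmorphM/=; field; rewrite gt_eqF ?exp2_gt0.
Qed.

(** The wavelets of the [q] levels between [V_(-q)] and [V_0]; [l.+1] is the number of halvings. *)
Definition coarse_wavelet q F := exists j l i, [/\ (j <= n)%N, (l < q)%N &
  F = fun t => ps j (t / 2 ^+ l.+1 - i%:~R)].

Lemma coarse_waveletW q q' F : (q <= q')%N -> coarse_wavelet q F -> coarse_wavelet q' F.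
Proof. by move=> qq [j [l [i [jn lq ->]]]]; exists j, l, i; split=> //; exact: leq_trans qq. Qed.

Lemma coarse_span_cc q E : funspan (coarse_wavelet q) E -> cc E.
Proof.
elim=> [|c F G [j [l [i [jn lq ->]]]] _ cG]; first exact: cc0.
by apply: ccD => //; apply: ccZ; exact: VV_cc (VV_psi_coarse l i jn).
Qed.

(** Rescaled by [2^(l+1)], the coarse function lies in [V_0], because [l < q], and the wavelet is a
    translate of some [psi j]. *)
Lemma coarse_span_VV q E V : funspan (coarse_wavelet q) E -> VV V -> dot E (fun t => V (t / 2 ^+ q)) = 0.
Proof.
move=> sE vV; have cV := VV_cc (VV_halfn q vV).
elim: sE => [|c F G [j [l [i [jn lq ->]]]] sG IH]; first exact: dot0l.
have cP := VV_cc (VV_psi_coarse l i jn).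
rewrite dotDl ?IH ?addr0//; [|exact: ccZ|exact: coarse_span_cc sG].
rewrite dotZl//.
have vW : VV (fun s => V ((s - (- i)%:~R) / 2 ^+ (q - l.+1))).
  exact: (VV_shift n3 (- i) (VV_halfn (q - l.+1) vV)).
have k0 : 0 < (2 ^+ l.+1)^-1 :> R by rewrite invr_gt0 exp2_gt0.
have := dot_affine (- i%:~R) k0 (cc_psi n3 hs ha jn) (VV_cc vW).
rewrite (psi_VV n3 hs ha jn vW) mulr0.
under [X in dot X _]eq_fun do rewrite mulrC.
have -> : (fun t => V (((2 ^+ l.+1)^-1 * t + - i%:~R - (- i)%:~R) / 2 ^+ (q - l.+1))) =
    fun t => V (t / 2 ^+ q).
  apply/funext => t; congr V; rewrite rmorphN opprK addrNK [_^-1 * t]mulrC -mulrA -invfM.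
  by rewrite -exprD addnC subnK.
by move=> ->; rewrite mulr0.
Qed.

Lemma coarse_split F q : VV F -> exists H E, [/\ VV H, funspan (coarse_wavelet q) E &
  forall t, F t = H (t / 2 ^+ q) + E t].
Proof.
move=> vF; elim: q => [|q [H [E [vH sE FE]]]].
  exists F, (fun=> 0); split=> // [|t]; first exact: span0.
  by rewrite expr0 divr1 addr0.
have [H' [E' [vH' sE' HE]]] := VV_double_split n3 hs ha vH.
exists H', (fun t => E' (t / 2 ^+ q.+1) + E t); split=> //.
  apply: spanD; last first.
    have := @span_comp R _ _ id _ _ sE; apply => G gG.
    by apply: span_gen; exact: coarse_waveletW gG.
  have := @span_comp R _ (coarse_wavelet q.+1) (fun t => t / 2 ^+ q.+1) _ _ sE'; apply=> G [j [i [jn ->]]].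
  by apply: span_gen; exists j, q, i.
move=> t; rewrite FE addrA -HE; congr (H _ + _).
by rewrite exprS; field; rewrite gt_eqF ?exp2_gt0.
Qed.

Lemma cc_bounded F : cc F -> exists2 b, 0 <= b & forall t, `|F t| <= b.
Proof.
move=> cF; have [a [b [ab sF]]] := cc_supp_lt cF; have [contF _] := cF.
have /compact_bounded[m [_ mF]] : compact (F @` `[a, b]).
  by apply: continuous_compact; [exact: continuous_subspaceT|exact: segment_compact].
exists (Num.max 0 m + 1); first by rewrite addr_ge0// le_max lexx.
have mm : m < Num.max 0 m + 1 by have : m <= Num.max 0 m by [rewrite le_max lexx orbT]; lra.
move=> t; have [tab|tab] := boolP (a <= t <= b).
  by apply: (mF _ mm); exists t => //; rewrite /= in_itv.
rewrite sF ?normr0 ?addr_ge0 ?le_max ?lexx//.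
by move: tab; rewrite negb_and -!ltNge => /orP[] /ltW; [left|right].
Qed.

Lemma dot_bound F b m : cc F -> supp (- m) m F -> 0 <= m -> (forall t, `|F t| <= b) ->
  forall G b', cc G -> (forall t, `|G t| <= b') -> `|dot F G| <= b * b' * (2 * m).
Proof.
move=> cF sF m0 Fb G b' cG Gb; rewrite (dot_supp _ sF).
have cFG := continuousMf (cc_cont cF) (cc_cont cG).
have mm : - m <= m by lra.
have le t : - (b * b') <= F t * G t <= b * b'.
  by rewrite -ler_norml normrM ler_pM.
have E : b * b' * (2 * m) = itg (- m) m (fun=> b * b') by rewrite itg_cst//; ring.
have EN : - (b * b' * (2 * m)) = itg (- m) m (fun=> - (b * b')) by rewrite itg_cst//; ring.
rewrite ler_norml EN E; apply/andP; split; apply: le_itg => //.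
- exact: cst_continuous.
- by move=> t _; have /andP[] := le t.
- exact: cst_continuous.
- by move=> t _; have /andP[] := le t.
Qed.

(** Only the indices [M - 1], [M] and [M + 1] can contribute. For [M = 0] the truncated [M.-1]
    counts [M] twice, which is harmless in an upper bound. *)
Lemma sum_near_bound (N M : nat) (f : 'I_N -> R) b : 0 <= b -> (forall k, f k <= b) ->
  (forall k : 'I_N, 2 <= `|(- M%:Z + k%:Z)%:~R : R| -> f k = 0) -> \sum_(k < N) f k <= 3 * b.
Proof.
move=> b0 fb f0.
have one m : \sum_(k < N) (k == m :> nat)%:R <= 1 :> R.
  have [mN|mN] := ltnP m N.
    rewrite (bigD1 (Ordinal mN))//= eqxx big1 ?addr0// => k km.
    by case: eqP => // kE; case/negP: km; apply/eqP/val_inj.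
  by rewrite big1 ?ler01// => k _; case: eqP => // kE; have := ltn_ord k; rewrite kE; lia.
apply: (@le_trans _ _ (\sum_(k < N) b * ((k == M.-1 :> nat)%:R + (k == M :> nat)%:R + (k == M.+1 :> nat)%:R))).
  apply: ler_sum => k _.
  have [k1|k1] := boolP [|| (k == M.-1 :> nat), (k == M :> nat) | (k == M.+1 :> nat)].
    apply: le_trans (fb k) _; rewrite ler_peMr//.
    case/or3P: k1 => /eqP ->; rewrite eqxx.
    - by rewrite -addrA lerDl addr_ge0.
    - by rewrite addrAC lerDr addr_ge0.
    - by rewrite lerDr addr_ge0.
  rewrite f0 ?mulr_ge0 ?addr_ge0//.
  have [h|h] : (2 <= - M%:Z + k%:Z \/ - M%:Z + k%:Z <= -2)%R.
      by move: k1; rewrite !negb_or => /and3P[/eqP k1 /eqP k2 /eqP k3]; lia.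
    by rewrite ler_normr; apply/orP; left; move: h; rewrite -(ler_int R).
  by rewrite ler_normr; apply/orP; right; move: h; rewrite -(ler_int R); lra.
rewrite -mulr_sumr !big_split/= mulrC ler_wpM2r//.
by have := one M.-1; have := one M; have := one M.+1; lra.
Qed.

(** Parseval for the orthogonal, not normalized, translates of the [phit k]. *)
Lemma VV_energy H : VV H -> exists (M : nat),
  dot H H = \sum_(k < n.+1) \sum_(i < (2 * M).+1)
    dot H (fun t => phit k (t - (- M%:Z + i%:Z)%:~R)) ^+ 2 / dot (phit k) (phit k).
Proof.
move=> vH; have [M [c [_ HE]]] := VV_expand_sym n3 vH; exists M.
pose g (i : nat) (k : nat) t := phit k (t - (- M%:Z + i%:Z)%:~R).
have cg (i k : nat) : cc (g i k) by exact/cc_shiftB/cc_phit.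
have cH := VV_cc vH.
have HE' : H = fun t => \sum_(i < (2 * M).+1) \sum_(k < n.+1) c i k * g i k t by [].
have coef (i : 'I_(2 * M).+1) (k : 'I_n.+1) : dot H (g i k) = c i k * dot (phit k) (phit k).
  have orth (i' k' : nat) : (k' <= n)%N -> dot (g i' k') (g i k) =
      ((i' == i) && (k' == k))%:R * dot (phit k) (phit k).
    move=> kn'.
    have -> : g i k = fun t => phit k (t + - (- M%:Z + i'%:Z)%:~R - (i%:Z - i'%:Z)%:~R).
      by apply/funext => t; congr (phit k _); rewrite !rmorphD !rmorphN/=; ring.
    have -> := dot_shift (- (- M%:Z + i'%:Z)%:~R) (cc_phit n3 k') (cc_shiftB (i%:Z - i'%:Z)%:~R (cc_phit n3 k)).
    have [ii|ii] := eqVneq i' (i : nat).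
      have -> : (fun t => phit k (t - (i%:Z - i'%:Z)%:~R)) = phit k.
        by apply/funext => t; rewrite ii subrr subr0.
      have [->|kk] := eqVneq k' (k : nat); first by rewrite mul1r.
      have := @phit_orth R n n3 k' k 0 kn' (ltn_ord k); rewrite kk => /(_ isT).
      by under eq_fun do rewrite subr0; rewrite mul0r.
    rewrite phit_orth// ?mul0r//; first exact: (ltn_ord k).
    by apply/orP; right; rewrite subr_eq0 eq_sym; apply/negP => /eqP[]; apply/eqP.
  have kn : (k <= n)%N := ltn_ord k.
  rewrite {1}HE' dot_suml//; last by move=> i'; apply: cc_sum => k'; exact: ccZ.
  rewrite (bigD1 i)//= [X in _ + X]big1 ?addr0 => [|i' ii].
    rewrite dot_suml//; last by move=> k'; exact: ccZ.
    rewrite (bigD1 k)//= [X in _ + X]big1 ?addr0 => [|k' kk].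
      by rewrite dotZl// orth// !eqxx mul1r.
    rewrite dotZl// orth; last exact: (ltn_ord k').
    by rewrite eqxx/= (_ : (k' == k :> nat) = false) ?mul0r ?mulr0//; exact: negbTE.
  rewrite dot_suml//; last by move=> k'; exact: ccZ.
  apply: big1 => k' _; rewrite dotZl// orth; last exact: (ltn_ord k').
  by rewrite (_ : (i' == i :> nat) = false) ?mul0r ?mulr0//; exact: negbTE.
rewrite {2}HE' dot_sumr//; last by move=> i; apply: cc_sum => k; exact: ccZ.
rewrite exchange_big/=; apply: eq_bigr => i _.
rewrite dot_sumr//; last by move=> k; exact: ccZ.
apply: eq_bigr => k _; rewrite dotZr// -/(g i k) coef.
have := @phit_norm_gt0 R n n3 k; set N := dot (phit k) (phit k) => N0.
by field; rewrite gt_eqF.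
Qed.

(* Only the translates by -1, 0, 1 of the functions [phit k (t / 2 ^+ q)] meet the
   support of [F], and their inner products with [F] are bounded independently
   of [q], so the squared norm of the coarse part is [O(2^-q)]. *)
Lemma coarse_approx F eps : VV F -> 0 < eps -> exists q E, funspan (coarse_wavelet q) E /\
  dot (fun t => F t - E t) (fun t => F t - E t) < eps.
Proof.
move=> vF e0; have cF := VV_cc vF; have [m sF] := supp_int cF.
have [b b0 Fb] := cc_bounded cF.
have exC (k : nat) : exists C, 0 <= C /\ forall t, `|phit k t| <= C.
  by have [C] := cc_bounded (cc_phit n3 k); exists C.
have [C CP] := choice exC.
pose D k := b * C k * (2 * m%:R).
have D0 k : 0 <= D k by have [C0 _] := CP k; rewrite !mulr_ge0.
pose nn k := dot (phit k) (phit k).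
have nn0 k : 0 < nn k := phit_norm_gt0 n3 k.
pose S := \sum_(k < n.+1) D k ^+ 2 / nn k.
have S0 : 0 <= S by apply: sumr_ge0 => k _; rewrite divr_ge0 ?sqr_ge0 ?(ltW (nn0 k)).
(* The first bound brings the support of [F], shrunk by [2^q], into [[-1, 1]]; the second makes the
   final estimate [3 S / 2^q] smaller than [eps]. *)
have [q qm qe] : exists2 q, m%:R <= 2 ^+ q :> R & 3 * S < 2 ^+ q * eps.
  exists (maxn m (Num.trunc (3 * S / eps)).+1).
    by rewrite -natrX ler_nat; apply: leq_trans (leq_maxl _ _) (ltnW (ltn_expl _ _)).
  have /andP[_ h] := truncn_itv (divr_ge0 (mulr_ge0 (ltac:(lra) : 0 <= 3 :> R) S0) (ltW e0)).
  rewrite -ltr_pdivrMr//; apply: lt_le_trans h _; rewrite -natrX ler_nat.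
  by apply: leq_trans (leq_maxr _ _) (ltnW (ltn_expl _ _)).
have [H [E [vH sE FE]]] := coarse_split q vF; exists q, E; split=> //.
have cE := coarse_span_cc sE.
have q0 := exp2_gt0 q.
have -> : (fun t => F t - E t) = fun t => H (t / 2 ^+ q).
  by apply/funext => t; rewrite FE addrK.
have scale G G' : cc G -> cc G' ->
    dot (fun t => G (t / 2 ^+ q)) (fun t => G' (t / 2 ^+ q)) = 2 ^+ q * dot G G'.
  move=> cG cG'; have qV : 0 < (2 ^+ q)^-1 :> R by rewrite invr_gt0.
  have := dot_affine 0 qV cG cG'.
  rewrite invrK => <-.
  by congr dot; apply/funext => t; rewrite addr0 mulrC.
rewrite (scale _ _ (VV_cc vH) (VV_cc vH)).
have [M ->] := VV_energy vH.
suff : \sum_(k < n.+1) \sum_(i < (2 * M).+1)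
    dot H (fun t => phit k (t - (- M%:Z + i%:Z)%:~R)) ^+ 2 / nn k <= 3 * S / 2 ^+ q ^+ 2.
  move=> /(ler_wpM2l (ltW q0)) h; apply: le_lt_trans h _.
  rewrite (_ : 2 ^+ q * _ = 3 * S / 2 ^+ q); last by field; rewrite gt_eqF.
  by rewrite ltr_pdivrMr// [eps * _]mulrC.
rewrite /S mulr_sumr mulr_suml; apply: ler_sum => k _.
have [C0 Ck] := CP k.
(* The wavelet part [E] is orthogonal to the coarse space, so the coefficients of [H] can be
   computed from [F], which does not change with [q]. *)
have key i : dot H (fun t => phit k (t - i%:~R)) =
    dot F (fun t => phit k (t / 2 ^+ q - i%:~R)) / 2 ^+ q.
  have vg : VV (fun t => phit k (t - i%:~R)) by apply: VV_shift => //; apply: VV_phit => //; exact: (ltn_ord k).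
  have cH := VV_cc (VV_halfn q vH).
  have -> : F = fun t => H (t / 2 ^+ q) + E t by apply/funext.
  rewrite dotDl//; last exact: VV_cc (VV_halfn q vg).
  rewrite (coarse_span_VV sE vg) addr0 (scale _ _ (VV_cc vH) (VV_cc vg)).
  by field; rewrite gt_eqF.
have -> : 3 * (D k ^+ 2 / nn k) / 2 ^+ q ^+ 2 = 3 * ((D k / 2 ^+ q) ^+ 2 / nn k).
  by field; rewrite !gt_eqF.
apply: (@sum_near_bound _ M).
- by rewrite divr_ge0 ?sqr_ge0// ltW.
- move=> i; rewrite ler_wpM2r ?invr_ge0 ?(ltW (nn0 k))//.
  rewrite -[leLHS]ger0_norm ?sqr_ge0// normrX lerXn2r ?nnegrE ?divr_ge0 ?(ltW q0)//.
  rewrite key normrM [X in _ * X]gtr0_norm ?invr_gt0// ler_wpM2r ?invr_ge0 ?(ltW q0)//.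
  apply: (dot_bound cF sF) => //.
  apply: VV_cc; apply: (VV_halfn q (F := fun t => phit k (t - _))).
  by apply: VV_shift => //; apply: VV_phit => //; exact: (ltn_ord k).
- move=> i i2; rewrite key; set z := (_)%:~R in i2 *.
  rewrite (_ : dot _ _ = 0) ?mul0r ?expr0n/= ?mul0r//.
  apply: dot_disj => t; have [tm|tm] := leP m%:R `|t|.
    by rewrite sF ?mul0r//; move: tm; rewrite ler_normr => /orP[]; [right|left; lra].
  rewrite [phit _ _](@supp_phitW R n n3 k) ?mulr0//.
  have : `|t / 2 ^+ q| <= 1.
    rewrite normrM [X in _ * X]gtr0_norm ?invr_gt0// ler_pdivrMr// mul1r.
    exact: le_trans (ltW tm) qm.
  rewrite ler_norml => h; move: i2; rewrite ler_normr => /orP[] ?; [left|right]; lra.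
Qed.

End CoarseScales.

(** * The basis *)

Section PiecewisePolynomials.
Context {R : realType}.
Implicit Types (f g : R -> R) (p : {poly R}) (a b c k t x : R).
Local Notation pp := (@piecewise_polynomial R).

Lemma pp_poly p : pp (fun t => p.[t]).
Proof. by exists [::] => I _ _; exists p. Qed.

Lemma ppD f g : pp f -> pp g -> pp (fun t => f t + g t).
Proof.
move=> [s fP] [s' gP]; exists (s ++ s') => I iI Is.
have [|p pE] := fP I iI; first by move=> x xs; apply: Is; rewrite mem_cat xs.
have [|q qE] := gP I iI; first by move=> x xs; apply: Is; rewrite mem_cat xs orbT.
by exists (p + q) => x Ix; rewrite hornerD pE// qE.
Qed.

Lemma ppZ c f : pp f -> pp (fun t => c * f t).
Proof.
move=> [s fP]; exists s => I iI Is; have [p pE] := fP I iI Is.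
by exists (c *: p) => x Ix; rewrite hornerZ pE.
Qed.

Lemma pp_sum (T : Type) (s : seq T) (F : T -> R -> R) :
  (forall i, pp (F i)) -> pp (fun t => \sum_(i <- s) F i t).
Proof.
move=> cF; elim: s => [|i s IH].
  under eq_fun do rewrite big_nil; have := pp_poly 0.
  by under eq_fun do rewrite horner0.
by under eq_fun do rewrite big_cons; exact: ppD.
Qed.

Lemma pp_affine k c f : 0 < k -> pp f -> pp (fun t => f (k * t + c)).
Proof.
move=> k0 [s fP]; exists [seq (x - c) / k | x <- s] => I iI Is.
have kK x : k * ((x - c) / k) + c = x by field; rewrite gt_eqF.
have [||p pE] := fP [set x | I ((x - c) / k)].
- move=> x y /= Ix Iy z /andP[xz zy]; apply: (iI _ _ Ix Iy).
  by rewrite !ler_pM2r ?invr_gt0// !lerD2r xz zy.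
- by move=> x xs; apply: Is; exact: map_f.
exists (p \Po (k *: 'X + c%:P)) => x Ix; rewrite horner_comp !hornerE.
by rewrite -pE//= addrK mulrC mulKf// gt_eqF.
Qed.

(** With [a] and [b] among the break points, an admissible interval lies inside [[a, b)] or misses
    it. *)
Lemma pp_cond a b f g : a <= b -> pp f -> pp g ->
  pp (fun t => if (a <= t) && (t < b) then f t else g t).
Proof.
move=> ab [s fP] [s' gP]; exists ([:: a; b] ++ s ++ s') => I iI Is.
have [|p pE] := fP I iI; first by move=> x xs; apply: Is; rewrite !mem_cat xs !orbT.
have [|q qE] := gP I iI; first by move=> x xs; apply: Is; rewrite !mem_cat xs !orbT.
have Ia : ~ I a by apply: Is; rewrite inE eqxx.
have Ib : ~ I b by apply: Is; rewrite !inE eqxx orbT.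
have [[x Ix xab]|no] := pselect (exists2 x, I x & (a <= x) && (x < b)); last first.
  by exists q => x Ix; rewrite -qE//; case: ifPn => // xab; case: no; exists x.
have /andP[ax xb] := xab.
exists p => y Iy; rewrite -pE//; case: ifPn => //.
rewrite negb_and -leNgt -ltNge => /orP[ya|by_].
  by case: Ia; apply: (iI _ _ Iy Ix); rewrite (ltW ya).
by case: Ib; apply: (iI _ _ Ix Iy); rewrite (ltW xb).
Qed.

Lemma pp_split f p q : (forall x, 0 <= x -> f x = p.[x]) -> (forall x, x <= 0 -> f x = q.[x]) ->
  pp f.
Proof.
move=> fp fq; exists [:: 0] => I iI I0; have {}I0 : ~ I 0 by apply: I0; rewrite inE.
have [[x Ix x0]|no] := pselect (exists2 x, I x & 0 <= x).
  exists p => y Iy; have [y0|y0] := leP 0 y; first exact: fp.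
  by case: I0; apply: (iI _ _ Iy Ix); rewrite (ltW y0).
by exists q => y Iy; apply: fq; have [y0|y0] := leP 0 y; [case: no; exists y|exact: ltW].
Qed.

Lemma cc_compactly_supported f : cc f -> compactly_supported f.
Proof.
move=> [_ [a [b sf]]]; apply: (@subclosed_compact _ _ `[a, b]).
- exact: closed_closure.
- exact: segment_compact.
have : closure [set x | f x != 0] `<=` closure `[a, b].
  apply: closure_subset => x /= fx; rewrite in_itv/=.
  by apply/negPn/negP => xab; move: fx; rewrite sf ?eqxx//; move: xab;
    rewrite negb_and -!ltNge => /orP[] /ltW; [left|right].
by rewrite -(closure_id `[a, b]).1//; exact: interval_closed.
Qed.

End PiecewisePolynomials.

(** * The wavelets of all scales *)

Section WaveletBasis.
Context {R : realType} (n : nat).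
Hypothesis n3 : (3 <= n)%N.
Notation mu := (@lebesgue_measure R).
Implicit Types (F G H E : R -> R) (t a b c eps : R) (i k : int).
Local Notation VV := (@VV R n).
Local Notation vec := 'cV[R]_(n.+1 + n.+1).
Local Notation pp := (@piecewise_polynomial R).
Variables vs va : seq vec.
Hypothesis hs : algorithm_run (@sym_form R n) (Emx (@Phi R n)) vs.
Hypothesis ha : algorithm_run (@antisym_form R n) (Emx (@Phi R n)) va.
Local Notation ps := (@psi R n vs va).
Local Notation idx := ('I_n.+1 * int * int)%type.

Lemma pp_inW H : inW n H -> pp H.
Proof.
move=> [p [c [_ HE]]]; have -> : H = fun x => p.[x] + c * w n x by apply/funext.
apply: ppD; first exact: pp_poly.
apply: ppZ; have [q _ qE] := @w_poly_pos R n n3; have [q' _ q'E] := @w_poly_neg R n n3.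
exact: pp_split qE q'E.
Qed.

Lemma pp_phit (k : nat) : (k <= n)%N -> pp (phit n k).
Proof.
move=> kn; have pp0 : pp (fun=> 0).
  by have := pp_poly (0 : {poly R}); under eq_fun do rewrite horner0.
have two : 0 < 2 :> R by lra.
case: k kn => [|k] kn; rewrite /phit /=.
  apply: pp_cond; [lra| |by apply: pp_cond => //;
    apply: (@pp_affine _ 2 (-1)) => //; apply: pp_inW; exact: inW_q_l].
  by apply: pp_affine => //; apply: pp_inW; exact: inW_q_r.
apply: pp_cond => //.
have := @inW_bas R n n3 k.+1 kn; rewrite /bas => /pp_inW.
by case: ifP => _; exact: pp_affine.
Qed.

Lemma pp_VV F : VV F -> pp F.
Proof.
move=> vF; have [M [c [_ ->]]] := VV_expand_sym n3 vF.
apply: pp_sum => i; apply: pp_sum => k; apply: ppZ.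
have := pp_affine (- (- M%:Z + (i : nat)%:Z)%:~R) (@ltr01 R) (pp_phit (ltn_ord k : (k <= n)%N)).
by under eq_fun do rewrite mul1r.
Qed.

Definition wavelet (x : idx) t : R := let: (j, k, i) := x in ps j (2 ^ k * t - i%:~R).

Lemma exp2z_gt0 k : 0 < 2 ^ k :> R. Proof. by rewrite exprz_gt0//; lra. Qed.

Lemma cc_wavelet x : cc (wavelet x).
Proof.
case: x => [[j k] i]; rewrite /wavelet; apply: (cc_affine (- i%:~R) (exp2z_gt0 k)).
exact: (cc_psi n3 hs ha (ltn_ord j)).
Qed.

Lemma pp_wavelet x : pp (wavelet x).
Proof.
case: x => [[j k] i]; rewrite /wavelet; apply: (pp_affine (- i%:~R) (exp2z_gt0 k)).
have := pp_affine 0 (ltac:(lra) : 0 < 2 :> R) (pp_VV (psi_half n3 hs ha (ltn_ord j : (j <= n)%N))).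
by congr pp; apply/funext => t; congr (ps j _); field.
Qed.

Lemma wavelet_norm_gt0 x : 0 < dot (wavelet x) (wavelet x).
Proof.
case: x => [[j k] i]; have jn : (j <= n)%N := ltn_ord j; have cj := cc_psi n3 hs ha jn.
rewrite /wavelet (dot_affine (- i%:~R) (exp2z_gt0 k) cj cj) mulr_gt0 ?invr_gt0 ?exp2z_gt0//.
exact: psi_norm_gt0.
Qed.

(** Seen from the finer scale [k'], a wavelet of a strictly coarser scale is a function of [V_0], to
    which every [psi j'] is orthogonal; on equal scales it is a translate of [psi j]. *)
Lemma wavelet_orth_le (j j' : 'I_n.+1) k k' i i' : k <= k' -> (j, k, i) <> (j', k', i') ->
  dot (wavelet (j', k', i')) (wavelet (j, k, i)) = 0.
Proof.
move=> kk ne; have jn : (j <= n)%N := ltn_ord j; have jn' : (j' <= n)%N := ltn_ord j'.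
have [G [cG GE G0]] : exists G, [/\ cc G, (forall t, wavelet (j, k, i) t = G (2 ^ k' * t - i'%:~R)) &
    dot (ps j') G = 0].
  have [kE|kE] := eqVneq k k'.
    exists (fun t => ps j (t - (i - i')%:~R)); split.
    - exact/cc_shiftB/(cc_psi n3 hs ha).
    - by move=> t; rewrite /wavelet kE; congr (ps j _); rewrite rmorphB/=; ring.
    - apply: (psi_orth n3 hs ha) => //; rewrite subr_eq0 -negb_and; apply/negP => /andP[/eqP jj /eqP ii].
      by apply: ne; rewrite kE ii; congr (_, _, _); exact: val_inj.
  have [l lE] : exists l : nat, k' = k + l.+1%:Z by exists (`|k' - k|.-1)%N; lia.
  have v1 := VV_shift n3 (- i') (VV_psi_coarse n3 hs ha l i jn).
  exists (fun s => ps j ((s - (- i')%:~R) / 2 ^+ l.+1 - i%:~R)); split.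
  - exact: VV_cc v1.
  - move=> t; rewrite /wavelet; congr (ps j (_ - _)).
    rewrite rmorphN opprK subrK lE expfzDr ?pnatr_eq0// -exprnP.
    by field; rewrite gt_eqF// exprn_gt0//; lra.
  - exact: (psi_VV n3 hs ha).
have -> : wavelet (j, k, i) = fun t => G (2 ^ k' * t - i'%:~R) by apply/funext.
by rewrite /wavelet (dot_affine (- i'%:~R) (exp2z_gt0 k') (cc_psi n3 hs ha jn') cG) G0 mulr0.
Qed.

Lemma wavelet_orth x y : x <> y -> dot (wavelet x) (wavelet y) = 0.
Proof.
case: x y => [[j k] i] [[j' k'] i'] ne; have [kk|kk] := leP k k'.
  by rewrite dotC wavelet_orth_le.
by rewrite wavelet_orth_le ?(ltW kk)// => E; apply: ne.
Qed.

(** A generator used several times is merged into one term, so that the coefficient can be a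
    function of the index. *)
Lemma funspan_combination (I : eqType) (e : I -> R -> R) F :
  funspan (fun G => exists i : I, G = e i) F ->
  exists (s : seq I) (c : I -> R), uniq s /\ forall t, F t = \sum_(i <- s) c i * e i t.
Proof.
elim=> [|d _ G [i0 ->] _ [s [c [us GE]]]].
  by exists [::], (fun=> 0); split=> // t; rewrite big_nil.
have [i0s|i0s] := boolP (i0 \in s).
  exists s, (fun i : I => (if i == i0 then d else 0) + c i); split=> // t.
  under eq_bigr do rewrite mulrDl.
  rewrite big_split/= -GE (bigD1_seq i0)//= eqxx [X in _ = _ + X + _]big1 ?addr0// => i ii.
  by rewrite (negbTE ii) mul0r.
exists (i0 :: s), (fun i : I => if i == i0 then d else c i); split=> [|t]; first by rewrite /= i0s.
rewrite big_cons eqxx GE; congr (_ + _); apply: eq_big_seq => i is_.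
by case: eqP => // ii; rewrite -ii is_ in i0s.
Qed.

Lemma wavelet_dense f eps : f \in Lfun mu 2%:E -> 0 < eps -> exists (s : seq idx) (c : idx -> R),
  ('N[mu]_(2%:E)[EFin \o (fun t => f t - \sum_(i <- s) c i * wavelet i t)%R] < eps%:E)%E.
Proof.
move=> lf e0; pose d := eps ^+ 2; have d0 : 0 < d by rewrite exprn_gt0.
have d4 : 0 < d / 4 by lra.
(* Three errors are added by two nested uses of [sqintD_lt], each of which divides by 4. *)
have d16 : 0 < d / 4 / 4 by lra.
have [G cG fG] := cc_approx lf d4.
have [p [F [vF GF]]] := VV_approx n3 cG d16.
have [q [E [sE FE]]] := coarse_approx n3 hs ha vF d16.
have p0 : 0 < 2 ^+ p :> R by rewrite exprn_gt0//; lra.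
have sE' : funspan (fun G => exists i : idx, G = wavelet i) (fun t => E (2 ^+ p * t)).
  apply: (@span_comp _ _ _ (fun t => 2 ^+ p * t) _ _ sE) => _ [j [l [i [jn _ ->]]]].
  (* Dilation by [2^p] moves the scale [-(l+1)] to [p - (l+1)], which can have either sign. *)
  apply: span_gen; exists (Ordinal (jn : (j < n.+1)%N), p%:Z - l.+1%:Z, i).
  apply/funext => t; rewrite /wavelet/=; congr (ps j (_ - _)).
  by rewrite expfzDr ?pnatr_eq0// -exprnP -exprnN; ring.
have [s [c [_ cE]]] := funspan_combination sE'; exists s, c.
have -> : (fun t => f t - \sum_(i <- s) c i * wavelet i t) = fun t =>
    (f t - G t) + ((G t - F (2 ^+ p * t)) + (F (2 ^+ p * t) - E (2 ^+ p * t))).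
  by apply/funext => t; rewrite -cE; ring.
have cscale H : cc H -> cc (fun t => H (2 ^+ p * t)).
  by move=> /(cc_affine 0 p0); under eq_fun do rewrite addr0.
have cF := cscale _ (VV_cc vF); have cEE := coarse_span_cc n3 hs ha sE.
have cE' := cscale _ cEE.
have c1 := ccB cG cF; have c2 := ccB cF cE'.
apply: Lnorm2_lt => //; apply: sqintD_lt => //.
- by apply: measurable_funB; [exact: Lfun2_measurable|exact: cc_measurable].
- exact: (cc_measurable (ccD c1 c2)).
apply: sqintD_lt; [exact: cc_measurable|exact: cc_measurable| |].
  by rewrite sqint_cc// lte_fin.
rewrite sqint_cc// lte_fin; apply: le_lt_trans FE.
have cFE := ccB (VV_cc vF) cEE.
have := dot_affine 0 p0 cFE cFE.
have -> : (fun t => F (2 ^+ p * t + 0) - E (2 ^+ p * t + 0)) =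
    fun t => F (2 ^+ p * t) - E (2 ^+ p * t) by apply/funext => t; rewrite addr0.
(* The dilation divides the squared norm by [2^p >= 1]. *)
move=> ->; rewrite ler_piMl ?dot_ge0// invf_le1// exprn_ege1//; lra.
Qed.

End WaveletBasis.

Theorem theorem22 (R : realType) (n : nat) (hn : (3 <= n)%N)
    (vs va : seq 'cV[R]_(n.+1 + n.+1))
    (hs : algorithm_run (@sym_form R n) (Emx (@Phi R n)) vs)
    (ha : algorithm_run (@antisym_form R n) (Emx (@Phi R n)) va) :
  size (vs ++ va) = n.-1 /\
  let e (x : 'I_n.+1 * int * int) (t : R) : R :=
    let: (j, k, i) := x in psi vs va j (2 ^ k * t - i%:~R) in
  L2_orthogonal_basis e /\
  forall x, [/\ compactly_supported (e x), continuous (e x)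
                & piecewise_polynomial (e x)].
Proof.
split; first exact: size_wavelets.
move=> e; have cx := cc_wavelet hn hs ha; split; last first.
  move=> x; split; [exact/cc_compactly_supported/cx|exact/cc_cont/cx|].
  exact: (pp_wavelet hn hs ha).
split.
- by move=> x; exact/Lfun2_cc/cx.
- by move=> x; rewrite gt_eqF//; exact: (wavelet_norm_gt0 hn hs ha).
- by move=> x y; exact: (wavelet_orth hn hs ha).
- by move=> f lf eps; exact: (wavelet_dense hn hs ha).
Qed.
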